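(* Let $\xi=(\xi_t)_{t\ge0}$ be a real-valued Lévy process started at $0$ (law $\mathbb{P}$) such that $\mu:=\mathbb{E}[\xi_1]\in(0,\infty)$, $\xi$ has local times, and $\xi$ is not a compound Poisson process. Let $f:\mathbb{R}\to[0,\infty)$ be a measurable, locally integrable function. Then $\mathbb{P}\big(\int_0^\infty f(\xi_s)\,ds<\infty\big)\in\{0,1\}$, and more precisely $$\mathbb{P}\Big(\int_0^\infty f(\xi_s)\,ds<\infty\Big)=1 \iff \int_a^\infty f(x)\,dx<\infty \text{ for some } a\in\mathbb{R},$$ $$\mathbb{P}\Big(\int_0^\infty f(\xi_s)\,ds<\infty\Big)=0 \iff \int_a^\infty f(x)\,dx=\infty \text{ for some (equivalently all) } a\in\mathbb{R}.$$
   Context: A Lévy process $\xi$ is said to have local times if there is a family $(L_t(x))_{t\ge0,x\in\mathbb{R}}$ of random variables such that for every bounded measurable $g:\mathbb{R}\to[0,\infty)$ the occupation time formula $\int_0^t g(\xi_s)\,ds=\int_{\mathbb{R}} g(x)L_t(x)\,dx$ holds almost surely for all $t\ge0$; equivalently, with characteristic exponent $\Psi(\lambda)=-\log\mathbb{E}[e^{i\lambda\xi_1}]$, one has $\int_{-\infty}^\infty \mathrm{Re}\big(\frac{1}{1+\Psi(r)}\big)\,dr<\infty$. *)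

(* Defs.v *)
From HB Require Import structures.
From mathcomp Require Import all_boot all_order all_algebra.
From mathcomp Require Import all_classical all_reals all_analysis.
Set Implicit Arguments. Unset Strict Implicit. Unset Printing Implicit Defensive.
Import Order.TTheory GRing.Theory Num.Theory.
Import numFieldNormedType.Exports.
Local Open Scope classical_set_scope.
Local Open Scope ring_scope.

(* A real-valued stochastic process indexed by time t >= 0 (values of X at
   negative times are irrelevant) on the probability space (T, P). *)

Definition levy_process (R : realType) (d : measure_display)
    (T : measurableType d) (P : probability T R) (X : R -> T -> R) : Prop :=
  [/\ (forall w, X 0 w = 0),
      (forall t, 0 <= t -> measurable_fun setT (X t)),
      (forall w t, 0 <= t ->
          (fun s => X s w) @ t^'+ --> X t w /\
          (0 < t -> cvg ((fun s => X s w) @ t^'-))),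
      (forall s t (B : set R), 0 <= s -> 0 <= t -> measurable B ->
          P [set w | X (s + t) w - X s w \in B] = P [set w | X t w \in B])
    & (forall (n : nat) (tt : nat -> R) (B : nat -> set R),
          0 <= tt 0%N ->
          (forall i, (i < n)%N -> tt i <= tt i.+1) ->
          (forall i, measurable (B i)) ->
          P (\bigcap_(i in [set i | (i < n)%N])
               [set w | X (tt i.+1) w - X (tt i) w \in B i]) =
          (\prod_(i < n) P [set w | (X (tt i.+1) w - X (tt i) w)%R \in B i])%E)].

Definition has_local_times (R : realType) (d : measure_display)
    (T : measurableType d) (P : probability T R) (X : R -> T -> R) : Prop :=
  exists L : R -> R -> T -> R,
    (forall t x, 0 <= t -> measurable_fun setT (L t x)) /\
    forall g : R -> R, measurable_fun setT g -> (forall x, 0 <= g x) ->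
      (exists M : R, forall x, g x <= M) ->
      {ae P, forall w, forall t : R, (0 <= t)%R ->
         (\int[lebesgue_measure]_(s in `[0%R, t]) (g (X s w))%:E =
          \int[lebesgue_measure]_(x in setT) (g x * L t x w)%:E)%E}.

(* The law of X 1 is a compound Poisson distribution: there are a rate c >= 0
   and a probability measure sigma on R with sigma {0} = 0 such that the
   characteristic function of X 1 is u |-> exp(c (hat sigma(u) - 1)).
   Written via real and imaginary parts:
     E[cos(u X1)] = exp(c (int cos(ux) sigma(dx) - 1)) cos(c int sin(ux) sigma(dx))
     E[sin(u X1)] = exp(c (int cos(ux) sigma(dx) - 1)) sin(c int sin(ux) sigma(dx)).
   A Lévy process is a compound Poisson process iff X 1 has such a law. *)
Definition compound_poisson (R : realType) (d : measure_display)
    (T : measurableType d) (P : probability T R) (X : R -> T -> R) : Prop :=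
  exists (c : R) (sigma : probability R R),
    0 <= c /\ sigma [set 0] = 0%E /\
    forall u : R,
      let re := Rintegral sigma setT (fun x => cos (u * x)) in
      let im := Rintegral sigma setT (fun x => sin (u * x)) in
      Rintegral P setT (fun w => cos (u * X 1 w)) =
        expR (c * (re - 1)) * cos (c * im) /\
      Rintegral P setT (fun w => sin (u * X 1 w)) =
        expR (c * (re - 1)) * sin (c * im).

Definition perpetual_finite (R : realType) (d : measure_display)
    (T : measurableType d) (X : R -> T -> R) (f : R -> R) : set T :=
  [set w | (\int[lebesgue_measure]_(s in `[0%R, +oo[) (f (X s w))%:E < +oo)%E].

(* Main.v *)
(* Independence is only ever used at deterministic times, through the sequence of
   values of the path at dyadic times, from which right continuity recovers the path.

   Since E[X_1] > 0, Garsia's maximal inequality puts the path above a line a s - b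
   with a, b > 0, so the potential measure U (the expected occupation measure of the
   half-line of times) is finite on intervals. The occupation measure of [0, 1] has a
   density, so with probability at least 1/2 the time spent within e of the starting
   point is O(e); hence U is at most C times Lebesgue measure. If f is integrable at
   infinity, then its restriction to [-b, oo) has finite U-integral for every b, and the
   perpetual integral is almost surely finite.

   Conversely, U charges every long interval far to the right, because a path with
   integrable jumps cannot overshoot a long interval too often. The law of X
   averaged over [0, 1] is at most U, so it has a bounded density and dominates a
   multiple of Lebesgue measure on a set of positive measure; convolving it with itself
   spreads this lower bound over long intervals, and U >= c Leb on some [x, oo).
   The second moment bound E[A_B^2] <= 2 (C |B|)^2 for the occupation time A_B makes
   such a lower bound survive restriction to any event of probability near 1. If the
   perpetual integral is finite with positive probability, approximating this event
   by one depending on finitely many coordinates gives a shift x for which the integral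
   of f(x + X) is finite, hence bounded, with probability near 1; so f is integrable
   at infinity. *)
Require Import Defs.
From HB Require Import structures.
From mathcomp Require Import all_boot all_order all_algebra.
From mathcomp Require Import all_classical all_reals all_analysis.
From mathcomp Require Import measurable_realfun lra ring.
Set Implicit Arguments. Unset Strict Implicit. Unset Printing Implicit Defensive.
Import Order.TTheory GRing.Theory Num.Theory.
Import numFieldNormedType.Exports.
Local Open Scope classical_set_scope.
Local Open Scope ring_scope.

(** No stopping time occurs. Where one would restart a path at its first entrance into a set, all
    visits followed by a favourable future are integrated over time, and the time spent after the
    earliest of them bounds the total; an event of probability one half then costs only a factor 2.
    The local time gives a density in a weak sense only: no sign and no measurability in space are
    assumed of it, its identity has an exceptional null set for each test function, and the density
    obtained on a path is integrable rather than bounded. The bound on the time near the starting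
    point must nevertheless be uniform over all scales [2 ^- n]; it comes from averaging over the
    starting time in [[0, 1]], most of which is spent at levels where the density is moderate. In
    the converse, the probability of a finite integral may a priori depend on the starting point.
    One shift with probability near 1 is enough, because integrability at infinity is insensitive to
    translations, and because the required nearness, [rare], depends on the two constants comparing
    the potential measure with Lebesgue measure and not on [f]. *)

Section image_measure.
Context d d' (T : measurableType d) (T' : measurableType d') (R : realType).
Variables (m : {measure set T -> \bar R}) (f : T -> T').
Hypothesis mf : measurable_fun setT f.

Definition image_measure : {measure set T' -> \bar R} :=
  measure_function_pushforward__canonical__measure_function_Measure m mf.

Lemma image_measureE A : image_measure A = m (f @^-1` A).
Proof. by []. Qed.

Lemma ge0_integral_image (g : T' -> \bar R) : measurable_fun setT g ->
  (forall y, 0 <= g y)%E ->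
  (\int[image_measure]_y g y = \int[m]_x g (f x))%E.
Proof. by move=> mg g0; rewrite ge0_integral_pushforward// preimage_setT. Qed.

Lemma measurable_preimage A : measurable A -> measurable (f @^-1` A).
Proof. by move=> mA; rewrite -[X in measurable X]setTI; exact: mf. Qed.

End image_measure.

(** * Sequence space and independence of increments *)

Section rseq.
Context (R : realType).

Definition cylinder : set (set (nat -> R)) :=
  [set C | exists (n : nat) (B : nat -> set R), (forall i, measurable (B i)) /\
     C = [set y | forall i, (i < n)%N -> B i (y i)]].

Definition rseq := g_sigma_algebraType cylinder.

Lemma cylinder_setI : setI_closed cylinder.
Proof.
move=> A A' [n [B [mB ->]]] [n' [B' [mB' ->]]].
exists (maxn n n'), (fun i => (if (i < n)%N then B i else setT) `&`
                              (if (i < n')%N then B' i else setT)); split.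
  by move=> i; apply: measurableI; case: ifP.
apply/seteqP; split => [y [h h'] i|y h].
  by move=> _; split; case: ifP => // ii; [apply: h|apply: h'].
split=> i ii; have := h i; rewrite leq_max ii ?orbT => /(_ isT) [].
  by [].
by [].
Qed.

Lemma cylinderT : cylinder setT.
Proof. by exists 0%N, (fun=> setT); split=> //; apply/seteqP; split. Qed.

Lemma measurable_cylinder (A : set rseq) : cylinder A -> measurable A.
Proof. exact: sub_gen_smallest. Qed.

Lemma measurable_coord i : measurable_fun setT (fun y : rseq => y i : R).
Proof.
move=> _ B mB; rewrite setTI; apply: measurable_cylinder.
exists i.+1, (fun j => if j == i then B else setT); split.
  by move=> j; case: ifP.
apply/seteqP; split => [y /= By j|y /= /(_ i (ltnSn i))].
  by case: eqP => // -> _.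
by rewrite eqxx.
Qed.

Lemma measurable_rseq d (T : measurableType d) (f : T -> rseq) :
  (forall i, measurable_fun setT (fun w => f w i)) -> measurable_fun setT f.
Proof.
move=> mf; apply: (@measurability _ _ _ _ setT f cylinder) => //.
move=> _ [_ [n [B [mB ->]]] <-]; rewrite setTI.
have -> : f @^-1` [set y | forall i, (i < n)%N -> B i (y i)] =
  \bigcap_(i in [set i | (i < n)%N]) ((fun w => f w i) @^-1` B i).
  by apply/seteqP; split=> w h i; exact: h.
apply: fin_bigcap_measurable => [|i _]; first exact: finite_II.
by rewrite -[X in measurable X]setTI; exact: mf.
Qed.

Lemma measurable_coord_comp d (T : measurableType d) (f : T -> rseq) i :
  measurable_fun setT f -> measurable_fun setT (fun w => f w i : R).
Proof. by move=> mf; exact: (measurableT_comp (measurable_coord i) mf). Qed.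

(** The cylinders form a generating pi-system that contains the whole space, so finite total mass is
    enough for uniqueness. *)
Lemma rseq_measure_unique (m1 m2 : {measure set rseq -> \bar R}) :
  (m1 setT < +oo)%E -> (forall A, cylinder A -> m1 A = m2 A) ->
  forall A, measurable A -> m1 A = m2 A.
Proof.
move=> moo m12; apply: (@measure_unique _ R rseq cylinder (fun=> setT)) => //.
- exact: cylinder_setI.
- by move=> _; exact: cylinderT.
- by apply/seteqP; split=> // x _; exists 0%N.
Qed.

Section independence.
Context d (T : measurableType d) (P : probability T R).
Variables (U V V0 : T -> rseq).
Hypotheses (mU : measurable_fun setT U) (mV : measurable_fun setT V)
  (mV0 : measurable_fun setT V0).
Hypothesis UV : forall A B, cylinder A -> cylinder B ->
  (P (U @^-1` A `&` V @^-1` B) = P (U @^-1` A) * P (V0 @^-1` B))%E.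

(** Two uniqueness steps: for a cylinder [B] both sides are finite measures in [A] that agree on
    cylinders; then, for any measurable [A], the same holds in [B]. Since [V0] enters only through
    its law, independence of [U] and [V] and equality in law of [V] and [V0] are carried along
    together. *)
Lemma rseq_indep A B : measurable A -> measurable B ->
  (P (U @^-1` A `&` V @^-1` B) = P (U @^-1` A) * P (V0 @^-1` B))%E.
Proof.
move=> mA.
have fP (C : set T) : measurable C -> P C \is a fin_num.
  by move=> mC; rewrite fin_num_measure.
have mpre (W : T -> rseq) (C : set rseq) : measurable_fun setT W -> measurable C ->
    measurable (W @^-1` C : set T).
  by move=> mW mC; exact: measurable_preimage.
have step1 (B' : set rseq) : cylinder B' -> forall A' : set rseq, measurable A' ->
    P (U @^-1` A' `&` V @^-1` B') = (P (U @^-1` A') * P (V0 @^-1` B'))%E.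
  move=> cB A' mA'; have mB' := measurable_cylinder cB.
  have mVB := mpre _ _ mV mB'.
  have r0 : (0 <= fine (P (V0 @^-1` B')))%R by rewrite fine_ge0.
  pose m1 := image_measure (mrestr P mVB) mU.
  pose m2 : {measure set rseq -> \bar R} := mscale (NngNum r0) (image_measure P mU).
  have m1E C : m1 C = P (U @^-1` C `&` V @^-1` B') by [].
  have m2E C : m2 C = (P (U @^-1` C) * (fine (P (V0 @^-1` B')))%:E)%E.
    by rewrite muleC.
  suff : m1 A' = m2 A' by rewrite m1E m2E fineK// fP//; exact: mpre.
  apply: rseq_measure_unique => //.
  - rewrite m1E preimage_setT setTI -ge0_fin_numE ?fP//; exact: mpre.
  - move=> A0 cA0; rewrite m1E m2E UV// fineK ?fP//; exact: mpre.
move=> mB.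
have mUA := mpre _ _ mU mA.
have r0 : (0 <= fine (P (U @^-1` A)))%R by rewrite fine_ge0.
pose m1 := image_measure (mrestr P mUA) mV.
pose m2 : {measure set rseq -> \bar R} := mscale (NngNum r0) (image_measure P mV0).
have m1E C : m1 C = P (U @^-1` A `&` V @^-1` C).
  by rewrite setIC.
have m2E C : m2 C = ((fine (P (U @^-1` A)))%:E * P (V0 @^-1` C))%E by [].
suff : m1 B = m2 B by rewrite m1E m2E fineK// fP.
apply: rseq_measure_unique => //.
- by rewrite m1E preimage_setT setIT -ge0_fin_numE ?fP.
- by move=> B0 cB0; rewrite m1E m2E step1// fineK ?fP.
Qed.

End independence.

End rseq.

(** * Dyadic times *)

Section dyadic.
Context (R : realType).

(** An enumeration with repetitions: [j / 2 ^ k] has one index for each such representation. Indices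
    that decode to no pair stand for time 0. *)
Definition dyadic (i : nat) : R :=
  if unpickle i is Some (k, j) then j%:R / 2 ^+ k else 0.

Definition dyadic_index (k j : nat) : nat := pickle (k, j).

Lemma dyadic_indexK k j : dyadic (dyadic_index k j) = j%:R / 2 ^+ k.
Proof. by rewrite /dyadic /dyadic_index pickleK. Qed.

Lemma dyadic_ge0 i : 0 <= dyadic i.
Proof.
by rewrite /dyadic; case: unpickle => // -[k j]; rewrite divr_ge0// exprn_ge0.
Qed.

Lemma dyadic_common N :
  exists k (n : nat -> nat), forall i, (i < N)%N -> dyadic i = (n i)%:R / 2 ^+ k.
Proof.
elim: N => [|N [k [n kn]]]; first by exists 0%N, (fun=> 0%N).
pose e := if (unpickle N : option (nat * nat)) is Some (k', _) then k' else 0%N.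
pose e' := if (unpickle N : option (nat * nat)) is Some (_, j) then j else 0%N.
exists (k + e)%N, (fun i => if (i < N)%N then n i * 2 ^ e else e' * 2 ^ k)%N => i.
rewrite ltnS leq_eqVlt => /orP[/eqP->|iN]; last first.
  by rewrite iN kn// natrM natrX exprD -mulf_div divff ?mulr1// expf_neq0.
rewrite ltnn /e /e' /dyadic; case: unpickle => [[k' j]|]; last by rewrite !mul0r.
by rewrite natrM natrX exprD [X in _ = _ / X]mulrC -mulf_div divff ?mulr1// expf_neq0.
Qed.

End dyadic.

(** * Independence of the past and the future of a path *)

Section levy.
Context (R : realType) (d : measure_display) (T : measurableType d).
Variables (P : probability T R) (X : R -> T -> R).
Hypothesis levyX : levy_process P X.

Lemma levy0 w : X 0 w = 0.
Proof. by case: levyX. Qed.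

Lemma measurable_levy t : 0 <= t -> measurable_fun setT (X t).
Proof. by case: levyX => _ + _ _ _; exact. Qed.

Lemma levy_rcvg w t : 0 <= t -> (fun s => X s w) @ t^'+ --> X t w.
Proof. by case: levyX => _ _ + _ _ t0 => /(_ w t t0)[]. Qed.

Lemma levy_stationary s t B : 0 <= s -> 0 <= t -> measurable B ->
  P [set w | B (X (s + t) w - X s w)] = P [set w | B (X t w)].
Proof.
case: levyX => _ _ _ + _ s0 t0 mB => /(_ s t B s0 t0 mB).
by under eq_set do rewrite in_setE; under [in RHS]eq_set do rewrite in_setE.
Qed.

Lemma levy_increments n (tt : nat -> R) (B : nat -> set R) : 0 <= tt 0%N ->
  (forall i, tt i <= tt i.+1) -> (forall i, measurable (B i)) ->
  P [set w | forall i, (i < n)%N -> B i (X (tt i.+1) w - X (tt i) w)] =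
  (\prod_(i < n) P [set w | B i (X (tt i.+1 - tt i) w)])%E.
Proof.
move=> tt0 ttS mB; case: levyX => _ _ _ _ /(_ n tt B tt0 (fun i _ => ttS i) mB).
have tt_ge0 i : 0 <= tt i by elim: i => // i /le_trans; exact.
have -> : (\bigcap_(i in [set i | (i < n)%N])
    [set w | X (tt i.+1) w - X (tt i) w \in B i]) =
    [set w | forall i, (i < n)%N -> B i (X (tt i.+1) w - X (tt i) w)].
  by apply/seteqP; split => w h i ni; have := h i ni; rewrite /= in_setE.
move=> ->; apply: eq_bigr => i _.
under eq_set do rewrite in_setE.
rewrite -{1}[tt i.+1](subrK (tt i)) addrC levy_stationary//.
by rewrite subr_ge0.
Qed.

Lemma measurable_increment s t : 0 <= s -> 0 <= t ->
  measurable_fun setT (fun w => X t w - X s w).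
Proof. by move=> s0 t0; apply: measurable_funB; exact: measurable_levy. Qed.

(** The future consists of increments from time [r], the past of values at times capped at [r].
    Because of the cap, [X r] itself is a coordinate of the past, at the index of any dyadic time
    beyond [r]. *)
Definition future r w : rseq R := fun i => X (r + dyadic R i) w - X r w.
Definition past r w : rseq R := fun i => X (Num.min (dyadic R i) r) w.

Lemma measurable_future r : 0 <= r -> measurable_fun setT (future r).
Proof.
move=> r0; apply: measurable_rseq => i; apply: measurable_increment => //.
by rewrite addr_ge0// dyadic_ge0.
Qed.

Lemma measurable_past r : 0 <= r -> measurable_fun setT (past r).
Proof.
move=> r0; apply: measurable_rseq => i; apply: measurable_levy.
by rewrite le_min dyadic_ge0.
Qed.

(** On a grid, cylinder events of increments have product probabilities. The first [J] steps lead
    from 0 to [r] and may be unequal; from then on the step is [h], so that [V] and its copy [V0]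
    started at time 0 use increments over equal lengths. *)
Lemma grid_indep (J : nat) (tt : nat -> R) (h r : R) : 0 <= h -> tt 0%N = 0 ->
  (forall i, tt i <= tt i.+1) -> (forall j, tt (J + j)%N = r + j%:R * h) ->
  let Y j w := X (tt j.+1) w - X (tt j) w in
  let U w : rseq R := fun j => if (j < J)%N then Y j w else 0 in
  let V w : rseq R := fun j => X (r + j.+1%:R * h) w - X (r + j%:R * h) w in
  let V0 w : rseq R := fun j => X (j.+1%:R * h) w - X (j%:R * h) w in
  forall A B, measurable A -> measurable B ->
  (P (U @^-1` A `&` V @^-1` B) = P (U @^-1` A) * P (V0 @^-1` B))%E.
Proof.
move=> h0 tt0 ttS ttJ Y U V V0.
have tt_ge0 i : 0 <= tt i by elim: i => [|i /le_trans]; [rewrite tt0|exact].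
have ge0h j : 0 <= j%:R * h by rewrite mulr_ge0.
have r0 : 0 <= r by have := ttJ 0%N; rewrite mul0r addr0 => <-.
have VE : V = fun w j => Y (J + j)%N w.
  by apply/funext => w; apply/funext => j; rewrite /V /Y -addnS !ttJ.
apply: rseq_indep.
- apply: measurable_rseq => j; rewrite /U; case: (j < J)%N => //.
  exact: measurable_increment.
- by apply: measurable_rseq => j; apply: measurable_increment; exact: addr_ge0.
- by apply: measurable_rseq => j; exact: measurable_increment.
move=> _ _ [nA [A [mA ->]]] [nB [B [mB ->]]].
(* From index [J] on, the coordinates of [U] are the constant 0: unless all the sets [A j] there
   contain 0, both sides vanish. *)
have [A0|A0] := pselect (forall j, (J <= j < nA)%N -> A j 0); last first.
  rewrite (_ : U @^-1` _ = set0) ?set0I ?measure0 ?mul0e//.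
  apply/seteqP; split=> // w /= UA; apply: A0 => j /andP[Jj jA].
  by have := UA j jA; rewrite /U ltnNge Jj.
pose A' j := if (j < nA)%N then A j else setT.
pose C j := if (j < J)%N then A' j else B (j - J)%N.
have mA' j : measurable (A' j) by rewrite /A'; case: ifP.
have mC j : measurable (C j) by rewrite /C; case: ifP.
have CE i : C (J + i)%N = B i by rewrite /C ltnNge leq_addr/= addKn.
have UE : U @^-1` [set y | forall i, (i < nA)%N -> A i (y i)] =
          [set w | forall i, (i < J)%N -> A' i (Y i w)].
  apply/seteqP; split => w /=.
    move=> + i iJ => /(_ i); rewrite /A'; case: ifP => // _ /(_ isT).
    by rewrite /U iJ.
  move=> + i inA => /(_ i); rewrite /U /A' inA; case: ifPn => [_ /(_ isT)//|].
  by rewrite -leqNgt => Ji _; apply: A0; rewrite Ji.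
have UVE : U @^-1` [set y | forall i, (i < nA)%N -> A i (y i)] `&`
           V @^-1` [set y | forall i, (i < nB)%N -> B i (y i)] =
          [set w | forall i, (i < J + nB)%N -> C i (Y i w)].
  rewrite UE VE; apply/seteqP; split => w /=.
    move=> [h1 h2] i iJ; rewrite /C; case: ifPn => [/h1//|].
    rewrite -leqNgt => Ji; have := h2 (i - J)%N; rewrite subnKC//; apply.
    by rewrite ltn_subLR.
  move=> h1; split => [i iJ|i inB].
    by have := h1 i; rewrite /C iJ; apply; rewrite ltn_addr.
  by have := h1 (J + i)%N; rewrite CE; apply; rewrite ltn_add2l.
rewrite UVE UE levy_increments// levy_increments//.
have -> : V0 @^-1` [set y | forall i, (i < nB)%N -> B i (y i)] =
    [set w | forall i, (i < nB)%N -> B i (X (i.+1%:R * h) w - X (i%:R * h) w)].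
  by [].
rewrite (@levy_increments _ (fun i => i%:R * h))//; last first.
  by move=> i; rewrite ler_wpM2r// ler_nat.
rewrite big_split_ord/=; congr (_ * _)%E; apply: eq_bigr => i _.
  by rewrite /C ltn_ord.
rewrite CE -addnS !ttJ; congr (P [set w | B _ (X _ w)]).
by rewrite opprD addrACA subrr add0r.
Qed.

Lemma measurable_sum_cylinder n (m : nat -> nat) (B : nat -> set R) :
  (forall i, measurable (B i)) -> measurable
  [set y : rseq R | forall i, (i < n)%N -> B i (\sum_(j < m i) (y j : R))].
Proof.
move=> mB.
have -> : [set y : rseq R | forall i, (i < n)%N -> B i (\sum_(j < m i) (y j : R))] =
  \bigcap_(i in [set i | (i < n)%N])
    ((fun y : rseq R => \sum_(j < m i) (y j : R)) @^-1` B i).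
  by apply/seteqP; split=> w h i; exact: h.
apply: fin_bigcap_measurable => [|i _]; first exact: finite_II.
rewrite -[X in measurable X]setTI.
have : measurable_fun setT (fun y : rseq R => \sum_(j < m i) (y j : R)).
  by apply: measurable_sum => j; exact: measurable_coord.
exact.
Qed.

(** A cylinder event reads finitely many dyadic times, which lie on one grid of mesh [h], and values
    on the grid are sums of increments. Past and future cylinders thus become events of the two
    blocks of [grid_indep]. *)
Theorem past_future_indep r A B : 0 <= r -> measurable A -> measurable B ->
  (P (past r @^-1` A `&` future r @^-1` B) =
   P (past r @^-1` A) * P (future 0 @^-1` B))%E.
Proof.
move=> r0; apply: rseq_indep.
- exact: measurable_past.
- exact: measurable_future.
- exact: measurable_future.
move=> _ _ [nA [A' [mA ->]]] [nB [B' [mB ->]]].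
have [k [n nE]] := dyadic_common R (maxn nA nB).
pose h : R := (2 ^+ k)^-1.
have h0 : 0 <= h by rewrite invr_ge0 exprn_ge0.
pose J := (Num.trunc (r * 2 ^+ k)).+1.
have rJ : r <= J%:R * h.
  rewrite ler_pdivlMr ?exprn_gt0// ltW// truncnS_gt//.
(* The grid is cut at [r]: as [r <= J%:R * h], its point of index [J] is [r] itself, and a fresh
   grid of mesh [h] starts there. *)
pose tt j := if (j <= J)%N then Num.min (j%:R * h) r else r + (j - J)%:R * h.
have tt0 : tt 0%N = 0 by rewrite /tt mul0r; apply/min_idPl.
have ttJ j : tt (J + j)%N = r + j%:R * h.
  rewrite /tt addKn; case: j => [|j]; first by rewrite addn0 leqnn mul0r addr0; apply/min_idPr.
  by rewrite addnS leqNgt ltnS leq_addr.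
have ttS i : tt i <= tt i.+1.
  have [iJ|] := ltnP i J.
    rewrite /tt iJ (ltnW iJ) le_min ge_min ge_min lexx orbT andbT.
    by rewrite ler_wpM2r// ler_nat.
  move=> /subnKC <-; rewrite -addnS !ttJ lerD2l ler_wpM2r// ler_nat//.
have pastE i w : (i < nA)%N ->
    past r w i = \sum_(j < minn (n i) J) (X (tt j.+1) w - X (tt j) w).
  move=> inA; rewrite -(big_mkord xpredT (fun j => X (tt j.+1) w - X (tt j) w)).
  rewrite telescope_sumr// tt0 levy0 subr0 /past nE ?leq_max ?inA//.
  rewrite /tt geq_minr; congr (X _ w).
  have [nJ|/ltnW nJ] := leqP (n i) J; first by [].
  rewrite (min_idPr rJ); apply/min_idPr; apply: (le_trans rJ).
  by rewrite ler_wpM2r// ler_nat.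
have futE s i w : (i < nB)%N -> 0 <= s ->
    future s w i = \sum_(j < n i) (X (s + j.+1%:R * h) w - X (s + j%:R * h) w).
  move=> inB s0; rewrite -(big_mkord xpredT (fun j => X (s + j.+1%:R * h) w - X (s + j%:R * h) w)).
  rewrite (telescope_sumr (fun j => X (s + j%:R * h) w))// mul0r addr0.
  by rewrite /future nE// leq_max inB orbT.
have := grid_indep h0 tt0 ttS ttJ
  (measurable_sum_cylinder nA (fun i => minn (n i) J) mA)
  (measurable_sum_cylinder nB n mB).
set U := (X in X @^-1` _ `&` _); set V := (X in _ `&` X @^-1` _).
set V0 := (X in (_ * P (X @^-1` _))%E).
set UA := U @^-1` _; set VB := V @^-1` _; set V0B := V0 @^-1` _ => UV.
have -> : past r @^-1` [set y | forall i, (i < nA)%N -> A' i (y i)] = UA.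
  apply/seteqP; split => w /= hA i inA; have := hA i inA; rewrite pastE//.
    congr (A' i _); apply: eq_bigr => j _; rewrite /U ifT//.
    by rewrite (leq_trans (ltn_ord j))// geq_minr.
  congr (A' i _); apply: eq_bigr => j _; rewrite /U ifT//.
  by rewrite (leq_trans (ltn_ord j))// geq_minr.
have -> : future r @^-1` [set y | forall i, (i < nB)%N -> B' i (y i)] = VB.
  by apply/seteqP; split => w /= hB i inB; have := hB i inB; rewrite futE.
have -> : future 0 @^-1` [set y | forall i, (i < nB)%N -> B' i (y i)] = V0B.
  apply/seteqP; split => w /= hB i inB; have := hB i inB; rewrite futE//;
  by congr (B' i _); apply: eq_bigr => j _; rewrite /V0 !add0r.
exact: UV.
Qed.

End levy.

(** * Recovering a path from its dyadic values *)

Section regularization.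
Context (R : realType).

(** For [s >= 0], the index of the first multiple of [2 ^- k] strictly above [s]. Strictness
    matters, since the right limit at [s] ignores [s] itself. *)
Definition dyadic_above (k : nat) (s : R) : nat :=
  dyadic_index k (Num.trunc (2 ^+ k * s)).+1.

Lemma dyadic_above_gt k s : s < dyadic R (dyadic_above k s).
Proof.
rewrite /dyadic_above dyadic_indexK ltr_pdivlMr ?exprn_gt0// mulrC.
exact: truncnS_gt.
Qed.

Lemma dyadic_above_le k s : 0 <= s ->
  dyadic R (dyadic_above k s) <= s + (2 ^+ k)^-1.
Proof.
move=> s0; rewrite /dyadic_above dyadic_indexK ler_pdivrMr ?exprn_gt0//.
rewrite mulrDl mulVf ?expf_neq0// -natr1 lerD2r mulrC.
by have /truncn_itv/andP[] : 0 <= s * 2 ^+ k by rewrite mulr_ge0// exprn_ge0.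
Qed.

Lemma cvg_pow_half : ((2 ^+ k)^-1 : R) @[k --> \oo] --> (0 : R).
Proof.
apply: (@squeeze_cvgr _ _ _ _ (fun=> 0) (@harmonic R)).
- apply: nearW => k; rewrite invr_ge0 exprn_ge0//= /harmonic.
  rewrite lef_pV2 ?posrE ?ltr0n ?exprn_gt0// -natrX ler_nat.
  exact: ltn_expl.
- exact: cvg_cst.
- exact: cvg_harmonic.
Qed.

Lemma cvg_dyadic_above s : 0 <= s ->
  dyadic R (dyadic_above k s) @[k --> \oo] --> s.
Proof.
move=> s0; apply: (@squeeze_cvgr _ _ _ _ (fun=> s) (fun k => s + (2 ^+ k)^-1)).
- by apply: nearW => k; rewrite ltW ?dyadic_above_gt//= dyadic_above_le.
- exact: cvg_cst.
- by rewrite -[X in _ --> X]addr0; apply: cvgD; [exact: cvg_cst|exact: cvg_pow_half].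
Qed.

(** A limit superior, with infinite values sent to 0 by [fine], is defined and measurable on all
    sequences; on the dyadic values of a right-continuous path it returns the path. *)
Definition path_at (y : rseq R) (s : R) : R :=
  fine (limn_esup (fun k => (y (dyadic_above k s))%:E)).

Lemma path_atE (x : R -> R) s : 0 <= s -> x u @[u --> s^'+] --> x s ->
  path_at (fun i => x (dyadic R i)) s = x s.
Proof.
move=> s0 xs; rewrite /path_at.
have cx : (x (dyadic R (dyadic_above k s)))%:E @[k --> \oo] --> (x s)%:E.
  apply/cvg_EFin; first by near=> k.
  move/cvg_at_rightP : xs; apply; split => [k|]; first exact: dyadic_above_gt.
  exact: cvg_dyadic_above.
by rewrite (cvg_limn_einf_sup cx).2.
Unshelve. all: by end_near. Qed.

Lemma measurable_trunc_eq (j : nat) : measurable [set x : R | Num.trunc x = j].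
Proof.
have mlt (n : nat) : measurable [set x : R | x < n%:R].
  by rewrite -(set_itvNyo n%:R).
(* [Num.trunc] sends all negative numbers to 0, so there is no lower bound when [j] is 0. *)
have -> : [set x : R | Num.trunc x = j] =
  [set x | x < j.+1%:R] `&` (if j is 0%N then setT else ~` [set x | x < j%:R]).
  apply/seteqP; split => x /=.
    move=> <-; split; first exact: truncnS_gt.
    case E : (Num.trunc x) => [//|j']; rewrite /= -truncn_le_nat E.
    by rewrite ltnn.
  move=> [+ h]; rewrite -truncn_le_nat => xj.
  apply/eqP; rewrite eqn_leq xj/=; case: j xj h => // j _ /= /negP.
  by rewrite -truncn_le_nat -ltnNge.
apply: measurableI; first exact: mlt.
by case: j => // j; apply: measurableC; exact: mlt.
Qed.

(** At level [k] the approximating time takes countably many values, and where it is constant a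
    single coordinate of the sequence is read. *)
Lemma measurable_path_at :
  measurable_fun setT (fun p : rseq R * R => path_at p.1 p.2).
Proof.
apply: (measurableT_comp (fine_measurable measurableT)).
apply: measurable_fun_limn_esup => k; apply/measurable_EFinP.
move=> _ B mB; rewrite setTI.
have -> : (fun p : rseq R * R => p.1 (dyadic_above k p.2) : R) @^-1` B =
  \bigcup_j (((fun p : rseq R * R => 2 ^+ k * p.2) @^-1`
      [set x | Num.trunc x = j]) `&`
    ((fun p : rseq R * R => p.1 (dyadic_index k j.+1) : R) @^-1` B)).
  apply/seteqP; split => [p Bp|p [j _ [/= <- //]]].
  by exists (Num.trunc (2 ^+ k * p.2)).
apply: bigcupT_measurable => j; apply: measurableI.
  rewrite -[X in measurable X]setTI.
  have : measurable_fun setT (fun p : rseq R * R => 2 ^+ k * p.2).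
    by apply: measurable_funM => //; exact: measurable_snd.
  by apply => //; exact: measurable_trunc_eq.
rewrite -[X in measurable X]setTI.
have : measurable_fun setT (fun p : rseq R * R => p.1 (dyadic_index k j.+1) : R).
  exact: (measurable_coord_comp _ measurable_fst).
exact.
Qed.

Lemma measurable_path_at_r (y : rseq R) : measurable_fun setT (path_at y).
Proof.
apply: (measurableT_comp measurable_path_at (g := fun r => (y, r))).
exact: measurable_fun_pair.
Qed.

End regularization.

(** * Lebesgue measure on the line and on the half-line of times *)

Lemma ge0_integral_mrestr d (T : measurableType d) (R : realType)
  (mu : {measure set T -> \bar R}) (D : set T) (mD : measurable D) (g : T -> \bar R) :
  measurable_fun setT g -> (forall x, 0 <= g x)%E ->
  (\int[mrestr mu mD]_x g x = \int[mu]_(x in D) g x)%E.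
Proof.
move=> mg g0.
transitivity (\int[mrestr mu mD]_(x in D) g x)%E.
  rewrite -(setUv D) ge0_integral_setU//; last 3 first.
  - exact: measurableC.
  - by rewrite setUv.
  - by apply/disj_setPS; rewrite setICr.
  rewrite (@null_set_integral _ _ _ _ (~` _)) ?adde0//; last 3 first.
  - exact: measurableC.
  - exact: measurable_funTS.
  - exact: (etrans (congr1 mu (setICl _)) (measure0 mu)).
by apply: eq_measure_integral => A mA AD; exact: (congr1 mu (setIidl AD)).
Qed.

Section lebesgue_line.
Context (R : realType).

Lemma measurable_id_line : measurable_fun setT (fun x : measurableTypeR R => x : R).
Proof. by move=> _ B mB; rewrite setTI. Qed.

(* Lebesgue measure on [R] with its default measurable structure; in the library
   it lives on the alias [measurableTypeR R], which has another display. *)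
Definition leb : set R -> \bar R :=
  image_measure (@lebesgue_measure R) measurable_id_line.

HB.instance Definition _ := Measure.on leb.

Lemma lebE A : leb A = lebesgue_measure A.
Proof. by []. Qed.

Let leb_sigma_finite : sigma_finite setT leb.
Proof.
exists (fun n => `](- n%:R)%R, n%:R]%classic).
  apply/esym; rewrite -subTset => x _; exists (Num.trunc `|x|).+1 => //=.
  rewrite in_itv/= ltrNl; have := truncnS_gt `|x|.
  by rewrite ltr_norml ltrNl => /andP[-> /ltW].
move=> n; split => //; rewrite lebE lebesgue_measure_itv/=.
by case: ifPn => // _; rewrite -EFinB ltry.
Qed.

HB.instance Definition _ :=
  Measure_isSigmaFinite.Build _ _ _ leb leb_sigma_finite.

Lemma ge0_integral_leb (f : R -> \bar R) D : measurable D ->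
  measurable_fun D f -> (forall s, D s -> 0 <= f s)%E ->
  (\int[leb]_(s in D) f s = \int[lebesgue_measure]_(s in D) f s)%E.
Proof.
move=> mD mf f0; rewrite ge0_integral_pushforward//.
by move=> x /[!inE]; exact: f0.
Qed.

Lemma leb_shift (r : R) (A : set R) : measurable A ->
  leb [set x | A (x + r)] = leb A.
Proof.
move=> mA; have ms : measurable_fun setT (fun x : measurableTypeR R => x + r : measurableTypeR R).
  have : measurable_fun setT (fun x : R => x + r) by exact: measurable_funD.
  exact.
rewrite [RHS](@lebesgue_measure_unique _ (image_measure lebesgue_measure ms))//.
move=> _ [[a b] /= _ <-]; rewrite image_measureE.
have -> : (fun x => x + r) @^-1` `]a, b] = `]a - r, b - r]%classic :> set R.
  by apply/seteqP; split => x /=; rewrite !in_itv/= ltrBlDr lerBrDr.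
rewrite -[RHS]/(lebesgue_measure `]a - r, b - r]%classic).
by rewrite !lebesgue_measure_itv/= !lte_fin ltrD2r -!EFinB opprB addrA subrK.
exact: ms.
Qed.

Lemma measurable_le_set d (T : measurableType d) (f g : T -> R) :
  measurable_fun setT f -> measurable_fun setT g ->
  measurable [set x | f x <= g x].
Proof.
move=> mf mg; have := measurable_fun_ler mf mg.
by move=> /(_ measurableT [set true]); rewrite setTI; apply.
Qed.

Lemma measurable_lt_set d (T : measurableType d) (f g : T -> R) :
  measurable_fun setT f -> measurable_fun setT g ->
  measurable [set x | f x < g x].
Proof.
move=> mf mg; have := measurable_fun_ltr mf mg.
by move=> /(_ measurableT [set true]); rewrite setTI; apply.
Qed.

Lemma measurable_pre d d' (T : measurableType d) (T' : measurableType d')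
  (f : T -> T') (A : set T') : measurable_fun setT f -> measurable A ->
  measurable [set x | A (f x)].
Proof. by move=> mf mA; rewrite -[X in measurable X]setTI; exact: mf. Qed.

(** A measure on the whole line that gives no mass to negative times, so that time integrals and
    Tonelli arguments run over [setT]. *)
Definition time_measure : set R -> \bar R :=
  mrestr leb (measurable_itv `[0%R, +oo[).

HB.instance Definition _ := Measure.on time_measure.

Lemma time_measureE A : time_measure A = leb (A `&` `[0, +oo[).
Proof. by []. Qed.

Let time_sigma_finite : sigma_finite setT time_measure.
Proof.
have [F TF mF] := leb_sigma_finite; exists F => // n; have [mFn Foo] := mF n.
split => //; rewrite time_measureE; apply: le_lt_trans Foo.
by apply: le_measure; rewrite ?inE//; apply: measurableI.
Qed.

HB.instance Definition _ :=
  Measure_isSigmaFinite.Build _ _ _ time_measure time_sigma_finite.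

Lemma integral_time (f : R -> \bar R) : measurable_fun setT f ->
  (forall s, 0 <= f s)%E ->
  (\int[time_measure]_s f s = \int[leb]_(s in `[0%R, +oo[) f s)%E.
Proof. by move=> mf f0; exact: ge0_integral_mrestr. Qed.

Lemma le_time_integral (f g : R -> \bar R) :
  measurable_fun setT f -> measurable_fun setT g ->
  (forall s, 0 <= f s)%E -> (forall s, 0 <= g s)%E ->
  (forall s : R, (0 <= s)%R -> f s <= g s)%E ->
  (\int[time_measure]_s f s <= \int[time_measure]_s g s)%E.
Proof.
move=> mf mg f0 g0 fg; rewrite !integral_time//; apply: ge0_le_integral => //.
- exact: measurable_funTS.
- exact: measurable_funTS.
- by move=> s /=; rewrite in_itv/= andbT => /fg.
Qed.

Lemma eq_time_integral (f g : R -> \bar R) :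
  measurable_fun setT f -> measurable_fun setT g ->
  (forall s, 0 <= f s)%E -> (forall s, 0 <= g s)%E ->
  (forall s : R, (0 <= s)%R -> f s = g s)%E ->
  (\int[time_measure]_s f s = \int[time_measure]_s g s)%E.
Proof.
move=> mf mg f0 g0 fg; apply/eqP; rewrite eq_le; apply/andP.
by split; apply: le_time_integral => // s s0; rewrite fg.
Qed.

Lemma time_shift (r : R) (A : set R) : 0 <= r -> measurable A ->
  time_measure [set s | A (r + s)] = time_measure (A `&` `[r, +oo[).
Proof.
move=> r0 mA; rewrite !time_measureE -[RHS](leb_shift r); last first.
  by apply: measurableI => //; exact: measurableI.
congr leb; apply/seteqP; split => s /=; rewrite !in_itv/= !andbT [s + r]addrC.
  by move=> [As s0]; rewrite lerDl s0 addr_ge0.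
by rewrite lerDl => -[[As s0] _].
Qed.

(** This replaces restarting at the first point of [S], which need not exist. If [inf S] is not in
    [S], then [S] is the increasing union of its parts beyond [inf S + 1 / (n + 1)], and each part
    lies in the tail from some point of [S] closer to the infimum. *)
Lemma measure_tails (mu : {measure set R -> \bar R}) (S : set R) (b : R) (m : \bar R) : (0 <= m)%E ->
  measurable S -> (forall s, S s -> b <= s) ->
  (forall r, S r -> mu (S `&` `[r, +oo[) <= m)%E -> (mu S <= m)%E.
Proof.
move=> m0 mS Sb Sm; have [S0|/set0P-/negP/negPn/eqP->] := pselect (S !=set0); last first.
  by rewrite measure0.
have Sinf : has_inf S by split => //; exists b.
have [Si|Si] := pselect (S (inf S)).
  have := Sm _ Si; rewrite setIidl// => s Ss /=.
  by rewrite in_itv/= andbT; apply: inf_lbound => //; exact: Sinf.2.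
pose F n := S `&` `[inf S + n.+1%:R^-1, +oo[.
have mF n : measurable (F n) by apply: measurableI.
have SF : S = \bigcup_n F n.
  apply/seteqP; split => [s Ss|s [n _ []//]].
  have iS : inf S < s.
    rewrite lt_neqAle; apply/andP; split; last by apply: inf_lbound => //; exact: Sinf.2.
    by apply/eqP => iSs; apply: Si; rewrite iSs.
  exists (Num.trunc (s - inf S)^-1) => //; split => //=.
  rewrite in_itv/= andbT -lerBrDl invf_ple ?posrE ?subr_gt0//.
  by rewrite ltW// truncnS_gt.
have ndF : {homo F : n m / (n <= m)%N >-> (n <= m)%O}.
  move=> i j ij; apply/subsetPset => s [Ss] /=; rewrite !in_itv/= !andbT => h.
  split => //=; rewrite in_itv/= andbT; apply: le_trans h.
  by rewrite lerD2l lef_pV2 ?posrE// ler_nat.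
have mUF : measurable (\bigcup_n F n) by rewrite -SF.
have := nondecreasing_cvg_mu (mu := mu) mF mUF ndF; rewrite -SF => cF.
rewrite -(cvg_lim _ cF)//; apply: lime_le; first by apply/cvg_ex; exists (mu S).
apply: nearW => n /=.
have [|r Sr rn] := @inf_adherent _ S n.+1%:R^-1 _ Sinf; first by rewrite invr_gt0.
apply: le_trans (Sm r Sr); apply: le_measure; rewrite ?inE//.
  by apply: measurableI.
move=> s [Ss] /=; rewrite !in_itv/= !andbT => h; split => //=.
by rewrite (le_trans _ h)// ltW.
Qed.

End lebesgue_line.

(** * Tonelli for the sections of a measurable set *)

Section tonelli_set.
Context d1 d2 (T1 : measurableType d1) (T2 : measurableType d2) (R : realType).
Variables (m1 : {sigma_finite_measure set T1 -> \bar R})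
  (m2 : {sigma_finite_measure set T2 -> \bar R}).
Variable A : set (T1 * T2).
Hypothesis mA : measurable A.

Let xE x : [set y | A (x, y)] = xsection A x.
Proof. by apply/seteqP; split => y; rewrite /xsection/= inE. Qed.

Let yE y : [set x | A (x, y)] = ysection A y.
Proof. by apply/seteqP; split => x; rewrite /ysection/= inE. Qed.

Lemma measurable_fst_section x : measurable [set y | A (x, y)].
Proof. by rewrite xE; exact: measurable_xsection. Qed.

Lemma measurable_snd_section y : measurable [set x | A (x, y)].
Proof. by rewrite yE; exact: measurable_ysection. Qed.

Lemma measurable_measure_fst : measurable_fun setT (fun x => m2 [set y | A (x, y)]).
Proof.
under eq_fun do rewrite xE.
exact: (measurable_fun_xsection m2 mA).
Qed.

Lemma measurable_measure_snd : measurable_fun setT (fun y => m1 [set x | A (x, y)]).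
Proof.
under eq_fun do rewrite yE.
exact: (measurable_fun_ysection m1 mA).
Qed.

Lemma tonelli_set :
  (\int[m1]_x m2 [set y | A (x, y)] = \int[m2]_y m1 [set x | A (x, y)])%E.
Proof.
transitivity (\int[m1]_x (m2 \o xsection A) x)%E.
  by apply: eq_integral => x _; rewrite xE.
transitivity (\int[m2]_y (m1 \o ysection A) y)%E; last first.
  by apply: eq_integral => y _; rewrite yE.
by rewrite -indic_fubini_tonelli_FE// -indic_fubini_tonelli_GE// indic_fubini_tonelli.
Qed.

End tonelli_set.

(** * The Markov property and the potential measure *)

Section markov.
Context (R : realType) (d : measure_display) (T : measurableType d).
Variables (P : probability T R) (X : R -> T -> R).
Hypothesis levyX : levy_process P X.
Local Notation tm := (@time_measure R).
Hypothesis measX : measurable_fun setT (fun p : R * T => X p.1 p.2).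

Lemma measurable_future_joint :
  measurable_fun setT (fun p : R * T => future X p.1 p.2).
Proof.
apply: measurable_rseq => i; apply: measurable_funB => //.
have : measurable_fun setT (fun p : R * T => (p.1 + dyadic R i, p.2)).
  by apply: measurable_fun_pair => //; exact: measurable_funD.
by move=> /(measurableT_comp measX).
Qed.

Lemma path_at_future r s w : 0 <= r -> 0 <= s ->
  path_at (future X r w) s = X (r + s) w - X r w.
Proof.
move=> r0 s0; rewrite /future.
apply: (@path_atE _ (fun u => X (r + u) w - X r w)) => //.
apply: cvgB; last exact: cvg_cst.
apply/cvg_at_rightP => u [us cu].
have := @levy_rcvg _ _ _ _ _ levyX w _ (addr_ge0 r0 s0).
move/cvg_at_rightP; apply; split => [n|]; first by rewrite ltrD2l.
by apply: cvgD => //; exact: cvg_cst.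
Qed.

Lemma path_at_future0 s w : 0 <= s -> path_at (future X 0 w) s = X s w.
Proof. by move=> s0; rewrite path_at_future// add0r (levy0 levyX) subr0. Qed.

(** The joint law of past and future agrees on rectangles with the product of the law of the past at
    [r] and the law of the future at 0, hence it is that product. *)
Lemma markov_past r (H : rseq R * rseq R -> \bar R) : 0 <= r ->
  measurable_fun setT H -> (forall z, 0 <= H z)%E ->
  (\int[P]_w H (past X r w, future X r w) =
   \int[P]_w \int[P]_v H (past X r w, future X 0 v))%E.
Proof.
move=> r0 mH H0.
have mp := measurable_past levyX r0; have mf := measurable_future levyX r0.
have mf0 := measurable_future levyX (lexx 0).
pose p' : {mfun T >-> rseq R} := HB.pack (past X r) (isMeasurableFun.Build _ _ _ _ _ mp).
pose f' : {mfun T >-> rseq R} := HB.pack (future X 0) (isMeasurableFun.Build _ _ _ _ _ mf0).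
pose mu1 := distribution P p'; pose mu2 := distribution P f'.
have mpf : measurable_fun setT (fun w => (past X r w, future X r w)).
  exact: measurable_fun_pair.
rewrite -(ge0_integral_image P mpf)//.
rewrite (eq_measure_integral (mu1 \x mu2)%E); last first.
  move=> A mA _; apply/esym; apply: product_measure_unique => // {}A B {}mA mB.
  exact: past_future_indep.
rewrite fubini_tonelli1//.
have mF : measurable_fun setT (fun x => \int[mu2]_y H (x, y))%E.
  exact: measurable_fun_fubini_tonelli_F.
have F0 x : (0 <= \int[mu2]_y H (x, y))%E by apply: integral_ge0.
have := ge0_integral_image P mp mF F0.
rewrite /fubini_F => ->; apply: eq_integral => w _.
have mHw : measurable_fun setT (fun y => H (past X r w, y)).
  by apply: (measurableT_comp mH); exact: measurable_pair1.
by have := ge0_integral_image P mf0 mHw (fun y => H0 _).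
Qed.

Lemma markov_property r (H : R * rseq R -> \bar R) : 0 <= r ->
  measurable_fun setT H -> (forall z, 0 <= H z)%E ->
  (\int[P]_w H (X r w, future X r w) =
   \int[P]_w \int[P]_v H (X r w, future X 0 v))%E.
Proof.
(* Coordinate [i] of the past belongs to an integer time beyond [r]; capping makes it [X r]. *)
move=> r0 mH H0; pose i := dyadic_above 0 r.
have pE w : X r w = past X r w i.
  by rewrite /past (min_idPr _)//; apply/ltW/dyadic_above_gt.
pose H' := fun z : rseq R * rseq R => H (z.1 i, z.2).
have mH' : measurable_fun setT H'.
  apply: (measurableT_comp mH); apply: measurable_fun_pair => //.
  exact: (measurable_coord_comp _ measurable_fst).
transitivity (\int[P]_w H' (past X r w, future X r w))%E.
  by apply: eq_integral => w _; rewrite pE.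
rewrite (@markov_past r H' r0 mH' (fun z => H0 _)).
apply: eq_integral => w _.
by apply: eq_integral => v _; rewrite pE.
Qed.

Lemma present_future_indep r (J : set R) (E : set (rseq R)) : 0 <= r ->
  measurable J -> measurable E ->
  (P [set w | J (X r w) /\ E (future X r w)] =
   P [set w | J (X r w)] * P (future X 0 @^-1` E))%E.
Proof.
move=> r0 mJ mE; pose i := dyadic_above 0 r.
have pE w : X r w = past X r w i.
  by rewrite /past (min_idPr _)//; apply/ltW/dyadic_above_gt.
have mi : measurable [set y : rseq R | J (y i)].
  exact: (@measurable_pre _ _ _ _ (fun y : rseq R => y i : R) J (measurable_coord i) mJ).
have := past_future_indep levyX r0 mi mE.
have -> : past X r @^-1` [set y | J (y i)] = [set w | J (X r w)].
  by apply/seteqP; split => w /=; rewrite pE.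
by move=> <-.
Qed.

Lemma future_law r (H : rseq R -> \bar R) : 0 <= r ->
  measurable_fun setT H -> (forall z, 0 <= H z)%E ->
  (\int[P]_w H (future X r w) = \int[P]_w H (future X 0 w))%E.
Proof.
move=> r0 mH H0; have := @markov_property r (fun z => H z.2) r0.
move=> -> //; last exact: (measurableT_comp mH).
by rewrite /= integral_cst//= probability_setT mule1.
Qed.

Lemma future_lawE r (E : set (rseq R)) : 0 <= r -> measurable E ->
  P (future X r @^-1` E) = P (future X 0 @^-1` E).
Proof.
move=> r0 mE; have := present_future_indep r0 measurableT mE.
rewrite [X in (P X * _)%E](_ : _ = setT); last by apply/seteqP; split.
rewrite probability_setT mul1e => <-; congr (P _).
by apply/seteqP; split => w // -[].
Qed.

Definition potential : {measure set R -> \bar R} :=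
  image_measure (tm \x P)%E measX.

Lemma integral_potential (g : R -> \bar R) : measurable_fun setT g ->
  (forall x, 0 <= g x)%E ->
  (\int[potential]_x g x = \int[P]_w \int[tm]_s g (X s w))%E.
Proof.
move=> mg g0; rewrite ge0_integral_image// fubini_tonelli2//.
exact: (measurableT_comp mg).
Qed.

Lemma measurable_path w : measurable_fun setT (X^~ w).
Proof.
apply: (measurableT_comp measX (g := fun s => (s, w))).
exact: measurable_fun_pair.
Qed.

Lemma measurable_hit (B : set R) : measurable B ->
  measurable [set p : R * T | B (X p.1 p.2)].
Proof. exact: measurable_pre. Qed.

Lemma potentialE (B : set R) : measurable B ->
  (potential B = \int[tm]_s P [set w | B (X s w)])%E.
Proof.
move=> mB; rewrite /potential image_measureE /product_measure1.
apply: eq_integral => s _; congr (P _).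
by apply/seteqP; split => w; rewrite /xsection/= inE.
Qed.

(* Weighting each visit to [J] by the indicator that the future is in [E] replaces
   the strong Markov property by independence at deterministic times. *)
Lemma potential_le (J : set R) (E : set (rseq R)) (m : R) : 0 <= m ->
  measurable J -> measurable E -> (2^-1%:E <= P (future X 0 @^-1` E))%E ->
  (forall w r, 0 <= r -> J (X r w) -> E (future X r w) ->
    (tm ([set s | J (X s w)] `&` `[r, +oo[) <= m%:E)%E) ->
  (potential J <= (2 * m)%:E)%E.
Proof.
move=> m0 mJ mE PE Em.
have mJE : measurable [set p : R * T | J (X p.1 p.2) /\ E (future X p.1 p.2)].
  apply: measurableI; first exact: measurable_hit.
  exact: (measurable_pre measurable_future_joint).
have I1 : (\int[tm]_r P [set w | J (X r w) /\ E (future X r w)] <= m%:E)%E.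
  rewrite (tonelli_set tm P mJE)/=.
  apply: (@le_trans _ _ (\int[P]_w m%:E)%E); last first.
    by rewrite integral_cst//= probability_setT mule1.
  apply: ge0_le_integral => //.
  - exact: (measurable_measure_snd tm mJE).
  - move=> w _; set S := [set _ | _].
    have mS : measurable S by exact: (measurable_snd_section mJE).
    have -> : tm S = tm (S `&` `[0, +oo[) by rewrite !time_measureE -setIA setIid.
    apply: (@measure_tails _ _ _ 0) => //.
    + exact: measurableI.
    + by move=> s [_] /=; rewrite in_itv/= andbT.
    + move=> r [[Jr Er]] /=; rewrite in_itv/= andbT => r0.
      apply: le_trans (Em w r r0 Jr Er); apply: le_measure; rewrite ?inE.
      * by do 2 apply: measurableI => //.
      * by apply: measurableI => //; exact: (measurable_snd_section (measurable_hit mJ)).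
      * by apply: setSI => s [[]].
have I2 : (\int[tm]_r (P [set w | J (X r w)] * P (future X 0 @^-1` E)) <= m%:E)%E.
  apply: le_trans I1; apply: le_time_integral.
  - apply: emeasurable_funM => //; exact: (measurable_measure_fst P (measurable_hit mJ)).
  - exact: (measurable_measure_fst P mJE).
  - by move=> s; rewrite mule_ge0.
  - by [].
  - by move=> r r0; rewrite present_future_indep.
have : (potential J * 2^-1%:E <= m%:E)%E.
  apply: le_trans I2; rewrite ge0_integralZr//; last first.
    exact: (measurable_measure_fst P (measurable_hit mJ)).
  by rewrite potentialE// lee_wpmul2l// integral_ge0.
by rewrite muleC -lee_pdivlMl// invrK EFinM.
Qed.

End markov.

(** * Paths stay above a line *)

Section garsia.
Context (R : realType) (d : measure_display) (T : measurableType d).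
Variables (P : probability T R) (X : R -> T -> R).
Hypothesis levyX : levy_process P X.
Hypothesis measX : measurable_fun setT (fun p : R * T => X p.1 p.2).
Variable a : R.

(** Positive when the path is below the line of slope [a] through its starting point; only integer
    times are observed. *)
Definition deviation (n : nat) (y : rseq R) : R :=
  a * n%:R - y (dyadic_index 0 n).

Fixpoint max_deviation (n : nat) (y : rseq R) : R :=
  if n is n'.+1 then Num.max (max_deviation n' y) (deviation n y) else 0.

Definition unbounded_deviation : set (rseq R) :=
  [set y | forall b, exists n, b%:R < deviation n y].

Lemma deviation_future n r w :
  deviation n (future X r w) = a * n%:R - (X (r + n%:R) w - X r w).
Proof. by rewrite /deviation /future dyadic_indexK expr0 divr1. Qed.

Lemma deviation_shift n w :
  deviation n.+1 (future X 0 w) = (a - X 1 w) + deviation n (future X 1 w).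
Proof.
rewrite !deviation_future add0r (levy0 levyX) subr0 -nat1r mulrDr mulr1.
by ring.
Qed.

(** The recursion behind Garsia's argument: with [Z = a - X 1], the maximum over [n + 1] steps is
    the positive part of [Z] plus the maximum over [n] steps of the path restarted at time 1. *)
Lemma max_deviation_shift n w : max_deviation n.+1 (future X 0 w) =
  Num.max 0 ((a - X 1 w) + max_deviation n (future X 1 w)).
Proof.
elim: n => [|n IH]; first by rewrite /= deviation_shift deviation_future mulr0 addr0 subrr subr0.
rewrite [LHS]/= -[X in Num.max X _]/(max_deviation n.+1 (future X 0 w)) IH.
by rewrite deviation_shift -maxA -addr_maxr.
Qed.

Lemma measurable_deviation n : measurable_fun setT (deviation n).
Proof. by apply: measurable_funB => //; exact: measurable_coord. Qed.

Lemma measurable_max_deviation n : measurable_fun setT (max_deviation n).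
Proof.
elim: n => [|n IH] //=; apply: measurable_maxr => //; exact: measurable_deviation.
Qed.

Lemma max_deviation_ge0 n y : 0 <= max_deviation n y.
Proof. by elim: n => [|n IH] //=; rewrite le_max IH. Qed.

Lemma max_deviation_le n y : max_deviation n y <= max_deviation n.+1 y.
Proof. by rewrite /= le_max lexx. Qed.

Lemma measurable_unbounded_deviation : measurable unbounded_deviation.
Proof.
have -> : unbounded_deviation =
    \bigcap_b \bigcup_n [set y | b%:R < deviation n y].
  apply/seteqP; split => [y yE b _|y yE b]; first by have [n yn] := yE b; exists n.
  by have [n _ yn] := yE b I; exists n.
apply: bigcapT_measurable => b; apply: bigcupT_measurable => n.
by apply: measurable_lt_set => //; exact: measurable_deviation.
Qed.

(** Restarting at time 1 changes all deviations by the same finite amount [a - X 1 w]. *)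
Lemma unbounded_deviation_shift w :
  unbounded_deviation (future X 0 w) <-> unbounded_deviation (future X 1 w).
Proof.
have la := ler_norm (a - X 1 w); have lb := ler_norm (X 1 w - a).
split => h b.
  have [n] := h (Num.trunc (b%:R + `|a - X 1 w|)).+1.
  case: n => [|n].
    rewrite deviation_future mulr0 addr0 subrr subr0 => /lt_le_trans/(_ (ler0n _ 0)).
    by rewrite ltrn0.
  rewrite deviation_shift => hn; exists n.
  have := lt_trans (truncnS_gt _) hn; lra.
have [n hn] := h (Num.trunc (b%:R + `|X 1 w - a|)).+1.
exists n.+1; rewrite deviation_shift; have := lt_trans (truncnS_gt _) hn; lra.
Qed.

Local Notation Zp := (fun w => (Num.max (a - X 1 w) 0)%:E).
Local Notation Zn := (fun w => (Num.max (X 1 w - a) 0)%:E).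

Let mX1 : measurable_fun setT (X 1).
Proof. exact: (measurable_levy levyX). Qed.

Let mZp : measurable_fun setT Zp.
Proof. by apply/measurable_EFinP; apply: measurable_maxr => //; apply: measurable_funB. Qed.

Let mZn : measurable_fun setT Zn.
Proof. by apply/measurable_EFinP; apply: measurable_maxr => //; apply: measurable_funB. Qed.

Let mM n r : 0 <= r ->
  measurable_fun setT (fun w => (max_deviation n (future X r w))%:E).
Proof.
move=> r0; apply/measurable_EFinP.
exact: (measurableT_comp (measurable_max_deviation n) (measurable_future levyX r0)).
Qed.

(** Finiteness is what allows [maximal_ergodic] to cancel the mean of the maximum on both sides. In
    the recursion each step adds at most the positive part of [a - X 1], and [future X 1] has the
    law of [future X 0]. *)
Lemma expectation_max_deviation n : (\int[P]_w Zp w < +oo)%E ->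
  (\int[P]_w (max_deviation n (future X 0 w))%:E < +oo)%E.
Proof.
move=> Zoo; elim: n => [|n IH] /=; first by rewrite integral0.
apply: (@le_lt_trans _ _ (\int[P]_w (Zp w + (max_deviation n (future X 1 w))%:E))%E).
  apply: ge0_le_integral => //.
  - by move=> w _; rewrite lee_fin (max_deviation_ge0 n.+1).
  - exact: (mM n.+1).
  - by apply: emeasurable_funD => //; exact: mM.
  - move=> w _; rewrite -[X in (X%:E <= _)%E]/(max_deviation n.+1 (future X 0 w)).
    rewrite max_deviation_shift -EFinD lee_fin ge_max.
    have := max_deviation_ge0 n (future X 1 w); move=> h.
    by rewrite addr_ge0 ?le_max ?lexx ?orbT//= lerD2r le_max lexx.
rewrite ge0_integralD//; last 3 first.
- by move=> w _; rewrite lee_fin le_max lexx orbT.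
- by move=> w _; rewrite lee_fin max_deviation_ge0.
- exact: mM.
rewrite (@future_law _ _ _ _ _ levyX 1 (fun y => (max_deviation n y)%:E))//.
- by rewrite lte_add_pinfty.
- by apply/measurable_EFinP; exact: measurable_max_deviation.
- by move=> z; rewrite lee_fin max_deviation_ge0.
Qed.

Definition drift_failure : set T := [set w | unbounded_deviation (future X 0 w)].

Definition deviation_event n : set T :=
  [set w | unbounded_deviation (future X 0 w) /\
           0 < max_deviation n.+1 (future X 0 w)].

(** Where the maximum over [n + 1] steps is positive, it equals [a - X 1] plus the maximum of the
    restarted path, and it is at least the maximum over [n] steps. Where it is not, the maximum over
    [n] steps is 0 and the left side vanishes. *)
Lemma max_deviation_ineq n w :
  ((max_deviation n (future X 0 w) * \1_unbounded_deviation (future X 0 w))%:E +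
    (Zn \_ (deviation_event n)) w <=
   (max_deviation n (future X 1 w) * \1_unbounded_deviation (future X 1 w))%:E +
    (Zp \_ (deviation_event n)) w)%E.
Proof.
have [E0|E0] := pselect (unbounded_deviation (future X 0 w)); last first.
  rewrite !patchE !memNset//; last by case.
  rewrite !indicE !memNset ?mulr0//.
  by move=> /unbounded_deviation_shift.
have E1 := (unbounded_deviation_shift w).1 E0.
rewrite !indicE !mem_set// !mulr1.
have M0 := max_deviation_ge0 n (future X 1 w).
have Mn := max_deviation_le n (future X 0 w).
have [Ap|Ap] := ltP 0 (max_deviation n.+1 (future X 0 w)).
  rewrite !patchE !mem_set// -!EFinD lee_fin.
  move: Mn Ap; rewrite max_deviation_shift.
  have -> : Num.max (X 1 w - a) 0 = Num.max (a - X 1 w) 0 - (a - X 1 w).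
    by rewrite -[X 1 w - a]opprB !maxEle; do 2 case: ifP; lra.
  rewrite maxEle; case: ifPn => _; last by rewrite ltxx.
  lra.
rewrite !patchE !memNset; [|by move=> [_]; rewrite ltNge Ap..].
by rewrite !adde0 lee_fin (le_trans Mn) // (le_trans Ap).
Qed.

Lemma measurable_deviation_event n : measurable (deviation_event n).
Proof.
apply: measurableI.
  exact: (measurable_pre (measurable_future levyX (lexx 0))
    measurable_unbounded_deviation).
apply: measurable_lt_set => //.
exact: (measurableT_comp (measurable_max_deviation n.+1) (measurable_future levyX (lexx 0))).
Qed.

(* Garsia's maximal inequality on the shift-invariant event [unbounded_deviation]. *)
Lemma maximal_ergodic : (\int[P]_w Zp w < +oo)%E ->
  (\int[P]_(w in drift_failure) Zn w <= \int[P]_(w in drift_failure) Zp w)%E.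
Proof.
move=> Zoo; pose E' := drift_failure.
have mE' : measurable E'.
  exact: (measurable_pre (measurable_future levyX (lexx 0))
    measurable_unbounded_deviation).
pose A := deviation_event.
have mA n : measurable (A n) by exact: measurable_deviation_event.
have Zp0 w : (0 <= Zp w)%E by rewrite lee_fin le_max lexx orbT.
have Zn0 w : (0 <= Zn w)%E by rewrite lee_fin le_max lexx orbT.
have AE : \bigcup_n A n = E'.
  apply/seteqP; split => [w [n _ []]//|w wE].
  have [n wn] := wE 0%N; exists n => //; split => //.
  apply: (lt_le_trans wn); apply: (@le_trans _ _ (max_deviation n.+1 (future X 0 w))) => //.
  case: {wn}n => [|n]; first by rewrite deviation_future mulr0 addr0 subrr subr0 max_deviation_ge0.
  by rewrite (le_trans _ (max_deviation_le _ _))//= le_max lexx orbT.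
pose G n y := (max_deviation n y * \1_unbounded_deviation y)%:E.
have G0 n y : (0 <= G n y)%E by rewrite lee_fin mulr_ge0// max_deviation_ge0.
have mG n : measurable_fun setT (G n).
  apply/measurable_EFinP; apply: measurable_funM.
    exact: measurable_max_deviation.
  by apply: measurable_indic; exact: measurable_unbounded_deviation.
have mGf n r : 0 <= r -> measurable_fun setT (fun w => G n (future X r w)).
  by move=> r0; exact: (measurableT_comp (mG n) (measurable_future levyX r0)).
have step n : (\int[P]_(w in A n) Zn w <= \int[P]_(w in E') Zp w)%E.
  apply: (@le_trans _ _ (\int[P]_(w in A n) Zp w)%E); last first.
    apply: ge0_subset_integral => //.
    - exact: measurable_funTS.
    - by move=> w [].
  have Gfin : (\int[P]_w G n (future X 0 w))%E \is a fin_num.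
    rewrite ge0_fin_numE ?integral_ge0//.
    apply: le_lt_trans (expectation_max_deviation n Zoo).
    apply: ge0_le_integral => //; first exact: mGf.
      exact: mM.
    move=> w _; rewrite lee_fin ler_piMr ?max_deviation_ge0//.
  rewrite -(@leeD2lE _ _ _ _ Gfin) -{2}(@future_law _ _ _ _ _ levyX 1 (G n))//.
  rewrite [X in (_ + X <= _)%E]integral_mkcond [X in (_ <= _ + X)%E]integral_mkcond.
  have mZnA : measurable_fun setT (Zn \_ (A n)).
    by apply/(measurable_restrictT _ (mA n)); exact: measurable_funTS.
  have mZpA : measurable_fun setT (Zp \_ (A n)).
    by apply/(measurable_restrictT _ (mA n)); exact: measurable_funTS.
  have ZnA0 w : setT w -> (0 <= (Zn \_ (A n)) w)%E by rewrite patchE; case: ifP.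
  have ZpA0 w : setT w -> (0 <= (Zp \_ (A n)) w)%E by rewrite patchE; case: ifP.
  rewrite -(ge0_integralD P measurableT (fun w _ => G0 n (future X 0 w)) (mGf n 0 (lexx 0)) ZnA0 mZnA).
  rewrite -(ge0_integralD P measurableT (fun w _ => G0 n (future X 1 w)) (mGf n 1 ler01) ZpA0 mZpA).
  apply: ge0_le_integral => //.
  - by move=> w _; rewrite adde_ge0// patchE; case: ifP.
  - by apply: emeasurable_funD => //; exact: mGf.
  - by apply: emeasurable_funD => //; exact: mGf.
  - by move=> w _; exact: max_deviation_ineq.
have ndA : nondecreasing_seq A.
  move=> i j ij; apply/subsetPset => w [wE w0]; split => //.
  apply: (lt_le_trans w0); elim: j ij => [|j IH]; first by rewrite leqn0 => /eqP->.
  rewrite leq_eqVlt ltnS => /orP[/eqP->//|/IH h]; apply: (le_trans h).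
  exact: max_deviation_le.
have := @ge0_nondecreasing_set_cvg_integral _ _ _ A Zn P ndA mA.
rewrite AE => /(_ (fun _ => measurable_funTS mZn) (fun _ _ _ => Zn0 _)) cA.
rewrite -(cvg_lim _ cA)//; apply: lime_le.
  by apply/cvg_ex; exists (\int[P]_(w in E') Zn w)%E.
by apply: nearW => n; exact: step.
Qed.

(** The event can be read from [future X 1], so it is independent of [X 1]. Both integrals in the
    maximal inequality then factor through [P drift_failure], and a positive value of it would
    contradict the strict inequality of the means. *)
Lemma drift_failure_null :
  (\int[P]_w Zp w < \int[P]_w Zn w)%E -> P drift_failure = 0%E.
Proof.
move=> ZpZn; have Zoo : (\int[P]_w Zp w < +oo)%E.
  by apply: (lt_le_trans ZpZn); rewrite leey.
have mE := measurable_unbounded_deviation.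
have mE' : measurable drift_failure.
  exact: (measurable_pre (measurable_future levyX (lexx 0)) mE).
have indep (z : R -> R) : measurable_fun setT z -> (forall x, 0 <= z x) ->
    (\int[P]_(w in drift_failure) (z (X 1 w))%:E =
     \int[P]_w (z (X 1 w))%:E * P drift_failure)%E.
  move=> mz z0; pose H (p : R * rseq R) : \bar R := (z p.1 * \1_unbounded_deviation p.2)%:E.
  have mH : measurable_fun setT H.
    apply/measurable_EFinP; apply: measurable_funM; first exact: (measurableT_comp mz).
    apply: (measurableT_comp (measurable_indic mE)); exact: measurable_snd.
  have H0 p : (0 <= H p)%E by rewrite lee_fin mulr_ge0.
  transitivity (\int[P]_w H (X 1 w, future X 1 w))%E.
    rewrite integral_mkcond; apply: eq_integral => w _.
    rewrite patchE /H indicE/=; case: ifPn => [|].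
      by rewrite inE => /unbounded_deviation_shift wE; rewrite mem_set// mulr1.
    by rewrite notin_setE => wE; rewrite memNset ?mulr0// => /unbounded_deviation_shift.
  rewrite (markov_property levyX ler01 mH H0).
  transitivity (\int[P]_w ((z (X 1 w))%:E * P drift_failure))%E.
    apply: eq_integral => w _; rewrite /H /=.
    under eq_integral do rewrite EFinM.
    have mI : measurable_fun setT (fun v => (\1_unbounded_deviation (future X 0 v))%:E : \bar R).
      apply/measurable_EFinP; apply: (measurableT_comp (measurable_indic mE)).
      exact: (measurable_future levyX (lexx 0)).
    have I0 v : setT v -> (0 <= (\1_unbounded_deviation (future X 0 v))%:E :> \bar R)%E.
      by rewrite lee_fin.
    rewrite (ge0_integralZl P measurableT mI I0) ?lee_fin//.
    congr (_ * _)%E; transitivity (P (drift_failure `&` setT)); last by rewrite setIT.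
    rewrite -(integral_indic P measurableT mE').
    by apply: eq_integral => v _; rewrite !indicE.
  rewrite ge0_integralZr//.
    by apply/measurable_EFinP; exact: (measurableT_comp mz).
  by move=> w _; rewrite lee_fin.
have := maximal_ergodic Zoo.
rewrite (indep (fun x => Num.max (x - a) 0))//; last 2 first.
- by apply: measurable_maxr => //; exact: measurable_funB.
- by move=> x; rewrite le_max lexx orbT.
rewrite (indep (fun x => Num.max (a - x) 0))//; last 2 first.
- by apply: measurable_maxr => //; exact: measurable_funB.
- by move=> x; rewrite le_max lexx orbT.
move=> h; apply/eqP; rewrite eq_le measure_ge0 andbT leNgt; apply/negP => P0.
have Pfin : P drift_failure \is a fin_num by exact: fin_num_measure.
by move: h; rewrite lee_pmul2r// leNgt ZpZn.
Qed.

End garsia.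

(** * Almost sure events and monotone unions *)

Lemma ae_probability d (T : measurableType d) (R : realType) (P : probability T R)
  (A : set T) : measurable A -> P A = 1%E -> {ae P, forall w, A w}.
Proof.
move=> mA A1; exists (~` A); split => //; first exact: measurableC.
by rewrite probability_setC// A1 subee.
Qed.

Lemma probability_ae d (T : measurableType d) (R : realType) (P : probability T R)
  (A : set T) : measurable A -> {ae P, forall w, A w} -> P A = 1%E.
Proof.
move=> mA [N [mN N0 sub]].
have : P (~` A) = 0%E.
  by apply/eqP; rewrite -measure_le0 -N0; apply: le_measure; rewrite ?inE//; exact: measurableC.
by rewrite probability_setC// -(fineK (fin_num_measure P _ mA)) -EFinB => -[?]; congr EFin; lra.
Qed.

Lemma measure_bigcup_le d (T : measurableType d) (R : realType)
  (mu : {measure set T -> \bar R}) (F : nat -> set T) (c : \bar R) :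
  (forall n, measurable (F n)) -> {homo F : n m / (n <= m)%N >-> (n <= m)%O} ->
  (forall n, mu (F n) <= c)%E -> (mu (\bigcup_n F n) <= c)%E.
Proof.
move=> mF ndF Fc.
have cF := nondecreasing_cvg_mu (mu := mu) mF (bigcupT_measurable _ mF) ndF.
rewrite -(cvg_lim _ cF)//; apply: lime_le; first by apply/cvg_ex; exists (mu (\bigcup_n F n)).
by apply: nearW => n; exact: Fc.
Qed.

Lemma measure_bigcup_ge d (T : measurableType d) (R : realType)
  (mu : {measure set T -> \bar R}) (F : nat -> set T) (c : \bar R) :
  (forall n, measurable (F n)) -> {homo F : n m / (n <= m)%N >-> (n <= m)%O} ->
  (c < mu (\bigcup_n F n))%E -> exists n, (c <= mu (F n))%E.
Proof.
move=> mF ndF; rewrite ltNge => /negP cF; apply: contrapT => /forallNP H; apply: cF.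
by apply: measure_bigcup_le => // n; apply/ltW; rewrite ltNge; apply/negP; exact: H.
Qed.

Lemma prode_ge_exp (R : realType) (c : R) n (p : nat -> \bar R) : 0 <= c ->
  (forall i, (i < n)%N -> (c%:E <= p i)%E) -> ((c ^+ n)%:E <= \prod_(i < n) p i)%E.
Proof.
move=> c0; elim: n => [|n IH] cp; first by rewrite big_ord0 expr0.
rewrite big_ord_recr/= exprSr EFinM; apply: lee_pmul.
- by rewrite lee_fin exprn_ge0.
- by rewrite lee_fin.
- by apply: IH => i ni; apply: cp; exact: ltnW.
- exact: cp.
Qed.

(** * From integer times to all times *)

Section drift.
Context (R : realType) (d : measure_display) (T : measurableType d).
Variables (P : probability T R) (X : R -> T -> R).
Hypothesis levyX : levy_process P X.
Hypothesis measX : measurable_fun setT (fun p : R * T => X p.1 p.2).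

(** The mean of [X 1 - a] is the difference of the means of its positive and negative parts; this is
    the form in which the drift enters Garsia's inequality. *)
Lemma mean_gap (a : R) : P.-integrable setT (EFin \o X 1) ->
  (a%:E < \int[P]_w (X 1 w)%:E)%E ->
  (\int[P]_w (Num.max (a - X 1 w) 0)%:E < \int[P]_w (Num.max (X 1 w - a) 0)%:E)%E.
Proof.
move=> iX aX.
have ia : P.-integrable setT (EFin \o cst a) by exact: finite_measure_integrable_cst.
have : (0 < \int[P]_w ((X 1 w)%:E - a%:E))%E.
  rewrite integralB// integral_cst//= probability_setT mule1 sube_gt0//.
rewrite integralE.
have -> : (\int[P]_w (fun w => (X 1 w)%:E - a%:E)^\+ w = \int[P]_w (Num.max (X 1 w - a) 0)%:E)%E.
  by apply: eq_integral => w _; rewrite funeposE -EFinB -EFin_max.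
have -> : (\int[P]_w (fun w => (X 1 w)%:E - a%:E)^\- w = \int[P]_w (Num.max (a - X 1 w) 0)%:E)%E.
  by apply: eq_integral => w _; rewrite funenegE -EFinB -EFinN -EFin_max opprB.
by rewrite sube_gt0.
Qed.

(** By right continuity at 0, almost all of the probability is carried, for large [k], by the paths
    that stay below 1 at all dyadic times up to [2 ^- k]. *)
Lemma small_time_tight : exists K : nat, forall i, dyadic R i <= (2 ^+ K)^-1 ->
  (2^-1%:E <= P [set w | (X (dyadic R i) w <= 1)%R])%E.
Proof.
pose Q (k : nat) : set T := \bigcap_i [set w | dyadic R i <= (2 ^+ k)^-1 -> X (dyadic R i) w <= 1].
have mle i : measurable [set w | X (dyadic R i) w <= 1].
  by apply: measurable_le_set => //; apply: (measurable_levy levyX); exact: dyadic_ge0.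
have mQ k : measurable (Q k).
  apply: bigcapT_measurable => i.
  have [h|h] := pselect (dyadic R i <= (2 ^+ k)^-1); last first.
    by rewrite (_ : [set w | _] = setT)//; apply/seteqP; split => // w _ /h.
  rewrite (_ : [set w | _] = [set w | X (dyadic R i) w <= 1])//.
  by apply/seteqP; split => w /=; [exact|].
have ndQ : {homo Q : n m / (n <= m)%N >-> (n <= m)%O}.
  move=> i j ij; apply/subsetPset => w wi l _ /= h; apply: wi => //.
  apply: (le_trans h); rewrite lef_pV2 ?posrE ?exprn_gt0//.
  by rewrite ler_weXn2l// ler1n.
have QT : \bigcup_k Q k = setT.
  apply/seteqP; split => // w _.
  have := @levy_rcvg _ _ _ _ _ levyX w _ (lexx 0); rewrite (levy0 levyX).
  move=> /cvgr_le/(_ 1 ltr01) [e /= e0 he].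
  have [k _ ke] : \forall k \near \oo, ((2 ^+ k)^-1 : R) < e.
    by have /cvgr_lt := @cvg_pow_half R; apply.
  exists k => // i _ /= ik.
  have [->|i0] := eqVneq (dyadic R i) 0; first by rewrite (levy0 levyX) ler01.
  have ip : 0 < dyadic R i by rewrite lt_neqAle eq_sym i0 dyadic_ge0.
  apply: he => //=.
  rewrite sub0r normrN gtr0_norm// (le_lt_trans ik)//.
  by apply: ke => /=.
have [k hk] : exists k, (2^-1%:E <= P (Q k))%E.
  apply: contrapT => /forallNP hQ.
  suff : (P setT <= 2^-1%:E)%E.
    by rewrite probability_setT lee_fin leNgt invf_lt1 ?ltr1n.
  rewrite -QT; apply: measure_bigcup_le => // n.
  by apply/ltW; rewrite ltNge; apply/negP; exact: hQ.
exists k => i ik; apply: le_trans hk _.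
by apply: le_measure; rewrite ?inE// => w /(_ i I); apply.
Qed.

Lemma unit_time_tight : exists (b c : R), 0 < c /\
  forall k j, (j <= 2 ^ k)%N -> (c%:E <= P [set w | (X (j%:R / 2 ^+ k) w <= b)%R])%E.
Proof.
have [K HK] := small_time_tight.
(* A time in [[0, 1]] is cut into [2 ^ K] equal dyadic pieces of length at most [2 ^- K]. Their
   increments are independent and each is at most 1 with probability at least one half; if all are,
   their sum is at most [2 ^ K]. *)
exists (2 ^+ K), (2^-1 ^+ (2 ^ K)); split; first by rewrite exprn_gt0// invr_gt0.
move=> k j jk.
pose s : R := j%:R / 2 ^+ (k + K).
have s0 : 0 <= s by rewrite divr_ge0// exprn_ge0.
have sE : j%:R / 2 ^+ k = (2 ^ K)%:R * s.
  by rewrite /s natrX exprD; field; rewrite !expf_neq0.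
have sK : s <= (2 ^+ K)^-1.
  rewrite /s exprD invfM mulrA ler_piMl ?invr_ge0 ?exprn_ge0//.
  by rewrite ler_pdivrMr ?exprn_gt0// mul1r -natrX ler_nat.
have Ps : (2^-1%:E <= P [set w | (X s w <= 1)%R])%E.
  by have := HK (dyadic_index (k + K) j); rewrite dyadic_indexK; exact.
have := @levy_increments _ _ _ _ _ levyX (2 ^ K) (fun i => i%:R * s) (fun=> `]-oo, 1]%classic).
rewrite mul0r => /(_ (lexx 0)) inc.
have mS t : 0 <= t -> measurable_fun setT (X t) by move=> t0; exact: (measurable_levy levyX).
apply: (@le_trans _ _ (P [set w | forall i, (i < 2 ^ K)%N ->
    `]-oo, 1]%classic (X (i.+1%:R * s) w - X (i%:R * s) w)])).
  rewrite inc//; last by move=> i; rewrite ler_wpM2r// ler_nat.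
  apply: (@prode_ge_exp _ _ _ (fun i => P [set w | `]-oo, 1]%classic (X (i.+1%:R * s - i%:R * s) w)])).
    by rewrite invr_ge0.
  move=> i _; have -> : i.+1%:R * s - i%:R * s = s by rewrite -natr1; ring.
  by rewrite [X in P X](_ : _ = [set w | X s w <= 1])//; apply/seteqP; split => w; rewrite /= in_itv.
apply: le_measure; rewrite ?inE.
- rewrite (_ : [set w | _] = \bigcap_(i in [set i | (i < 2 ^ K)%N])
    [set w | `]-oo, 1]%classic (X (i.+1%:R * s) w - X (i%:R * s) w)]); last first.
    by apply/seteqP; split => w h i; exact: h.
  apply: fin_bigcap_measurable => [|i _]; first exact: finite_II.
  apply: (@measurable_pre _ _ _ _ (fun w => X (i.+1%:R * s) w - X (i%:R * s) w)) => //.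
  by apply: measurable_funB; apply: mS; rewrite mulr_ge0.
- by apply: measurable_le_set => //; apply: mS; rewrite divr_ge0// exprn_ge0.
- move=> w /= h; rewrite sE -[X _ _]subr0 -(levy0 levyX w).
  have -> : X 0 w = X (0%:R * s) w by rewrite mul0r.
  rewrite -(telescope_sumr (fun i => X (i%:R * s) w) (leq0n _)) big_mkord.
  rewrite -natrX -[X in _ <= X%:R]card_ord -sumr_const; apply: ler_sum => i _.
  by have := h i (ltn_ord i); rewrite in_itv.
Qed.


Variable a : R.
Hypothesis a0 : 0 <= a.

Definition grid_crossing (b : R) (k : nat) : set T :=
  \bigcup_j [set w | b < a * (j%:R / 2 ^+ k) - X (j%:R / 2 ^+ k) w].

Definition integer_crossing (b : R) : set T :=
  \bigcup_n [set w | b < a * n%:R - X n%:R w].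

Lemma measurable_crossing b s : 0 <= s -> measurable [set w | b < a * s - X s w].
Proof.
move=> s0; apply: measurable_lt_set => //; apply: measurable_funB => //.
exact: (measurable_levy levyX).
Qed.

Lemma measurable_grid_crossing b k : measurable (grid_crossing b k).
Proof.
apply: bigcupT_measurable => j; apply: measurable_crossing.
by rewrite divr_ge0// exprn_ge0.
Qed.

Lemma measurable_integer_crossing b : measurable (integer_crossing b).
Proof. by apply: bigcupT_measurable => j; apply: measurable_crossing. Qed.

(* First passage on the grid: just after the first crossing of level [b], the
   path has conditional probability at least [c] of not having moved up by more
   than [v] at the next integer time. *)
Lemma grid_crossing_le (v c : R) : 0 < c ->
  (forall k j, (j <= 2 ^ k)%N -> (c%:E <= P [set w | (X (j%:R / 2 ^+ k) w <= v)%R])%E) ->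
  forall b k, (c%:E * P (grid_crossing b k) <= P (integer_crossing (b - v)))%E.
Proof.
move=> c0 Hc b k.
pose t j : R := j%:R / 2 ^+ k.
have t0 j : 0 <= t j by rewrite divr_ge0// exprn_ge0.
pose B' j := [set y : rseq R | b < a * t j - y (dyadic_index k j)].
pose B j := [set w | b < a * t j - X (t j) w].
have mB' j : measurable (B' j).
  by apply: measurable_lt_set => //; apply: measurable_funB => //; exact: measurable_coord.
have mB j : measurable (B j) by exact: measurable_crossing.
pose F := seqDU B; pose F' := seqDU B'.
have mF j : measurable (F j) by apply: measurableD => //; apply: bigsetU_measurable.
have mF' j : measurable (F' j) by apply: measurableD => //; apply: bigsetU_measurable.
have FF' j : F j = past X (t j) @^-1` F' j.
  rewrite /F /F' /seqDU -!bigcup_mkord.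
  have BB' i : (i <= j)%N -> B i = past X (t j) @^-1` B' i.
    move=> ij; apply/seteqP; split => w; rewrite /B/= /B'/= /past dyadic_indexK -/(t i);
    by rewrite (min_idPl _)// ler_wpM2r ?invr_ge0 ?exprn_ge0// ler_nat.
  rewrite -[RHS]/(past X (t j) @^-1` B' j `\` past X (t j) @^-1` (\bigcup_(i < j) B' i)).
  rewrite -BB'// preimage_bigcup; congr (_ `\` _).
  by apply: eq_bigcupr => i /= ij; rewrite BB'// ltnW.
(* The number of grid steps from [t j] to the next integer strictly after it: at most [2 ^ k], that
   is, at most one unit of time. *)
pose m j := ((j %/ 2 ^ k).+1 * 2 ^ k - j)%N.
pose E j : set (rseq R) := [set y | y (dyadic_index k (m j)) <= v].
have mE j : measurable (E j).
  by apply: measurable_le_set => //; exact: measurable_coord.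
have mP j : (m j <= 2 ^ k)%N.
  by rewrite /m leq_subLR mulSn addnC leq_add2r leq_trunc_div.
have tm j : t j + t (m j) = (j %/ 2 ^ k).+1%:R.
  rewrite /t -mulrDl -natrD subnKC; last first.
    by rewrite ltnW// ltn_ceil// expn_gt0.
  by rewrite natrM natrX mulfK// expf_neq0.
have FE j : (c%:E * P (F j) <= P (F j `&` future X (t j) @^-1` E j))%E.
  rewrite FF' (past_future_indep levyX)// muleC lee_wpmul2l//.
  apply: le_trans (Hc k (m j) (mP j)) _.
  rewrite (_ : [set w | _] = future X 0 @^-1` E j)//.
  by apply/seteqP; split => w; rewrite /E/= /future dyadic_indexK add0r (levy0 levyX) subr0.
have FEG : \bigcup_j (F j `&` future X (t j) @^-1` E j) `<=` integer_crossing (b - v).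
  move=> w [j _ [[Bj _] Ej]]; exists (j %/ 2 ^ k).+1 => //=.
  move: Bj Ej; rewrite /B /E/= /future dyadic_indexK -/(t (m j)) tm => h1 h2.
  have : a * t j <= a * (j %/ 2 ^ k).+1%:R by rewrite ler_wpM2l// -tm lerDl.
  lra.
have mFE j : measurable (F j `&` future X (t j) @^-1` E j).
  apply: measurableI => //; exact: (measurable_pre (measurable_future levyX (t0 j))).
rewrite /grid_crossing -/(\bigcup_j B j) (seqDU_bigcup_eq B).
rewrite (measure_bigcup P setT (seqDU B) (fun i _ => mF i) (@trivIset_seqDU _ B)).
apply: (@le_trans _ _ (P (\bigcup_j (F j `&` future X (t j) @^-1` E j)))); last first.
  apply: le_measure => //; rewrite inE; last exact: measurable_integer_crossing.
  exact: bigcupT_measurable.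
rewrite (measure_bigcup P setT _ (fun i _ => mFE i)); last first.
  by apply: trivIset_setIr; exact: trivIset_seqDU.
rewrite -nneseriesZl//; apply: lee_nneseries => //.
  by move=> i _ _; rewrite mule_ge0// lee_fin ltW.
by move=> i _; exact: FE.
Qed.

Lemma grid_crossing_nd b : {homo grid_crossing b : n m / (n <= m)%N >-> (n <= m)%O}.
Proof.
move=> i j ij; apply/subsetPset => w [l _ /= h]; exists (l * 2 ^ (j - i))%N => //=.
suff -> : (l * 2 ^ (j - i))%:R / 2 ^+ j = l%:R / 2 ^+ i :> R by [].
rewrite -{2}(subnKC ij) exprD natrM natrX; field.
by rewrite !expf_neq0.
Qed.

(** A crossing of level [b] on some grid is, up to the factor [c], no more likely than a crossing of
    level [b - v] at an integer time. The latter events decrease, as the level grows, into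
    [drift_failure], which is null. *)
Lemma linear_growth : (\int[P]_w (Num.max (a - X 1 w) 0)%:E <
    \int[P]_w (Num.max (X 1 w - a) 0)%:E)%E ->
  P (\bigcap_(b : nat) \bigcup_k grid_crossing b%:R k) = 0%E.
Proof.
move=> gap; have [v [c [c0 Hc]]] := unit_time_tight.
have H b : (c%:E * P (\bigcup_k grid_crossing b k) <= P (integer_crossing (b - v)))%E.
  rewrite muleC -lee_pdivlMr//; apply: measure_bigcup_le.
  - exact: measurable_grid_crossing.
  - exact: grid_crossing_nd.
  - by move=> k; rewrite lee_pdivlMr// muleC; exact: grid_crossing_le.
pose G := \bigcap_(b : nat) \bigcup_k grid_crossing b%:R k.
have mGb (b : nat) : measurable (\bigcup_k grid_crossing b%:R k).
  by apply: bigcupT_measurable => k; exact: measurable_grid_crossing.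
pose I n := integer_crossing (n%:R - v).
have mI n : measurable (I n) by exact: measurable_integer_crossing.
have cI : (P \o I) x @[x --> \oo] --> 0%E.
  rewrite -(_ : P (\bigcap_n I n) = 0%E); last first.
    apply/eqP; rewrite eq_le measure_ge0 andbT.
    rewrite -(drift_failure_null levyX gap); apply: le_measure; rewrite ?inE.
    - exact: bigcapT_measurable.
    - exact: (measurable_pre (measurable_future levyX (lexx 0)) (measurable_unbounded_deviation a)).
    - move=> w wI b; have [n _ /= hn] := wI (Num.trunc (b%:R + v)).+1 Logic.I.
      exists n; rewrite deviation_future add0r (levy0 levyX) subr0.
      by have := truncnS_gt (b%:R + v); lra.
  apply: nonincreasing_cvg_mu => //.
  - by rewrite (le_lt_trans (probability_le1 _ _)) ?ltry.
  - exact: bigcapT_measurable.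
  - move=> i j ij; apply/subsetPset => w [n _ /= hn]; exists n => //=.
    by apply: le_lt_trans hn; rewrite lerD2r ler_nat.
have : (c%:E * P G <= 0)%E.
  rewrite -(cvg_lim _ cI)//; apply: lime_ge; first by apply/cvg_ex; exists 0%E.
  apply: nearW => n; apply: le_trans (H n%:R).
  rewrite lee_wpmul2l ?lee_fin ?(ltW c0)//; apply: le_measure; rewrite ?inE//.
    exact: bigcapT_measurable.
  by move=> w; apply.
rewrite -[X in (_ <= X)%E](mule0 c%:E) lee_pmul2l// => PG.
by apply/eqP; rewrite eq_le PG measure_ge0.
Qed.

(** Imposed at dyadic times only, which makes it a countable intersection; right continuity gives
    all times in [above_lineE]. *)
Definition above_line (b : R) : set (rseq R) :=
  [set y | forall i, a * dyadic R i - b <= y i].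

Lemma measurable_above_line b : measurable (above_line b).
Proof.
have -> : above_line b = \bigcap_i [set y | a * dyadic R i - b <= y i].
  by apply/seteqP; split => [y h i _|y h i]; [exact: h|exact: (h i I)].
apply: bigcapT_measurable => i; apply: measurable_le_set => //.
exact: measurable_coord.
Qed.

Lemma above_lineE b r w : 0 <= r ->
  above_line b (future X r w) -> forall s, 0 <= s -> X r w + (a * s - b) <= X (r + s) w.
Proof.
move=> r0 h s s0.
pose u k := dyadic R (dyadic_above k s).
have cu : u k @[k --> \oo] --> s by exact: cvg_dyadic_above.
have cX : X (r + u k) w @[k --> \oo] --> X (r + s) w.
  have := @levy_rcvg _ _ _ _ _ levyX w _ (addr_ge0 r0 s0).
  move/cvg_at_rightP; apply; split => [n|]; first by rewrite ltrD2l dyadic_above_gt.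
  by apply: cvgD => //; exact: cvg_cst.
have cL : X r w + (a * u k - b) @[k --> \oo] --> X r w + (a * s - b).
  apply: cvgD; first exact: cvg_cst.
  by apply: cvgB; [apply: cvgM => //; exact: cvg_cst|exact: cvg_cst].
rewrite -(cvg_lim _ cX)// -(cvg_lim _ cL)//; apply: ler_lim.
- by apply/cvg_ex; exists (X r w + (a * s - b)).
- by apply/cvg_ex; exists (X (r + s) w).
- by apply: nearW => k; have := h (dyadic_above k s); rewrite /future -/(u k); lra.
Qed.

Lemma above_line_ae : (\int[P]_w (Num.max (a - X 1 w) 0)%:E <
    \int[P]_w (Num.max (X 1 w - a) 0)%:E)%E ->
  P (\bigcup_(b : nat) (future X 0 @^-1` above_line b%:R)) = 1%E.
Proof.
move=> gap; have G0 := linear_growth gap.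
have mU : measurable (\bigcup_(b : nat) (future X 0 @^-1` above_line b%:R)).
  apply: bigcupT_measurable => b.
  exact: (measurable_pre (measurable_future levyX (lexx 0)) (measurable_above_line _)).
apply/eqP; rewrite eq_le probability_le1//=.
rewrite -[X in (X <= _)%E](_ : P (~` \bigcap_(b : nat) \bigcup_k grid_crossing b%:R k) = 1%E); last first.
  rewrite probability_setC ?G0 ?sube0//; apply: bigcapT_measurable => b.
  by apply: bigcupT_measurable => k; exact: measurable_grid_crossing.
apply: le_measure; rewrite ?inE//.
  apply: measurableC; apply: bigcapT_measurable => b.
  by apply: bigcupT_measurable => k; exact: measurable_grid_crossing.
rewrite setC_bigcap => w [b _ wb]; exists b => // i.
rewrite /future add0r (levy0 levyX) subr0.
apply: contrapT => /negP; rewrite -ltNge => hi; apply: wb.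
move: hi; rewrite /dyadic; case: unpickle => [[k j]|]; last first.
  rewrite (levy0 levyX) mulr0 sub0r oppr_gt0 => /lt_le_trans/(_ (ler0n _ b)).
  by rewrite ltxx.
by move=> h; exists k => //; exists j => //=; lra.
Qed.

End drift.

(** * Occupation densities *)

Section lower_density.
Context d (T : measurableType d) (R : realType) (mu : {measure set T -> \bar R}).
Import HBNNSimple.

Lemma lower_integralE (f : T -> \bar R) : (forall x, 0 <= f x)%E ->
  (\int[mu]_x f x = ereal_sup [set sintegral mu h |
    h in [set h : {nnsfun T >-> R} | forall x, ((h x)%:E <= f x)%E]])%E.
Proof. exact: ge0_integralTE. Qed.

Lemma le_lower_integral (f g : T -> \bar R) : (forall x, 0 <= f x)%E ->
  (forall x, f x <= g x)%E -> (\int[mu]_x f x <= \int[mu]_x g x)%E.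
Proof.
move=> f0 fg; rewrite !lower_integralE//; last by move=> x; exact: le_trans (fg x).
apply: ge_ereal_sup => _ [h /= hf <-]; apply: ereal_sup_ubound; exists h => //= x.
exact: le_trans (hf x) (fg x).
Qed.

(** A simple minorant on [A] and one on its complement add up to a simple minorant of [f], so lower
    integrals are superadditive. Finiteness permits moving the terms across before each supremum is
    taken. *)
Lemma lower_integral_split (f : T -> R) (A : set T) : (forall x, 0 <= f x) ->
  (\int[mu]_x (f x)%:E < +oo)%E ->
  (\int[mu]_x (f x * \1_A x)%:E + \int[mu]_x (f x * \1_(~` A) x)%:E <=
   \int[mu]_x (f x)%:E)%E.
Proof.
move=> f0 foo.
have I0 B x : (0 <= (f x * \1_B x)%:E :> \bar R)%E by rewrite lee_fin mulr_ge0.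
have If B x : ((f x * \1_B x)%:E <= (f x)%:E)%E.
  by rewrite lee_fin ler_piMr// indicE; case: (_ \in _).
have fin B : (\int[mu]_x (f x * \1_B x)%:E)%E \is a fin_num.
  rewrite ge0_fin_numE ?integral_ge0//; apply: le_lt_trans foo.
  exact: le_lower_integral.
rewrite -leeBrDr//.
rewrite [X in (X <= _)%E]lower_integralE//; apply: ge_ereal_sup => _ [h /= hA <-].
rewrite leeBrDr// addeC -leeBrDr; last first.
  rewrite ge0_fin_numE ?sintegral_ge0//; apply: le_lt_trans foo.
  rewrite lower_integralE; last by move=> x; rewrite lee_fin.
  by apply: ereal_sup_ubound; exists h => //= x; exact: le_trans (hA x) (If A x).
rewrite [X in (X <= _)%E]lower_integralE//; apply: ge_ereal_sup => _ [k /= kA <-].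
rewrite leeBrDr; last first.
  rewrite ge0_fin_numE ?sintegral_ge0//; apply: le_lt_trans foo.
  rewrite lower_integralE; last by move=> x; rewrite lee_fin.
  by apply: ereal_sup_ubound; exists h => //= x; exact: le_trans (hA x) (If A x).
rewrite -sintegralD lower_integralE; last by move=> x; rewrite lee_fin.
apply: ereal_sup_ubound; exists (add_nnsfun k h) => //= x.
have := kA x; have := hA x; rewrite !lee_fin !indicE in_setC.
by case: (x \in A); rewrite /= ?mulr1 ?mulr0; lra.
Qed.

(* The library's integral of a possibly non-measurable nonnegative function is
   its lower integral; it is computed by a measurable minorant. *)
Lemma lower_density (l : T -> R) : (forall x, 0 <= l x) ->
  (\int[mu]_x (l x)%:E < +oo)%E ->
  exists h : T -> R, [/\ measurable_fun setT h, forall x, 0 <= h x &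
    forall A, measurable A ->
      (\int[mu]_x (l x * \1_A x)%:E = \int[mu]_(x in A) (h x)%:E)%E].
Proof.
move=> l0 loo.
have l0' x : (0 <= (l x)%:E :> \bar R)%E by rewrite lee_fin.
have lfin : (\int[mu]_x (l x)%:E)%E \is a fin_num.
  by rewrite ge0_fin_numE// integral_ge0.
have /choice[g Hg] : forall n : nat, exists h : {nnsfun T >-> R},
    (forall x, h x <= l x) /\ (\int[mu]_x (l x)%:E - n.+1%:R^-1%:E < sintegral mu h)%E.
  move=> n; have n0 : 0 < n.+1%:R^-1 :> R by rewrite invr_gt0.
  have := lfin; rewrite {1}lower_integralE// => lf.
  have [_ [h /= hl <-]] := ub_ereal_sup_adherent n0 lf.
  by rewrite -lower_integralE// => hh; exists h; split => // x; rewrite -lee_fin.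
have ub x : has_ubound (range (fun n => g n x)).
  by exists (l x) => _ [n _ <-]; exact: (Hg n).1.
(* The supremum of simple minorants whose integrals approach the lower integral of [l]: measurable,
   below [l], and of the same total integral. *)
pose h x := sups (fun n => g n x) 0%N.
have gh n x : g n x <= h x by apply: ub_le_sup; [exact/has_ubound_sdrop|exists n].
have hl x : h x <= l x.
  apply: ge_sup; first by exists (g 0%N x); exists 0%N.
  by move=> _ [n _ <-]; exact: (Hg n).1.
have h0 x : 0 <= h x by apply: le_trans (gh 0%N x).
have mh : measurable_fun setT h by apply: measurable_fun_sups.
have hE : (\int[mu]_x (h x)%:E = \int[mu]_x (l x)%:E)%E.
  apply/eqP; rewrite eq_le; apply/andP; split.
    by apply: le_lower_integral => x; rewrite lee_fin.
  apply/lee_addgt0Pr => e e0.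
  have [n ne] : exists n, n.+1%:R^-1 < e.
    exists (Num.trunc e^-1); rewrite invf_plt ?posrE//.
    exact: truncnS_gt.
  rewrite -leeBlDr//; apply: (@le_trans _ _ (sintegral mu (g n))).
    apply: le_trans (ltW (Hg n).2); rewrite leeD2l// leeN2 lee_fin; exact: ltW.
  rewrite -integralT_nnsfun; apply: le_lower_integral => x; first by rewrite lee_fin.
  by rewrite lee_fin.
exists h; split => // A mA.
have hAE B : measurable B -> (\int[mu]_(x in B) (h x)%:E = \int[mu]_x (h x * \1_B x)%:E)%E.
  move=> mB; rewrite integral_mkcond; apply: eq_integral => x _.
  by rewrite patchE indicE; case: ifP => _; rewrite ?mulr1 ?mulr0.
have hlA B : (\int[mu]_x (h x * \1_B x)%:E <= \int[mu]_x (l x * \1_B x)%:E)%E.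
  apply: le_lower_integral => x; first by rewrite lee_fin mulr_ge0.
  by rewrite lee_fin ler_wpM2r.
have hsum : (\int[mu]_x (h x * \1_A x)%:E + \int[mu]_x (h x * \1_(~` A) x)%:E = \int[mu]_x (l x)%:E)%E.
  rewrite -hE -!hAE//; last exact: measurableC.
  rewrite -ge0_integral_setU//; last 4 first.
  - exact: measurableC.
  - by rewrite setUv; exact/measurable_EFinP.
  - by move=> x _; rewrite lee_fin.
  - by apply/disj_setPS; rewrite setICr.
  by rewrite setUv.
have fl B : (\int[mu]_x (l x * \1_B x)%:E)%E \is a fin_num.
  rewrite ge0_fin_numE ?integral_ge0//; last by move=> x _; rewrite lee_fin mulr_ge0.
  apply: le_lt_trans loo; apply: le_lower_integral => x; first by rewrite lee_fin mulr_ge0.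
  by rewrite lee_fin ler_piMr// indicE; case: (_ \in _).
have fh B : (\int[mu]_x (h x * \1_B x)%:E)%E \is a fin_num.
  rewrite ge0_fin_numE ?integral_ge0//; last by move=> x _; rewrite lee_fin mulr_ge0.
  by apply: le_lt_trans (hlA B) _; rewrite -ge0_fin_numE// integral_ge0// => x _; rewrite lee_fin mulr_ge0.
(* On [A] and on its complement the integral of [h] is at most the lower integral of [l]. The two
   lower integrals add up to no more than the total, so both inequalities are equalities. *)
have := lower_integral_split A l0 loo; rewrite -hsum hAE//.
move: (hlA A) (hlA (~` A)).
rewrite -(fineK (fl A)) -(fineK (fl (~` A))) -(fineK (fh A)) -(fineK (fh (~` A))).
by rewrite -!EFinD !lee_fin => h1 h2 h3; congr EFin; lra.
Qed.

End lower_density.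

Section density_measure.
Context d (T : measurableType d) (R : realType) (mu : {measure set T -> \bar R}).
Variable h : T -> R.
Hypotheses (mh : measurable_fun setT h) (h0 : forall x, 0 <= h x).

Definition density_measure (A : set T) : \bar R := (\int[mu]_(x in A) (h x)%:E)%E.

Let density0 : density_measure set0 = 0%E.
Proof. exact: integral_set0. Qed.

Let density_ge0 A : (0 <= density_measure A)%E.
Proof. by apply: integral_ge0 => x _; rewrite lee_fin. Qed.

Let density_sigma_additive : semi_sigma_additive density_measure.
Proof.
move=> F mF tF mUF; rewrite /density_measure ge0_integral_bigcup//; last 2 first.
- by apply: measurable_funTS; exact/measurable_EFinP.
- by move=> x _; rewrite lee_fin.
by apply: is_cvg_nneseries => n _ _; exact: density_ge0.
Qed.

HB.instance Definition _ := isMeasure.Build _ _ _ density_measure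
  density0 density_ge0 density_sigma_additive.

Definition measure_of_density : {measure set T -> \bar R} := density_measure.

End density_measure.

Section occupation_density.
Context (R : realType).
Local Notation leb := (@leb R).
Local Notation lam := (@lebesgue_measure R).

(** A countable pi-system generating the Borel sets. The occupation formula holds off a null set
    depending on the test function, so only countably many test functions can be used on the same
    path. *)
Definition ray (i : nat) : set R := `]-oo, ratr (odflt 0%Q (unpickle i))[%classic.

Lemma measurable_rational_rays : measurable = <<s [set A : set R |
  exists i : nat, A = ray i] >>.
Proof.
have -> : (measurable : set (set R)) = <<s @RGenInftyO.G R >>.
  exact: RGenInftyO.measurableE.
apply/seteqP; split; apply: smallest_sub.
- exact: smallest_sigma_algebra.
- move=> _ [x ->].
  pose F (i : nat) := let q : R := ratr (odflt 0%Q (unpickle i)) in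
    if q <= x then `]-oo, q[%classic else set0.
  have -> : `]-oo, x[%classic = \bigcup_i F i.
    apply/seteqP; split => [y|y [i _]]; rewrite /F /=; last first.
      by case: ifP => //= qx; rewrite !in_itv/= => /lt_le_trans; apply.
    rewrite in_itv/= => yx.
    have [q] := rat_in_itvoo yx; rewrite in_itv/= => /andP[yq qx].
    by exists (pickle q) => //; rewrite /F pickleK/= ltW//= in_itv.
  apply: sigma_algebra_bigcup => i; rewrite /F; case: ifP => _.
    by apply: sub_sigma_algebra; exists i.
  exact: sigma_algebra0.
- exact: smallest_sigma_algebra.
- by move=> _ [i ->]; apply: sub_sigma_algebra; eexists.
Qed.

Lemma sub_fin_num (a b : \bar R) : (0 <= a)%E -> (0 <= b)%E ->
  (a - b)%E \is a fin_num -> a \is a fin_num /\ b \is a fin_num.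
Proof. by case: a b => [a||] [b||]. Qed.

(** The function [l] may change sign and need not be measurable. Its positive and negative parts
    have measurable substitutes [hp] and [hn]; on rays, hence on all Borel sets, the occupation
    measure plus the measure of density [hn] is the measure of density [hp], so [hp] dominates. *)
Lemma occupation_dominated (x l : R -> R) : measurable_fun setT x ->
  (forall i, \int[lam]_(s in `[0%R, 1%R]) (\1_(ray i) (x s))%:E =
             \int[lam]_(y in setT) (\1_(ray i) y * l y)%:E)%E ->
  (\int[lam]_(s in `[0%R, 1%R]) 1%:E = \int[lam]_(y in setT) (1 * l y)%:E)%E ->
  exists h : R -> R, [/\ measurable_fun setT h, forall y, 0 <= h y,
    (\int[leb]_y (h y)%:E < +oo)%E &
    forall B, measurable B ->
      (leb ([set s | B (x s)] `&` `[0%R, 1%R]) <= \int[leb]_(y in B) (h y)%:E)%E].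
Proof.
move=> mx xray xT.
pose lp y := Num.max (l y) 0; pose ln y := Num.max (- l y) 0.
have lp0 y : 0 <= lp y by rewrite le_max lexx orbT.
have ln0 y : 0 <= ln y by rewrite le_max lexx orbT.
have split_int (A : set R) : (\int[lam]_(y in setT) (\1_A y * l y)%:E =
    \int[lam]_y (lp y * \1_A y)%:E - \int[lam]_y (ln y * \1_A y)%:E)%E.
  rewrite integralE; congr (_ - _)%E; apply: eq_integral => y _.
    rewrite funeposE -EFin_max /lp !indicE; case: (y \in A); rewrite ?mul1r ?mul0r ?mulr1 ?mulr0//.
    by rewrite maxxx.
  rewrite funenegE -EFinN -EFin_max /ln !indicE; case: (y \in A); rewrite ?mul1r ?mul0r ?mulr1 ?mulr0//.
  by rewrite oppr0 maxxx.
have I0 f (A : set R) : (forall y, 0 <= f y) -> (0 <= \int[lam]_y (f y * \1_A y)%:E)%E.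
  by move=> f0; apply: integral_ge0 => y _; rewrite lee_fin mulr_ge0.
have T1 (f : R -> R) : (\int[lam]_y (f y * \1_setT y)%:E = \int[lam]_y (f y)%:E)%E.
  by apply: eq_integral => y _; rewrite indicT mulr1.
(* The test function 1 gives the value 1 for the difference of these two integrals, which forces
   both to be finite. *)
have [fp fn] : (\int[lam]_y (lp y)%:E)%E \is a fin_num /\
               (\int[lam]_y (ln y)%:E)%E \is a fin_num.
  rewrite -(T1 lp) -(T1 ln); apply: sub_fin_num; [exact: I0|exact: I0|].
  rewrite -split_int (_ : (\int[_]_(_ in _) _)%E = 1%:E)//.
  rewrite -[RHS](_ : (\int[lam]_(s in `[0%R, 1%R]) 1%:E = 1%:E)%E).
    by rewrite xT; apply: eq_integral => y _; rewrite indicT.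
  by rewrite integral_cst//= mul1e lebesgue_measure_itv/= lte_fin ltr01 oppr0 adde0.
have lpoo : (\int[lam]_y (lp y)%:E < +oo)%E.
  by rewrite -ge0_fin_numE// integral_ge0// => y _; rewrite lee_fin.
have lnoo : (\int[lam]_y (ln y)%:E < +oo)%E.
  by rewrite -ge0_fin_numE// integral_ge0// => y _; rewrite lee_fin.
have [hp [mhp hp0 hpE]] := @lower_density _ (measurableTypeR R) R lam lp lp0 lpoo.
have [hn [mhn hn0 hnE]] := @lower_density _ (measurableTypeR R) R lam ln ln0 lnoo.
have mhp' : measurable_fun setT (hp : R -> R) by [].
have mhn' : measurable_fun setT (hn : R -> R) by [].
have toleb (f : R -> R) (A : set R) : measurable_fun setT f -> (forall y, 0 <= f y) ->
    measurable A -> (\int[leb]_(y in A) (f y)%:E = \int[lam]_(y in A) (f y)%:E)%E.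
  move=> mf f0 mA; apply: ge0_integral_leb => //.
    by apply: measurable_funTS; exact/measurable_EFinP.
  by move=> y _; rewrite lee_fin.
have mI01 : measurable (`[0, 1]%classic : set R) by [].
have hpoo : (\int[leb]_y (hp y)%:E < +oo)%E by rewrite toleb// -hpE// T1.
have hnoo : (\int[leb]_y (hn y)%:E < +oo)%E by rewrite toleb// -hnE// T1.
pose m1 := image_measure (mrestr leb mI01) mx.
pose mp := measure_of_density leb mhp' hp0.
pose mn := measure_of_density leb mhn' hn0.
have m1E B : m1 B = leb ([set s | B (x s)] `&` `[0%R, 1%R]) by [].
have mpE B : mp B = (\int[leb]_(y in B) (hp y)%:E)%E by [].
have mnE B : mn B = (\int[leb]_(y in B) (hn y)%:E)%E by [].
have mray i : measurable (ray i) by exact: measurable_itv.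
have finp B : measurable B -> mp B \is a fin_num.
  move=> mB; rewrite mpE ge0_fin_numE ?integral_ge0//; last by move=> y _; rewrite lee_fin.
  apply: le_lt_trans hpoo; apply: ge0_subset_integral => //.
    exact/measurable_EFinP.
  by move=> y _; rewrite lee_fin.
have finn B : measurable B -> mn B \is a fin_num.
  move=> mB; rewrite mnE ge0_fin_numE ?integral_ge0//; last by move=> y _; rewrite lee_fin.
  apply: le_lt_trans hnoo; apply: ge0_subset_integral => //.
    exact/measurable_EFinP.
  by move=> y _; rewrite lee_fin.
have onray i : (m1 (ray i) + mn (ray i) = mp (ray i))%E.
  have -> : m1 (ray i) = (mp (ray i) - mn (ray i))%E.
    rewrite mpE mnE (toleb hp)// (toleb hn)// -hpE; last exact: mray.
    rewrite -hnE; last exact: mray.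
    rewrite -split_int -xray m1E.
    rewrite -[RHS]ge0_integral_leb//.
    - rewrite (_ : (fun s => _) = (fun s => (\1_[set s | ray i (x s)] s)%:E)).
        by rewrite integral_indic//; exact: (measurable_pre mx).
      by apply/funext => s; rewrite !indicE; congr ((_ _)%:R%:E); apply/idP/idP; rewrite !inE.
    - by apply/measurable_EFinP; apply: measurable_funTS; exact: (measurableT_comp (measurable_indic (mray i))).
  by rewrite subeK// finn.
exists hp; split => // B mB.
have : measure_add m1 mn B = mp B.
  apply: (measure_unique [set A : set R | exists i : nat, A = ray i]
    (fun k => ray (pickle (k%:Q))) measurable_rational_rays) => //.
  - move=> _ _ [i ->] [j ->]; rewrite /ray.
    have [ij|/ltW ij] := leP (ratr (odflt 0%Q (unpickle i)) : R) (ratr (odflt 0%Q (unpickle j))).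
      exists i; apply/seteqP; split => [y []//|y /= yi]; split => //=.
      by move: yi; rewrite !in_itv/= => /lt_le_trans; apply.
    exists j; apply/seteqP; split => [y []//|y /= yi]; split => //=.
    by move: yi; rewrite !in_itv/= => /lt_le_trans; apply.
  - by move=> i; exists (pickle (i%:Q)).
  - apply/seteqP; split => // y _; exists (Num.trunc `|y|).+1 => //.
    rewrite /ray pickleK/= in_itv/= ratr_int.
    by have := truncnS_gt `|y|; have := ler_norm y; lra.
  - by move=> _ [i ->]; exact: (etrans (measure_addE m1 mn _) (onray i)).
  - move=> k; have : (m1 (ray (pickle (k%:Q))) + mn (ray (pickle (k%:Q))) < +oo)%E.
      by rewrite onray -ge0_fin_numE ?finp.
    by rewrite -(measure_addE m1 mn).
rewrite (measure_addE m1 mn) -mpE => <-; rewrite -m1E.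
by rewrite leeDl.
Qed.

End occupation_density.

(** * Crowded levels of a single path *)

Section occupation_tight.
Context (R : realType).
Local Notation leb := (@leb R).
Local Notation tm := (@time_measure R).

Lemma integral_tail (h : R -> R) (e : R) : 0 < e -> measurable_fun setT h ->
  (forall y, 0 <= h y) -> (\int[leb]_y (h y)%:E < +oo)%E ->
  exists N : nat, (\int[leb]_(y in ~` [set y : R | (`|y| <= N%:R)%R /\ (h y <= N%:R)%R]) (h y)%:E <= e%:E)%E.
Proof.
move=> e0 mh h0 hoo.
pose C (N : nat) := [set y : R | (`|y| <= N%:R)%R /\ (h y <= N%:R)%R].
have mC N : measurable (C N).
  apply: measurableI; apply: measurable_le_set => //.
have mh' : measurable_fun setT (EFin \o h) by exact/measurable_EFinP.
have ndC : nondecreasing_seq C.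
  by move=> i j ij; apply/subsetPset => y [y1 y2]; split;
    [apply: (le_trans y1)|apply: (le_trans y2)]; rewrite ler_nat.
have CT : \bigcup_N C N = setT.
  apply/seteqP; split => // y _; exists (Num.trunc (`|y| + h y)).+1 => //.
  have := truncnS_gt (`|y| + h y); have := normr_ge0 y; have := h0 y.
  by split; lra.
have h0' y : (0 <= (h y)%:E :> \bar R)%E by rewrite lee_fin.
have := @ge0_nondecreasing_set_cvg_integral _ _ _ C (EFin \o h) leb ndC mC
  (fun _ => measurable_funTS mh') (fun _ _ _ => h0' _).
rewrite CT => cC.
have fin A : measurable A -> (\int[leb]_(y in A) (h y)%:E)%E \is a fin_num.
  move=> mA; rewrite ge0_fin_numE ?integral_ge0//; apply: le_lt_trans hoo.
  exact: ge0_subset_integral.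
have splitC N : (\int[leb]_y (h y)%:E = \int[leb]_(y in C N) (h y)%:E + \int[leb]_(y in ~` C N) (h y)%:E)%E.
  rewrite -{1}(setUv (C N)) ge0_integral_setU//.
  - exact: measurableC.
  - by rewrite setUv.
  - by apply/disj_setPS; rewrite setICr.
apply: contrapT => /forallNP H.
have : (\int[leb]_y (h y)%:E <= \int[leb]_y (h y)%:E - e%:E)%E.
  rewrite -{1}(cvg_lim _ cC)//; apply: lime_le; first by apply/cvg_ex; exists (\int[leb]_y (h y)%:E)%E.
  apply: nearW => N; rewrite (splitC N) leeBrDr//; apply: leeD2l.
  by apply/ltW; rewrite ltNge; apply/negP; exact: H.
rewrite leeBrDr// -[X in (_ <= X)%E]adde0 leeD2lE ?fin//.
by rewrite lee_fin leNgt e0.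
Qed.

(** Call a level [y] crowded if the path spends more than [M] times the scale [e] within [e] of it.
    By Tonelli and Markov's inequality the crowded levels in a bounded interval have Lebesgue
    measure of order [1 / M], uniformly in [e <= 1]. Few times in [[0, 1]] are spent there, because
    [h] is bounded off a set of small [h]-mass. *)
Lemma occupation_tight (x h : R -> R) : measurable_fun setT x ->
  measurable_fun setT h -> (forall y, 0 <= h y) -> (\int[leb]_y (h y)%:E < +oo)%E ->
  (forall B, measurable B ->
      (leb ([set s | B (x s)] `&` `[0%R, 1%R]) <= \int[leb]_(y in B) (h y)%:E)%E) ->
  (forall k : nat, (tm [set s | (`|x s| <= k%:R)%R] < +oo)%E) ->
  exists M0 : nat, forall M n : nat, (M0 <= M)%N ->
    (leb ([set s | (M%:R / 2 ^+ n)%:E < tm [set r | (`|x r - x s| <= (2 ^+ n)^-1)%R]] `&`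
      `[0%R, 1%R]) <= 4^-1%:E)%E.
Proof.
move=> mx mh h0 hoo dom xfin.
have [|N HN] := @integral_tail h 8^-1 _ mh h0 hoo; first by rewrite invr_gt0.
pose K := fine (tm [set s | `|x s| <= N.+1%:R]).
have K0 : 0 <= K by rewrite fine_ge0.
(* The crowded levels inside [C] have measure at most [2 K / M] and [h] is at most [N] there;
   [M > 16 N K] makes the product at most [1 / 8]. The other [1 / 8] is the [h]-mass outside [C].
   The choice does not depend on [n]. *)
exists (Num.trunc (16 * N%:R * K)).+1 => M n MM.
have M16 : 16 * N%:R * K < M%:R.
  by apply: lt_le_trans (truncnS_gt _) _; rewrite ler_nat.
have Mpos : 0 < M%:R :> R.
  by apply: le_lt_trans M16; rewrite !mulr_ge0.
pose e : R := (2 ^+ n)^-1.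
have e0 : 0 < e by rewrite invr_gt0 exprn_gt0.
have e1 : e <= 1 by rewrite invf_le1 ?exprn_gt0// exprn_ege1// ler1n.
pose V y := tm [set r | `|x r - y| <= e].
pose O := [set y | ((M%:R * e)%:E < V y)%E].
have mball : measurable [set p : R * R | `|x p.2 - p.1| <= e].
  apply: measurable_le_set => //; apply: measurableT_comp => //.
  apply: measurable_funB => //; exact: (measurableT_comp mx).
have mV : measurable_fun setT V.
  exact: (measurable_measure_fst tm mball).
have mO : measurable O.
  by rewrite -(setTI O); apply: emeasurable_fun_o_infty.
apply: le_trans (dom O mO) _.
pose C := [set y : R | (`|y| <= N%:R)%R /\ (h y <= N%:R)%R].
have mC : measurable C by apply: measurableI; apply: measurable_le_set.
have mh' D : measurable_fun D (EFin \o h) by apply: measurable_funTS; exact/measurable_EFinP.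
have h0' y : (0 <= (h y)%:E :> \bar R)%E by rewrite lee_fin.
have bound : ((M%:R * e)%:E * leb (O `&` C) <= (2 * e * K)%:E)%E.
  pose A3 := [set p : R * R | `|p.1| <= N%:R /\ `|x p.2 - p.1| <= e].
  have mA3 : measurable A3.
    by apply: measurableI => //; apply: measurable_le_set => //; apply: measurableT_comp.
  apply: (@le_trans _ _ (\int[leb]_y tm [set r | A3 (y, r)])%E).
    rewrite -integral_cst; last exact: measurableI.
    apply: (@le_trans _ _ (\int[leb]_(y in O `&` C) tm [set r | A3 (y, r)])%E); last first.
      apply: ge0_subset_integral => //; first exact: measurableI.
      exact: (measurable_measure_fst tm mA3).
    apply: ge0_le_integral => //.
    - exact: measurableI.
    - by move=> y _; rewrite lee_fin mulr_ge0// ltW.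
    - by apply: measurable_funTS; exact: (measurable_measure_fst tm mA3).
    - move=> y [Oy [Ny _]]; apply/ltW/(lt_le_trans Oy).
      by apply: le_measure; rewrite ?inE; [exact: (measurable_fst_section mball y)|exact: (measurable_fst_section mA3 y)|].
  rewrite (tonelli_set leb tm mA3).
  have mN : measurable [set r | `|x r| <= N.+1%:R].
    by apply: measurable_le_set => //; exact: measurableT_comp.
  apply: (@le_trans _ _ (\int[tm]_(r in [set r | (`|x r| <= N.+1%:R)%R]) (2 * e)%:E)%E).
    rewrite [leRHS]integral_mkcond; apply: ge0_le_integral => //.
    - exact: (measurable_measure_snd leb mA3).
    - by apply/(measurable_restrictT _ mN).
    - move=> r _; rewrite patchE; case: ifPn => [_|].
        apply: (@le_trans _ _ (leb `[x r - e, x r + e])).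
          apply: le_measure; rewrite ?inE//; first exact: (measurable_snd_section mA3 r).
          by move=> y [_ /=]; rewrite in_itv/= ler_norml; lra.
        rewrite lebE lebesgue_measure_itv/= lte_fin; case: ifPn => _.
          by rewrite -EFinB lee_fin; lra.
        by rewrite lee_fin mulr_ge0// ltW.
      rewrite notin_setE => /= nr; rewrite (_ : [set y | _] = set0) ?measure0//.
      apply/seteqP; split => // y [yN ye]; apply: nr.
      rewrite -(subrK y (x r)) (le_trans (ler_normD _ _))//.
      by rewrite -natr1 addrC lerD// (le_trans ye).
  rewrite integral_cst// (EFinM (2 * e)) lee_wpmul2l ?lee_fin ?mulr_ge0// ?(ltW e0)//.
  by rewrite /K fineK// ge0_fin_numE.
have lebfin : leb (O `&` C) \is a fin_num.
  rewrite ge0_fin_numE//; apply: (@le_lt_trans _ _ (leb `[- N%:R, N%:R])).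
    apply: le_measure; rewrite ?inE//; first exact: measurableI.
    by move=> y [_ [yN _]] /=; rewrite in_itv/= -ler_norml.
  by rewrite lebE lebesgue_measure_itv/=; case: ifPn => // _; rewrite -EFinB ltry.
have {}bound : fine (leb (O `&` C)) <= 2 * K / M%:R.
  move: bound; rewrite -(fineK lebfin) -EFinM lee_fin /= ler_pdivlMr// => b.
  by rewrite -(ler_pM2r e0); lra.
apply: (@le_trans _ _ (\int[leb]_(y in O `&` C) (h y)%:E + \int[leb]_(y in ~` C) (h y)%:E)%E).
  rewrite -ge0_integral_setU//; last 3 first.
  - exact: measurableI.
  - exact: measurableC.
  - by apply/disj_setPS => y [[_ Cy] nC]; exact: nC.
  apply: ge0_subset_integral => //.
    by apply: measurableU; [exact: measurableI|exact: measurableC].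
  by move=> y Oy; have [Cy|nCy] := pselect (C y); [left|right].
apply: (@le_trans _ _ (8^-1%:E + 8^-1%:E)%E); last by rewrite -EFinD lee_fin; lra.
apply: leeD => //.
apply: (@le_trans _ _ (\int[leb]_(y in O `&` C) N%:R%:E)%E).
  apply: ge0_le_integral => //; first exact: measurableI.
  by move=> y [_ [_ hN]]; rewrite lee_fin.
rewrite integral_cst; last exact: measurableI.
rewrite [X in (_ * X)%E](_ : _ = (fine (leb (O `&` C)))%:E); last by rewrite fineK.
rewrite -EFinM lee_fin.
apply: (@le_trans _ _ (N%:R * (2 * K / M%:R))); first by rewrite ler_wpM2l.
rewrite !mulrA ler_pdivrMr//; lra.
Qed.

End occupation_tight.

(** * Domination by Lebesgue measure *)

Section lebesgue_domination.
Context (R : realType).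
Variables (mu : {measure set R -> \bar R}) (C : R).
Hypothesis C0 : 0 < C.

(** Consecutive intervals of length [2 ^- n] cover []x, y]] with an excess of at most one such
    length, which is negligible for large [n]. *)
Lemma measure_le_dyadic :
  (forall (x : R) n, (mu `[x, (x + (2 ^+ n)^-1)%R]%classic <= (C / 2 ^+ n)%:E)%E) ->
  forall x y : R, x < y -> (mu `]x, y]%classic <= (C * (y - x))%:E)%E.
Proof.
move=> H x y xy.
have step n N : (mu `]x, (x + N%:R / 2 ^+ n)%R]%classic <= (C * (N%:R / 2 ^+ n))%:E)%E.
  elim: N => [|N IH]; first by rewrite mul0r mulr0 addr0 set_itvoc0 measure0.
  apply: (@le_trans _ _ (mu (`]x, (x + N%:R / 2 ^+ n)%R] `|`
      `[(x + N%:R / 2 ^+ n)%R, (x + N%:R / 2 ^+ n + (2 ^+ n)^-1)%R]))).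
    apply: le_measure; rewrite ?inE//; first exact: measurableU.
    move=> z /=; rewrite !in_itv/= -natr1 mulrDl mul1r addrA => /andP[xz zy].
    by case: (leP z (x + N%:R / 2 ^+ n)) => zz; [left|right]; rewrite ?xz ?zz ?(ltW zz).
  apply: le_trans (measureU2 _ _ _) _ => //.
  apply: le_trans (leeD IH (H _ _)) _.
  by rewrite -EFinD lee_fin -[N.+1%:R]natr1 mulrDl mul1r mulrDr.
apply/lee_addgt0Pr => e e0.
have eC : 0 < e / C by rewrite divr_gt0.
have [n _ /(_ n (leqnn n)) /= Hn] := near_infty_natSinv_expn_lt (PosNum eC).
have p0 : 0 < 2 ^+ n :> R by rewrite exprn_gt0.
pose N := (Num.trunc ((y - x) * 2 ^+ n)).+1.
have NN : (y - x) * 2 ^+ n < N%:R by exact: truncnS_gt.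
have NN' : N%:R <= (y - x) * 2 ^+ n + 1.
  by rewrite /N -(natr1 (Num.trunc _)) lerD2r truncn_le// mulr_ge0 ?(ltW p0)// subr_ge0 ltW.
apply: (@le_trans _ _ (mu `]x, (x + N%:R / 2 ^+ n)%R]%classic)).
  apply: le_measure; rewrite ?inE// => z /=; rewrite !in_itv/= => /andP[-> zy] /=.
  by rewrite (le_trans zy)// -lerBlDl ler_pdivlMr// ltW.
apply: le_trans (step n N) _; rewrite -EFinD lee_fin.
have : N%:R / 2 ^+ n <= y - x + e / C.
  rewrite ler_pdivrMr// (le_trans NN')// (mulrDl (y - x)) lerD2l.
  by rewrite -ler_pdivrMr// ltW.
by rewrite -(ler_pM2l C0) mulrDr (mulrC C (e / C)) divfK// gt_eqF.
Qed.

(** Lebesgue measure is an infimum over countable covers by half-open intervals, and the bound is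
    countably subadditive along each cover. *)
Lemma measure_le_leb :
  (forall x y : R, x < y -> (mu `]x, y]%classic <= (C * (y - x))%:E)%E) ->
  forall B, measurable B -> (mu B <= C%:E * leb B)%E.
Proof.
move=> H B mB.
rewrite -lee_pdivrMl// lebE; apply/ereal_infP => _ [A [mA BA] <-].
rewrite lee_pdivrMl// -nneseriesZl//.
have mA' i : measurable (A i : set R).
  by have [[x y] _ <-] := mA i; exact: measurable_itv.
apply: (@le_trans _ _ (mu (\bigcup_i A i))).
  by apply: le_measure; rewrite ?inE//; exact: bigcupT_measurable.
apply: le_trans (generalized_Boole_inequality _ _ _) _ => //.
  exact: bigcupT_measurable.
apply: lee_nneseries => // i _.
have [[x y] _ <-] := mA i.
have [xy|xy] := ltP x y; last by rewrite set_itv_ge ?measure0 ?wlength0 ?mule0// bnd_simp -leNgt.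
apply: le_trans (H x y xy) _.
rewrite EFinM; apply: lee_wpmul2l; first by rewrite lee_fin ltW.
by rewrite /= wlength_itv_bnd// ltW.
Qed.

End lebesgue_domination.

(** * Upper bound on the potential measure *)

Section potential_bounds.
Context (R : realType) (d : measure_display) (T : measurableType d).
Variables (P : probability T R) (X : R -> T -> R).
Hypothesis levyX : levy_process P X.
Hypothesis measX : measurable_fun setT (fun p : R * T => X p.1 p.2).
Local Notation leb := (@leb R).
Local Notation tm := (@time_measure R).
Local Notation potential := (potential P measX).
Variable a : R.
Hypothesis a0 : 0 < a.
Hypothesis gap : (\int[P]_w (Num.max (a - X 1 w) 0)%:E < \int[P]_w (Num.max (X 1 w - a) 0)%:E)%E.

Lemma above_line_half : exists b : nat, (2^-1%:E <= P (future X 0 @^-1` above_line a b%:R))%E.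
Proof.
apply: (measure_bigcup_ge (mu := P) (F := fun b => future X 0 @^-1` above_line a b%:R)).
- by move=> b; exact: (measurable_pre (measurable_future levyX (lexx 0)) (measurable_above_line _ _)).
- move=> m n mn; apply/subsetPset => w h i; apply: le_trans (h i).
  by rewrite lerD2l lerN2 ler_nat.
- rewrite [ltRHS](above_line_ae levyX (ltW a0) gap) lte_fin; lra.
Qed.

(** A path in an interval of length [l] whose future stays above the line of slope [a] and offset
    [-b] has left for good after a time [(l + b) / a]; the constant comes from
    [l + b <= (1 + b) (1 + l)]. *)
Lemma potential_itv_le : exists C : R, 0 < C /\
  forall x l : R, 0 <= l -> (potential `[x, (x + l)%R]%classic <= (C * (1 + l))%:E)%E.
Proof.
have [b Hb] := above_line_half.
have b0 : 0 <= b%:R :> R by [].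
exists (2 * ((1 + b%:R) / a)); split; first by rewrite mulr_gt0// divr_gt0//; lra.
move=> x l l0.
pose m := (l + b%:R) / a.
have m0 : 0 <= m by rewrite divr_ge0 ?addr_ge0// ltW.
apply: (@le_trans _ _ (2 * m)%:E); last first.
  rewrite lee_fin -mulrA ler_pM2l// /m mulrAC ler_pM2r ?invr_gt0//.
  have := mulr_ge0 l0 b0; lra.
apply: (potential_le levyX measX m0 _ _ Hb) => //; first exact: measurable_above_line.
move=> w r r0 /=; rewrite in_itv/= => /andP[J1 J2] E.
apply: (@le_trans _ _ (leb `[r, (r + m)%R])); last first.
  rewrite lebE lebesgue_measure_itv/= lte_fin; case: ifPn => _; last by rewrite lee_fin.
  by rewrite -EFinB lee_fin; lra.
have mS : measurable ([set s | (X s w) \in `[x, x + l]] `&` `[r, +oo[).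
  apply: measurableI => //.
  exact: (measurable_snd_section (measurable_hit measX (measurable_itv `[x, (x + l)%R])) w).
rewrite time_measureE; apply: le_measure; rewrite ?inE//; first exact: measurableI.
move=> s [[/=]]; rewrite !in_itv/= !andbT => /andP[_ s2] rs _.
rewrite rs/=.
have := @above_lineE _ _ _ _ _ levyX _ b%:R r w r0 E (s - r).
rewrite subr_ge0 => /(_ rs); rewrite (addrC r) subrK => K.
rewrite -lerBlDl /m ler_pdivlMr// mulrC; lra.
Qed.

Definition small_occupation (e m : R) : set (rseq R) :=
  [set y | (tm [set r | (`|path_at y r| <= e)%R] <= m%:E)%E].

Lemma measurable_small_occupation e m : measurable (small_occupation e m).
Proof.
have mA : measurable [set p : rseq R * R | `|path_at p.1 p.2| <= e].
  by apply: measurable_le_set => //; apply: measurableT_comp => //; exact: measurable_path_at.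
have mV := measurable_measure_fst tm mA.
rewrite -(setTI (small_occupation e m)); exact: emeasurable_fun_infty_c.
Qed.

Hypothesis LT : has_local_times P X.

Let mXw := measurable_path measX.

Let mpath := @measurable_path_at_r R.

Lemma time_in_ball_fin : {ae P, forall w, forall k : nat, (tm [set s | (`|X s w| <= k%:R)%R] < +oo)%E}.
Proof.
apply: ae_foralln => k.
have mB : measurable [set x : R | `|x| <= k%:R] by apply: measurable_le_set.
have mV := measurable_measure_snd tm (measurable_hit measX mB).
have [C [_ HC]] := potential_itv_le.
have : P.-integrable setT (fun w => tm [set s | (`|X s w| <= k%:R)%R]).
  apply/integrableP; split => //.
  under eq_integral do rewrite gee0_abs//.
  have H : (potential `[(- k%:R)%R, (- k%:R + 2 * k%:R)%R]%classic <= (C * (1 + 2 * k%:R))%:E)%E.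
    by apply: HC; rewrite mulr_ge0.
  apply: le_lt_trans (ltry (C * (1 + 2 * k%:R))); apply: le_trans H.
  rewrite -(tonelli_set tm P (measurable_hit measX mB)) -potentialE//.
  apply: le_measure; rewrite ?inE// => x /=; rewrite in_itv/= ler_norml; lra.
move=> /(integrable_ae measurableT); apply: filterS => w /(_ I).
by rewrite ge0_fin_numE.
Qed.

(** Only time 1, the indicators of the rays and the constant 1 are tested, so countably many null
    sets are discarded. *)
Lemma occupation_dominated_ae : {ae P, forall w, exists h : R -> R,
  [/\ measurable_fun setT h, forall y, 0 <= h y,
    (\int[leb]_y (h y)%:E < +oo)%E &
    forall B, measurable B ->
      (leb ([set s | B (X s w)] `&` `[0%R, 1%R]) <= \int[leb]_(y in B) (h y)%:E)%E]}.
Proof.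
have [L [mL HL]] := LT.
have H1 : {ae P, forall w, forall i : nat, (\int[lebesgue_measure]_(s in `[0%R, 1%R]) (\1_(ray i) (X s w))%:E =
             \int[lebesgue_measure]_(y in setT) (\1_(ray i) y * L 1 y w)%:E)%E}.
  apply: ae_foralln => i.
  have [] // := HL (\1_(ray i)).
  - by apply: measurable_indic; exact: measurable_itv.
  - by exists 1 => y; rewrite indicE; case: (_ \in _).
  by move=> N [mN N0 sub]; exists N; split => // w /= nH; apply: sub => /= H; apply: nH; exact: H.
have H2 : {ae P, forall w, (\int[lebesgue_measure]_(s in `[0%R, 1%R]) 1%:E =
             \int[lebesgue_measure]_(y in setT) (1 * L 1 y w)%:E)%E}.
  have [] // := HL (fun=> 1); first by exists 1.
  by move=> N [mN N0 sub]; exists N; split => // w /= nH; apply: sub => /= H; apply: nH; exact: H.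
apply: filterS2 H1 H2 => w; exact: occupation_dominated.
Qed.

(** The time near [X s] is counted both before and after [s], so that for a given path being crowded
    is a property of the level [X s] alone, as [occupation_tight] requires. *)
Let crowded (n M : nat) : set (T * R) :=
  [set p | (M%:R / 2 ^+ n)%:E < tm [set r | (`|X r p.1 - X p.2 p.1| <= (2 ^+ n)^-1)%R]]%E.

Let measurable_crowded n M : measurable (crowded n M).
Proof.
have mA : measurable [set q : (T * R) * R | `|X q.2 q.1.1 - X q.1.2 q.1.1| <= (2 ^+ n)^-1].
  apply: measurable_le_set => //; apply: measurableT_comp => //; apply: measurable_funB.
    apply: (measurableT_comp measX (g := fun q : (T * R) * R => (q.2, q.1.1))).
    by apply: measurable_fun_pair => //; apply: measurableT_comp.
  apply: (measurableT_comp measX (g := fun q : (T * R) * R => (q.1.2, q.1.1))).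
  by apply: measurable_fun_pair => //; apply: measurableT_comp.
have mV := measurable_measure_fst tm mA.
by rewrite -(setTI (crowded n M)); exact: emeasurable_fun_o_infty.
Qed.

Let crowd (n M : nat) w := leb ([set s | crowded n M (w, s)] `&` `[0%R, 1%R]).

Let crowd_ae : {ae P, forall w, exists M0 : nat, forall M n : nat,
  (M0 <= M)%N -> (crowd n M w <= 4^-1%:E)%E}.
Proof.
apply: filterS2 time_in_ball_fin occupation_dominated_ae => w xfin [h [mh h0 hoo dom]].
exact: occupation_tight dom xfin.
Qed.

Let measurable_crowd n M : measurable_fun setT (crowd n M).
Proof.
have mA : measurable (crowded n M `&` [set p | p.2 \in `[0%R, 1%R]]).
  apply: measurableI => //; exact: (measurable_pre measurable_snd (measurable_itv `[0%R, 1%R])).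
exact: (measurable_measure_fst leb mA).
Qed.

(** One [M] works for all [n] on an event of probability at least [3 / 4], where the crowded time is
    at most [1 / 4]. Elsewhere it is at most 1, with probability at most [1 / 4]. *)
Let crowd_mean : exists M : nat, forall n, (\int[P]_w crowd n M w <= 2^-1%:E)%E.
Proof.
pose G (M : nat) := [set w | forall n, (crowd n M w <= 4^-1%:E)%E].
have mG M : measurable (G M).
  rewrite (_ : G M = \bigcap_n [set w | (crowd n M w <= 4^-1%:E)%E]); last first.
    by apply/seteqP; split => [w h n _|w h n]; [exact: h|exact: (h n I)].
  apply: bigcapT_measurable => n; rewrite -(setTI [set w | _]).
  exact: emeasurable_fun_infty_c.
have [M HM] : exists M, ((3 / 4)%:E <= P (G M))%E.
  apply: (measure_bigcup_ge (mu := P) (F := G)) => //.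
    move=> m n mn; apply/subsetPset => w h i; apply: le_trans (h i).
    have mS M : measurable ([set s | crowded i M (w, s)] `&` `[0%R, 1%R]).
      apply: measurableI => //; exact: (measurable_fst_section (measurable_crowded i M) w).
    apply: le_measure; rewrite ?inE// => s [h1 h2]; split => //=.
    by apply: le_lt_trans h1; rewrite lee_fin ler_wpM2r ?invr_ge0 ?exprn_ge0// ler_nat.
  rewrite [ltRHS](_ : _ = 1%E) ?lte_fin; first lra.
  apply: probability_ae; first exact: bigcupT_measurable.
  by apply: filterS crowd_ae => w [M0 HM0]; exists M0 => // n; exact: HM0.
exists M => n.
have nGM : (P (~` G M) <= 4^-1%:E)%E.
  have [p pE] : exists p, P (G M) = p%:E.
    by exists (fine (P (G M))); rewrite fineK// fin_num_measure.
  by move: HM; rewrite probability_setC// pE -EFinB !lee_fin; lra.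
have c0 w : (0 <= crowd n M w)%E by [].
rewrite -(setUv (G M)) ge0_integral_setU//; last 3 first.
- exact: measurableC.
- exact: measurable_funTS.
- by apply/disj_setPS; rewrite setICr.
apply: (@le_trans _ _ (4^-1%:E + 4^-1%:E)%E); last by rewrite -EFinD lee_fin; lra.
apply: leeD.
  apply: (@le_trans _ _ (\int[P]_(w in G M) 4^-1%:E)%E).
    by apply: ge0_le_integral => //; exact: measurable_funTS.
  rewrite integral_cst// -[leRHS]mule1; apply: lee_wpmul2l => //.
  exact: probability_le1.
apply: (@le_trans _ _ (\int[P]_(w in ~` G M) 1%:E)%E).
  apply: ge0_le_integral => //; [exact: measurableC|exact: measurable_funTS|].
  move=> w _; apply: (@le_trans _ _ (leb `[0, 1])).
    apply: le_measure; rewrite ?inE//; apply: measurableI => //.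
    exact: (measurable_fst_section (measurable_crowded n M) w).
  by rewrite lebE lebesgue_measure_itv/= lte_fin ltr01 -EFinB lee_fin; lra.
by rewrite integral_cst ?mul1e//; exact: measurableC.
Qed.

(** The future at each [s] has the law of the future at 0, and if it spends too long near its
    starting point then [s] is crowded. Averaging over [s] in [[0, 1]] bounds the probability of
    this by the mean crowded time. *)
Lemma small_occupation_half : exists M : nat, forall n,
  (2^-1%:E <= P (future X 0 @^-1` small_occupation (2 ^+ n)^-1 (M%:R / 2 ^+ n)))%E.
Proof.
have [M HM] := crowd_mean; exists M => n.
have mS := measurable_small_occupation (2 ^+ n)^-1 (M%:R / 2 ^+ n).
set S := small_occupation _ _ in mS *.
have mF r : 0 <= r -> measurable (future X r @^-1` S).
  by move=> r0; exact: (measurable_pre (measurable_future levyX r0) mS).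
suff : (P (future X 0 @^-1` ~` S) <= 2^-1%:E)%E.
  rewrite preimage_setC probability_setC; last exact: mF.
  rewrite -(fineK (fin_num_measure P _ (mF 0 (lexx 0)))) -EFinB !lee_fin; lra.
apply: le_trans (HM n).
rewrite [leRHS](_ : _ = \int[leb]_(s in `[0%R, 1%R]) P [set w | crowded n M (w, s)])%E; last first.
  have mA : measurable (crowded n M `&` [set p | p.2 \in `[0%R, 1%R]]).
    apply: measurableI => //; exact: (measurable_pre measurable_snd (measurable_itv `[0%R, 1%R])).
  rewrite [LHS](tonelli_set P leb mA) [RHS]integral_mkcond; apply: eq_integral => s _.
  rewrite patchE; case: ifPn => [/[!inE] s01|].
    by congr (P _); apply/seteqP; split => w //= [].
  rewrite notin_setE => s01; rewrite [LHS](_ : _ = P set0); first exact: measure0.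
  congr (P _).
  by apply/seteqP; split => // w [].
apply: (@le_trans _ _ (\int[leb]_(s in `[0%R, 1%R]) P (future X 0 @^-1` ~` S))%E).
  rewrite integral_cst// [X in (_ * X)%E](_ : _ = lebesgue_measure `[0%R, 1%R]%classic)//.
  by rewrite lebesgue_measure_itv/= lte_fin ltr01 -EFinB subr0 mule1.
apply: ge0_le_integral => //.
  by apply: measurable_funTS; exact: (measurable_measure_snd P (measurable_crowded n M)).
move=> s; rewrite /= in_itv/= => /andP[s0 s1].
rewrite -(future_lawE levyX s0); last exact: measurableC.
apply: le_measure; rewrite ?inE.
- by rewrite preimage_setC; apply: measurableC; exact: mF.
- exact: (measurable_snd_section (measurable_crowded n M) s).
move=> w /negP; rewrite -ltNge => H.
rewrite /crowded/=; apply: (lt_le_trans H).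
have mB : measurable [set r | `|X r w - X s w| <= (2 ^+ n)^-1].
  by apply: measurable_le_set => //; apply: measurableT_comp => //; apply: measurable_funB.
apply: (@le_trans _ _ (tm [set r | (`|X (s + r) w - X s w| <= (2 ^+ n)^-1)%R])).
  rewrite !time_measureE; apply: le_measure; rewrite ?inE.
  - by apply: measurableI => //; apply: measurable_le_set => //; apply: measurableT_comp.
  - apply: measurableI => //; apply: measurable_le_set => //; apply: measurableT_comp => //.
    apply: measurable_funB => //.
    exact: (measurableT_comp (mXw w) (measurable_funD (measurable_cst s) (@measurable_id _ _ setT))).
  move=> r []/=; rewrite in_itv/= andbT => H1 r0; split=> //.
  by move: H1; rewrite (path_at_future levyX).
rewrite (time_shift s0 mB); apply: le_measure; rewrite ?inE//; exact: measurableI.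
Qed.

Lemma potential_le_leb : exists C : R, 0 < C /\
  forall B, measurable B -> (potential B <= C%:E * leb B)%E.
Proof.
have [M HM] := small_occupation_half.
have M0 : 0 <= M%:R :> R by [].
(* The factor 2 is that of [potential_le]; adding 1 keeps the constant positive when [M] is 0. *)
exists (2 * M%:R + 1); split; first by lra.
apply: measure_le_leb; first by lra.
apply: measure_le_dyadic; first by lra.
move=> x n.
have p0 : 0 < (2 ^+ n)^-1 :> R by rewrite invr_gt0 exprn_gt0.
apply: (@le_trans _ _ (2 * (M%:R / 2 ^+ n))%:E); last first.
  by rewrite lee_fin mulrA ler_pM2r//; lra.
apply: (potential_le levyX measX _ _ _ (HM n)) => //.
- exact: measurable_small_occupation.
move=> w r r0 /=; rewrite in_itv/= => /andP[J1 J2] E.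
have mB : measurable [set s | X s w \in `[x, x + (2 ^+ n)^-1]].
  exact: (measurable_snd_section (measurable_hit measX (measurable_itv `[x, x + (2 ^+ n)^-1])) w).
rewrite -[X in (X <= _)%E](time_shift r0 mB); apply: le_trans E.
rewrite !time_measureE; apply: le_measure; rewrite ?inE.
- apply: measurableI => //.
  exact: (measurable_pre (measurable_funD (measurable_cst r) (@measurable_id _ _ setT)) mB).
- by apply: measurableI => //; apply: measurable_le_set => //; apply: measurableT_comp.
move=> s []/=; rewrite !in_itv/= andbT => /andP[x1 x2] s0; split => //.
by rewrite (path_at_future levyX)// ler_norml; lra.
Qed.

End potential_bounds.
Import HBNNSimple.

(** * Integrals against dominated measures *)

Lemma integral_le_measure d (T : measurableType d) (R : realType)
  (mu nu : {measure set T -> \bar R}) (C : R) : 0 <= C ->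
  (forall B, measurable B -> (mu B <= C%:E * nu B)%E) ->
  forall g : T -> \bar R, measurable_fun setT g -> (forall x, 0 <= g x)%E ->
  (\int[mu]_x g x <= C%:E * \int[nu]_x g x)%E.
Proof.
move=> C0 H g mg g0; rewrite ge0_integralTE//; apply: ge_ereal_sup => _ [h hg <-].
have hh : (sintegral mu h <= C%:E * sintegral nu h)%E.
  rewrite !sintegralE ge0_mule_fsumr; last by move=> r; exact: nnsfun_mulemu_ge0.
  apply: lee_fsum => // r [x _ <-].
  by rewrite muleCA; apply: lee_wpmul2l; [rewrite lee_fin|exact: H].
apply: le_trans hh _; apply: lee_wpmul2l => //; rewrite ge0_integralTE//.
by apply: ereal_sup_ubound; exists h.
Qed.

Lemma integral_indic_comp d d' (T : measurableType d) (T' : measurableType d')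
  (R : realType) (mu : {measure set T -> \bar R}) (g : T -> T') (A : set T') :
  measurable_fun setT g -> measurable A ->
  (\int[mu]_x (\1_A (g x))%:E = mu [set x | A (g x)])%E.
Proof.
move=> mg mA; transitivity (\int[mu]_(x in setT) (\1_[set x | A (g x)] x)%:E)%E; first by [].
by rewrite integral_indic ?setIT//; exact: measurable_pre mg mA.
Qed.

Lemma integral_excess d (T : measurableType d) (R : realType)
  (mu : {measure set T -> \bar R}) (f : T -> R) (e : R) : 0 < e ->
  mu.-integrable setT (EFin \o f) ->
  exists K : nat, (\int[mu]_x (Num.max (f x - K%:R) 0)%:E <= e%:E)%E.
Proof.
move=> e0 intf.
have mf : measurable_fun setT f by exact/measurable_EFinP/measurable_int/intf.
have mex (K : nat) : measurable_fun setT (fun x => (Num.max (f x - K%:R) 0)%:E).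
  by apply/measurable_EFinP; apply: measurable_maxr => //; apply: measurable_funB.
have cv : (\int[mu]_x (Num.max (f x - K%:R) 0)%:E)%E @[K --> \oo] --> (\int[mu]_x (cst 0 x))%E.
  apply: (@dominated_cvg _ _ _ mu setT measurableT
    (fun (K : nat) x => (Num.max (f x - K%:R) 0)%:E) (cst 0%E) (fun x => `|f x|%:E) mex) => //.
  - move=> x _; apply: cvg_near_cst; near=> K.
    have fK : f x <= K%:R by near: K; exact: nbhs_infty_ger.
    by congr EFin; rewrite max_r// subr_le0.
  - exact: integrable_abse intf.
  - move=> K x _; rewrite /= lee_fin ger0_norm ?le_max ?lexx ?orbT//.
    rewrite ge_max normr_ge0 andbT; have := ler_norm (f x); have : 0 <= K%:R :> R by [].
    lra.
apply: contrapT => /forallNP H.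
have : (e%:E <= \int[mu]_x (cst 0 x))%E.
  by apply: cvge_ge cv; apply: nearW => K; apply/ltW; rewrite ltNge; apply/negP; exact: H.
by rewrite integral0 lee_fin leNgt e0.
Unshelve. all: by end_near. Qed.

(** * The potential measure after a fixed time *)

Section occupation.
Context (R : realType) (d : measure_display) (T : measurableType d).
Variables (P : probability T R) (X : R -> T -> R).
Hypothesis levyX : levy_process P X.
Hypothesis measX : measurable_fun setT (fun p : R * T => X p.1 p.2).
Local Notation leb := (@leb R).
Local Notation tm := (@time_measure R).
Local Notation potential := (potential P measX).

Lemma markov_pair s t (A : set (R * R)) : 0 <= s -> 0 <= t -> measurable A ->
  (P [set w | A (X s w, (X (s + t) w - X s w)%R)] = \int[P]_w P [set v | A (X s w, X t v)])%E.
Proof.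
move=> s0 t0 mA.
pose B := [set p : R * rseq R | A (p.1, path_at p.2 t)].
have mB : measurable B.
  apply: (measurable_pre _ mA); apply: measurable_fun_pair => //.
  apply: (measurableT_comp (@measurable_path_at R) (g := fun p : R * rseq R => (p.2, t))).
  exact: measurable_fun_pair.
have mI : measurable_fun setT (fun p => (\1_B p)%:E : \bar R).
  by apply/measurable_EFinP; exact: measurable_indic.
have I0 z : (0 <= (\1_B z)%:E :> \bar R)%E by rewrite lee_fin.
have mF r : 0 <= r -> measurable_fun setT (future X r) by move=> r0; exact: (measurable_future levyX).
have mXs : measurable_fun setT (X s) by exact: (measurable_levy levyX).
have mg : measurable_fun setT (fun w => (X s w, future X s w)).
  by apply: measurable_fun_pair => //; exact: mF.
have := markov_property levyX s0 mI I0; rewrite integral_indic_comp// => E.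
transitivity (P [set w | B (X s w, future X s w)]).
  by congr (P _); apply/seteqP; split => w; rewrite /B/= (path_at_future levyX).
rewrite E; apply: eq_integral => w _.
rewrite integral_indic_comp//; last by apply: measurable_fun_pair => //; exact: mF.
by congr (P _); apply/seteqP; split => v; rewrite /B/= (path_at_future0 levyX).
Qed.

(** The increment over [[s, s + t]] is independent of [X s] and distributed as [X t]; with an
    independent copy of [X t] in its place, integrating over [s] first leaves the potential measure
    of a section. *)
Lemma potential_markov t (A : set (R * R)) : 0 <= t -> measurable A ->
  (\int[tm]_s P [set w | A (X s w, (X (s + t) w - X s w)%R)] =
   \int[P]_v potential [set u | A (u, X t v)])%E.
Proof.
move=> t0 mA.
have mXt : measurable_fun setT (X t) by exact: (measurable_levy levyX).
have mB : measurable [set q : (R * T) * T | A (X q.1.1 q.1.2, X t q.2)].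
  apply: (measurable_pre _ mA); apply: measurable_fun_pair.
    exact: (measurableT_comp measX).
  exact: (measurableT_comp mXt).
have mC : measurable [set q : R * T | A (X q.1 q.2, (X (q.1 + t) q.2 - X q.1 q.2)%R)].
  apply: (measurable_pre _ mA); apply: measurable_fun_pair => //; apply: measurable_funB => //.
  apply: (measurableT_comp measX (g := fun q : R * T => (q.1 + t, q.2))).
  by apply: measurable_fun_pair => //; exact: measurable_funD.
have mD : measurable [set q : (R * T) * T | A (X q.1.1 q.2, X t q.1.2)].
  apply: (measurable_pre _ mA); apply: measurable_fun_pair.
    apply: (measurableT_comp measX (g := fun q : (R * T) * T => (q.1.1, q.2))).
    by apply: measurable_fun_pair => //; exact: measurableT_comp.
  exact: (measurableT_comp mXt (measurableT_comp measurable_snd measurable_fst)).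
have msec s : measurable [set q : T * T | A (X s q.1, X t q.2)].
  apply: (measurable_pre (f := fun q : T * T => ((s, q.1), q.2)) _ mB).
  by apply: measurable_fun_pair => //; exact: measurable_fun_pair.
transitivity (\int[tm]_s \int[P]_v P [set w | A (X s w, X t v)])%E.
  apply: eq_time_integral.
  - exact: (measurable_measure_fst P mC).
  - exact: (measurable_fun_fubini_tonelli_F _ (measurable_measure_fst P mD)).
  - by [].
  - by move=> s; exact: integral_ge0.
  move=> s s0; rewrite markov_pair//; exact: (tonelli_set P P (msec s)).
transitivity (\int[P]_v \int[tm]_s P [set w | A (X s w, X t v)])%E.
  exact: (fubini_tonelli _ (measurable_measure_fst P mD) (fun=> measure_ge0 _ _)).
apply: eq_integral => v _; rewrite potentialE//.
by apply: (measurable_pre (f := fun u => (u, X t v)) _ mA); exact: measurable_fun_pair.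
Qed.

Lemma measurable_potential_section d' (T' : measurableType d') (A : set (R * T')) :
  measurable A -> measurable_fun setT (fun y => potential [set u | A (u, y)]).
Proof.
move=> mA.
have mD : measurable [set q : (R * T') * T | A (X q.1.1 q.2, q.1.2)].
  apply: (measurable_pre _ mA); apply: measurable_fun_pair; last exact: measurableT_comp.
  apply: (measurableT_comp measX (g := fun q : (R * T') * T => (q.1.1, q.2))).
  by apply: measurable_fun_pair => //; exact: measurableT_comp.
have := measurable_fun_fubini_tonelli_G (m1 := tm) _ (measurable_measure_fst P mD) (fun=> measure_ge0 _ _).
congr (measurable_fun _ _); apply/funext => y; rewrite potentialE//.
by apply: (measurable_pre (f := fun u => (u, y)) _ mA); exact: measurable_fun_pair.
Qed.

End occupation.
(** * Lower bound on the potential measure *)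

Section transience.
Context (R : realType) (d : measure_display) (T : measurableType d).
Variables (P : probability T R) (X : R -> T -> R).
Hypothesis levyX : levy_process P X.
Hypothesis measX : measurable_fun setT (fun p : R * T => X p.1 p.2).
Local Notation leb := (@leb R).
Local Notation tm := (@time_measure R).
Local Notation potential := (potential P measX).
Variables a C : R.
Hypothesis a0 : 0 < a.
Hypothesis gap : (\int[P]_w (Num.max (a - X 1 w) 0)%:E < \int[P]_w (Num.max (X 1 w - a) 0)%:E)%E.
Hypothesis C0 : 0 < C.
Hypothesis HC : forall B, measurable B -> (potential B <= C%:E * leb B)%E.
Hypothesis intX : P.-integrable setT (EFin \o X 1).

Lemma above_line_ae_ex : {ae P, forall w, exists b : nat, above_line a b%:R (future X 0 w)}.
Proof.
have mU : measurable (\bigcup_(b : nat) (future X 0 @^-1` above_line a b%:R)).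
  apply: bigcupT_measurable => b.
  exact: (measurable_pre (measurable_future levyX (lexx 0)) (measurable_above_line _ _)).
have := ae_probability mU (above_line_ae levyX (ltW a0) gap).
by apply: filterS => w [b _ h]; exists b.
Qed.

Lemma above_line0 b w s : above_line a b (future X 0 w) -> 0 <= s -> a * s - b <= X s w.
Proof.
move=> h s0; have := above_lineE levyX (lexx 0) h s0.
by rewrite (levy0 levyX) !add0r.
Qed.

Lemma measurable_perpetual (f : R -> \bar R) : measurable_fun setT f -> (forall x, 0 <= f x)%E ->
  measurable_fun setT (fun w => \int[tm]_s f (X s w))%E.
Proof.
move=> mf f0.
exact: (measurable_fun_fubini_tonelli_G (fun p : R * T => f (X p.1 p.2)) (measurableT_comp mf measX)).
Qed.

Let mXw := measurable_path measX.

Lemma perpetual_finite_ae (f : R -> R) : measurable_fun setT f -> (forall x, 0 <= f x) ->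
  (forall c : R, \int[leb]_(x in `[c, +oo[) (f x)%:E < +oo)%E ->
  {ae P, forall w, (\int[tm]_s (f (X s w))%:E < +oo)%E}.
Proof.
move=> mf f0 foo.
pose D (b : nat) : set R := `[(- b%:R)%R, +oo[%classic.
have mD b : measurable (D b) by exact: measurable_itv.
pose g b := (EFin \o f) \_ (D b).
have mg b : measurable_fun setT (g b).
  by apply/(measurable_restrictT _ (mD b)); apply: measurable_funTS; exact/measurable_EFinP.
have g0 b x : (0 <= g b x)%E by rewrite /g patchE; case: ifP => // _; rewrite lee_fin.
have gfin : {ae P, forall w, forall b, (\int[tm]_s g b (X s w) < +oo)%E}.
  apply: ae_foralln => b.
  have int_g : P.-integrable setT (fun w => \int[tm]_s g b (X s w))%E.
    apply/integrableP; split; first exact: (measurable_perpetual (mg b) (g0 b)).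
    under eq_integral do rewrite (gee0_abs (integral_ge0 _ (fun s _ => g0 b _))).
    rewrite -(integral_potential _ _ (mg b) (g0 b)).
    apply: le_lt_trans (integral_le_measure (ltW C0) HC (mg b) (g0 b)) _.
    rewrite lte_mul_pinfty// ?lee_fin ?ltW// /g -integral_mkcond; exact: foo.
  move: int_g => /(integrable_ae measurableT); apply: filterS => w /(_ I).
  by rewrite ge0_fin_numE// (integral_ge0 _ (fun s _ => g0 b _)).
apply: filterS2 gfin above_line_ae_ex => w gw [b hb].
apply: le_lt_trans (gw b); apply: le_time_integral => //.
- by apply/measurable_EFinP; exact: (measurableT_comp mf (mXw w)).
- exact: (measurableT_comp (mg b) (mXw w)).
- by move=> s; rewrite lee_fin.
move=> s s0; rewrite /g patchE mem_set// /D/= in_itv/= andbT.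
have := above_line0 hb s0; have : 0 <= a * s by rewrite mulr_ge0// ltW.
lra.
Qed.

(** Half-open, so that the unit interval and [[1, +oo[] partition the times. *)
Definition unit_time : set R -> \bar R := mrestr tm (measurable_itv `[0%R, 1%R[).

HB.instance Definition _ := Measure.on unit_time.

Lemma unit_timeE A : unit_time A = tm (A `&` `[0, 1[).
Proof. by []. Qed.

Lemma unit_timeT : unit_time setT = 1%E.
Proof.
rewrite unit_timeE setTI time_measureE setIidl; last first.
  by move=> s /=; rewrite !in_itv/= andbT => /andP[].
by rewrite lebE lebesgue_measure_itv/= lte_fin ltr01 -EFinB subr0.
Qed.

Let unit_time_fin : fin_num_fun unit_time.
Proof.
move=> A mA; rewrite ge0_fin_numE//; apply: (@le_lt_trans _ _ (unit_time setT)).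
  by apply: le_measure; rewrite ?inE.
by rewrite unit_timeT ltry.
Qed.

HB.instance Definition _ := @Measure_isFinite.Build _ _ _ unit_time unit_time_fin.

Definition mean_law : set R -> \bar R := image_measure (unit_time \x P)%E measX.

HB.instance Definition _ := Measure.on mean_law.

Lemma mean_lawE (B : set R) : measurable B ->
  (mean_law B = \int[unit_time]_s P [set w | B (X s w)])%E.
Proof.
move=> mB; rewrite /mean_law image_measureE /product_measure1.
apply: eq_integral => s _; congr (P _).
by apply/seteqP; split => w; rewrite /xsection/= inE.
Qed.

Lemma mean_lawE2 (B : set R) : measurable B ->
  (mean_law B = \int[P]_w unit_time [set s | B (X s w)])%E.
Proof. by move=> mB; rewrite mean_lawE// (tonelli_set unit_time P (measurable_hit measX mB)). Qed.

Lemma mean_lawT : mean_law setT = 1%E.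
Proof.
rewrite mean_lawE2//; under eq_integral do rewrite (_ : [set s | _] = setT)// unit_timeT.
by rewrite integral_cst// mul1e; exact: probability_setT.
Qed.

Let mean_law_fin : fin_num_fun mean_law.
Proof.
move=> A mA; rewrite ge0_fin_numE//; apply: (@le_lt_trans _ _ (mean_law setT)).
  by apply: le_measure; rewrite ?inE.
by rewrite mean_lawT ltry.
Qed.

HB.instance Definition _ := @Measure_isFinite.Build _ _ _ mean_law mean_law_fin.

Lemma mean_law_ray : exists x0 : R, forall x, x0 <= x -> ((3 / 4)%:E <= mean_law `]-oo, x]%classic)%E.
Proof.
have [n Hn] : exists n : nat, ((3 / 4)%:E <= mean_law `]-oo, (n%:R : R)]%classic)%E.
  apply: (measure_bigcup_ge (mu := mean_law) (F := fun n => `]-oo, (n%:R : R)]%classic)) => //.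
    move=> m n mn; apply/subsetPset => x /=; rewrite !in_itv/= => xm.
    by rewrite (le_trans xm)// ler_nat.
  rewrite [ltRHS](_ : _ = 1%E) ?lte_fin; first lra.
  rewrite -mean_lawT; congr (mean_law _); apply/seteqP; split => // x _.
  exists (Num.trunc `|x|).+1 => //=.
  rewrite in_itv/=; have := truncnS_gt `|x|; have := ler_norm x; lra.
exists n%:R => x nx; apply: le_trans Hn _; apply: le_measure; rewrite ?inE//.
by move=> y /=; rewrite !in_itv/= => /le_trans; apply.
Qed.

Let jump x := [set p : R * T | X p.1 p.2 <= x /\ x < X (1 + p.1) p.2].

Let measurable_jump x : measurable (jump x).
Proof.
apply: measurableI; first exact: measurable_le_set.
apply: measurable_lt_set => //.
apply: (measurableT_comp measX (g := fun q : R * T => (1 + q.1, q.2))).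
by apply: measurable_fun_pair => //; exact: measurable_funD.
Qed.

(* The chain [X s, X (s + 1), ...] starting below [x] must jump over [x], since it
   tends to infinity. *)
Let unit_time_le_jump x w b : above_line a b (future X 0 w) ->
  (unit_time [set s | (X s w <= x)%R] <= tm [set s | jump x (s, w)])%E.
Proof.
move=> hb.
have mA : measurable [set s | X s w <= x] by exact: measurable_le_set.
have mA' : measurable [set s | [set s | X s w <= x] (1 + s)].
  by apply: (measurable_pre (f := fun s : R => 1 + s : R) _ mA); exact: measurable_funD.
have mD : measurable [set s | jump x (s, w)] by exact: (measurable_snd_section (measurable_jump x) w).
(* The time below [x] after time 1 is finite, as the path stays above a line. It is added to both
   sides and cancelled: shifted back by 1, it is the measure of the times [s] with
   [X (1 + s) <= x]. *)
have fin1 : tm ([set s | X s w <= x] `&` `[1, +oo[) \is a fin_num.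
  rewrite ge0_fin_numE//; apply: (@le_lt_trans _ _ (leb `[0, (x + b) / a])).
    rewrite time_measureE; apply: le_measure; rewrite ?inE//.
      by apply: measurableI => //; exact: measurableI.
    move=> s [[/= s1 _]]; rewrite !in_itv/= andbT => s0; rewrite s0/= ler_pdivlMr//.
    have := above_line0 hb s0; lra.
  by rewrite lebE lebesgue_measure_itv/=; case: ifP => // _; rewrite -EFinB ltry.
rewrite unit_timeE -(leeD2rE _ _ fin1).
apply: (@le_trans _ _ (tm [set s | (X s w <= x)%R])).
  rewrite -measureU; last 3 first.
  - by apply: measurableI.
  - by apply: measurableI.
  - apply/seteqP; split => // s [[_ /=]]; rewrite in_itv/= => /andP[_ s1] [_ /=].
    by rewrite in_itv/= andbT leNgt s1.
  apply: le_measure; rewrite ?inE//; first by apply: measurableU; exact: measurableI.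
  by move=> s [] [].
rewrite -(time_shift ler01 mA); apply: le_trans (measureU2 _ _ _) => //.
apply: le_measure; rewrite ?inE//; first exact: measurableU.
by move=> s /= Xs; case: (leP (X (1 + s) w) x) => h; [right|left].
Qed.

(** The times [s] with [X s <= x < X (s + 1)] have mean measure at least [3 / 4]. Either [X (s + 1)]
    lies in the block, which accounts for at most the potential of the block, or the increment
    overshoots it; given the value of the increment, the latter needs [X s] in an interval of length
    at most the excess of that value over [K]. *)
Lemma potential_block : exists K x0 : R, 0 <= K /\
  forall x : R, x0 <= x -> (2^-1%:E <= potential `]x, (x + K)%R]%classic)%E.
Proof.
(* The overshoots contribute at most [C] times the mean excess of [X 1] over [K], hence [1 / 4];
   this leaves [3 / 4 - 1 / 4] for the block. *)
have eC : 0 < (4 * C)^-1 by rewrite invr_gt0 mulr_gt0.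
have [K HK] := integral_excess eC intX.
have [x0 Hx0] := mean_law_ray.
exists K%:R, x0; split => // x x0x.
set B := `]x, (x + K%:R)%R]%classic.
have mB : measurable B by exact: measurable_itv.
pose A := [set p : R * R | p.1 <= x /\ x + K%:R < p.1 + p.2].
have mA : measurable A.
  by apply: measurableI; [exact: measurable_le_set|apply: measurable_lt_set => //; exact: measurable_funD].
have H1 : (potential B + 4^-1%:E >= (3 / 4)%:E)%E.
  apply: le_trans (Hx0 x x0x) _; rewrite mean_lawE2//.
  apply: (@le_trans _ _ (\int[P]_w tm [set s | jump x (s, w)])%E).
    apply: ae_ge0_le_integral => //.
    - exact: (measurable_measure_snd unit_time (measurable_hit measX (measurable_itv `]-oo, x]))).
    - exact: (measurable_measure_snd tm (measurable_jump x)).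
    by apply: filterS above_line_ae_ex => w [b hb] _; exact: unit_time_le_jump hb.
  rewrite -(tonelli_set tm P (measurable_jump x)).
  pose S1 := [set p : R * T | B (X (1 + p.1) p.2)].
  have mS1 : measurable S1.
    apply: (measurable_pre _ mB); apply: (measurableT_comp measX (g := fun q : R * T => (1 + q.1, q.2))).
    by apply: measurable_fun_pair => //; exact: measurable_funD.
  pose S2 := [set p : R * T | A (X p.1 p.2, X (p.1 + 1) p.2 - X p.1 p.2)].
  have mS2 : measurable S2.
    apply: (measurable_pre _ mA); apply: measurable_fun_pair => //; apply: measurable_funB => //.
    apply: (measurableT_comp measX (g := fun q : R * T => (q.1 + 1, q.2))).
    by apply: measurable_fun_pair => //; exact: measurable_funD.
  apply: (@le_trans _ _ (\int[tm]_s (P [set w | S1 (s, w)] + P [set w | S2 (s, w)]))%E).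
    apply: ge0_le_integral => //.
    - exact: (measurable_measure_fst P (measurable_jump x)).
    - by apply: emeasurable_funD; exact: measurable_measure_fst.
    move=> s _; apply: le_trans (measureU2 _ _ _).
    - apply: le_measure; rewrite ?inE.
      + exact: (measurable_fst_section (measurable_jump x) s).
      + by apply: measurableU; exact: measurable_fst_section.
      move=> w [/= h1 h2]; case: (leP (X (1 + s) w) (x + K%:R)) => h; [left|right].
        by rewrite /S1/B/= in_itv/= h2 h.
      by split => //=; rewrite [X s w + _]addrC subrK (addrC s).
    - exact: (measurable_fst_section mS1 s).
    - exact: (measurable_fst_section mS2 s).
  rewrite ge0_integralD//; last 2 first.
  - exact: measurable_measure_fst.
  - exact: measurable_measure_fst.
  apply: leeD.
    rewrite (tonelli_set tm P mS1) potentialE// (tonelli_set tm P (measurable_hit measX mB)).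
    apply: ge0_le_integral => //.
    - exact: (measurable_measure_snd tm mS1).
    - exact: (measurable_measure_snd tm (measurable_hit measX mB)).
    have mBw w : measurable [set s | B (X s w)] by exact: (measurable_snd_section (measurable_hit measX mB) w).
    move=> w _; apply: (@le_trans _ _ (tm ([set s | B (X s w)] `&` `[1, +oo[))).
      by rewrite -(time_shift ler01 (mBw w)).
    by apply: le_measure; rewrite ?inE; [exact: measurableI|exact: mBw|move=> s []].
  rewrite (potential_markov levyX measX ler01 mA).
  apply: (@le_trans _ _ (\int[P]_v (C%:E * (Num.max (X 1 v - K%:R) 0)%:E))%E).
    have mX1 := measurable_levy levyX ler01.
    apply: ge0_le_integral => //.
    - exact: (measurableT_comp (measurable_potential_section P measX mA) mX1).
    - apply/measurable_EFinP; apply: measurable_funM => //; apply: measurable_maxr => //.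
      exact: measurable_funB.
    move=> v _.
    have mAv : measurable [set u | A (u, X 1 v)] by exact: (measurable_snd_section mA).
    apply: le_trans (HC mAv) _; apply: lee_wpmul2l; first by rewrite lee_fin ltW.
    apply: (@le_trans _ _ (leb `](x + K%:R - X 1 v), x])).
      apply: le_measure; rewrite ?inE// => u [/= u1 u2]; rewrite in_itv/= u1 andbT; lra.
    rewrite lebE lebesgue_measure_itv/= lte_fin; case: ifPn => _.
      by rewrite -EFinB lee_fin le_max; apply/orP; left; lra.
    by rewrite lee_fin le_max lexx orbT.
  rewrite ge0_integralZl ?lee_fin ?(ltW C0)//; last 2 first.
  - apply/measurable_EFinP; apply: measurable_maxr => //; apply: measurable_funB => //.
    exact: (measurable_levy levyX ler01).
  - by move=> v _; rewrite lee_fin le_max lexx orbT.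
  apply: le_trans (lee_wpmul2l _ HK) _; first by rewrite lee_fin ltW.
  by rewrite -EFinM lee_fin invfM mulrCA divff ?mulr1// gt_eqF.
move: H1; have : (potential B <= C%:E * leb B)%E by exact: HC.
case: (potential B) => [r _||]; rewrite ?leey// -?EFinD ?lee_fin; lra.
Qed.

End transience.

(** * Reflections, density intervals, minorants and convolutions *)

Section lebesgue_tools.
Context (R : realType).
Local Notation leb := (@leb R).

(** Reflection moves the open end of a half-open interval, so an inequality through the closed
    interval is proved here; applied twice it gives the equality. *)
Lemma leb_reflect_le (u : R) (A : set R) : measurable A ->
  (leb [set z : R | A (u - z)%R] <= leb A)%E.
Proof.
move=> mA.
have mf : measurable_fun setT (fun z : R => u - z) by exact: measurable_funB.
rewrite -[leRHS]mul1e; apply: (@measure_le_leb _ (image_measure leb mf) 1) => // x y xy.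
apply: (@le_trans _ _ (leb `[u - y, u - x])).
  rewrite image_measureE; apply: le_measure; rewrite ?inE.
  - exact: (measurable_pre mf (measurable_itv `]x, y])).
  - exact: measurable_itv.
  by move=> z /=; rewrite !in_itv/= => /andP[]; lra.
rewrite lebE lebesgue_measure_itv/= lte_fin; case: ifPn => _; last by rewrite lee_fin; lra.
by rewrite -EFinB lee_fin; lra.
Qed.

Lemma leb_reflect (u : R) (A : set R) : measurable A ->
  leb [set z | A (u - z)] = leb A.
Proof.
move=> mA; apply/eqP; rewrite eq_le leb_reflect_le//=.
have mf : measurable_fun setT (fun z : R => u - z) by exact: measurable_funB.
have := leb_reflect_le u (measurable_pre mf mA).
rewrite (_ : [set z | _] = A)//; apply/seteqP; split => z /=.
  by rewrite subKr.
by rewrite subKr.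
Qed.

Lemma leb_integral_shift (r : R) (g : R -> \bar R) : measurable_fun setT g ->
  (forall x, 0 <= g x)%E -> (\int[leb]_x g (x + r)%R = \int[leb]_x g x)%E.
Proof.
move=> mg g0.
have mf : measurable_fun setT (fun z : R => z + r) by exact: measurable_funD.
rewrite -(ge0_integral_image leb mf mg g0).
by apply: eq_measure_integral => A mA _; rewrite image_measureE; exact: leb_shift.
Qed.

(** Cover [S] by intervals of total length below [4 / 3] of its measure: if [S] filled less than
    [3 / 4] of each of them, its measure would be smaller than itself. *)
Lemma leb_dense_interval (S : set R) : measurable S -> (0 < leb S)%E -> (leb S < +oo)%E ->
  exists x y : R, x < y /\ ((3 / 4 * (y - x))%:E <= leb (S `&` `]x, y]))%E.
Proof.
move=> mS S0 Soo; apply: contrapT => H.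
have Sfin : leb S \is a fin_num by rewrite ge0_fin_numE.
have [s sE] : exists s, leb S = s%:E by exists (fine (leb S)); rewrite fineK.
have s0 : 0 < s by move: S0; rewrite sE lte_fin.
have : (lebesgue_measure S < (4 / 3 * s)%:E)%E by rewrite -lebE sE lte_fin; lra.
move=> /ereal_inf_lt [_ [A [mA SA] <-]] sumA.
have mA' i : measurable (A i : set R).
  by have [[x y] _ <-] := mA i; exact: measurable_itv.
have step i : (leb (S `&` A i) <= (3 / 4)%:E * wlength idfun (A i))%E.
  have [[x y] _ <-] := mA i.
  have [xy|xy] := ltP x y; last first.
    by rewrite set_itv_ge ?setI0 ?measure0 ?wlength0 ?mule0// bnd_simp -leNgt.
  have [h|/ltW h] := leP (leb (S `&` `]x, y])) (3 / 4 * (y - x))%:E; last first.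
    by exfalso; apply: H; exists x, y.
  apply: le_trans h _; rewrite EFinM; apply: lee_wpmul2l => //.
  by rewrite /= wlength_itv_bnd// ltW.
suff : (leb S <= (3 / 4)%:E * \sum_(0 <= i <oo) wlength idfun (A i))%E.
  apply/negP; rewrite -ltNge sE; apply: (@lt_le_trans _ _ ((3 / 4)%:E * (4 / 3 * s)%:E)%E).
    by rewrite lte_pmul2l// lte_fin; lra.
  by rewrite -EFinM lee_fin; lra.
rewrite -nneseriesZl//.
apply: (@le_trans _ _ (leb (\bigcup_i (S `&` A i)))).
  apply: le_measure; rewrite ?inE//.
    by apply: bigcupT_measurable => i; exact: measurableI.
  by move=> x Sx; have [i _ Aix] := SA _ Sx; exists i.
apply: le_trans (generalized_Boole_inequality _ _ _) _.
- by move=> i; exact: measurableI.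
- by apply: bigcupT_measurable => i; exact: measurableI.
by apply: lee_nneseries => // i _; exact: step.
Qed.

Definition window (n : nat) : set R -> \bar R :=
  mrestr leb (measurable_itv `[(- n%:R)%R, n%:R]).

HB.instance Definition _ n := Measure.on (window n).

Let window_fin n : fin_num_fun (window n).
Proof.
move=> A mA; rewrite ge0_fin_numE//; apply: (@le_lt_trans _ _ (leb `[(- n%:R)%R, n%:R])).
  by apply: le_measure; rewrite ?inE//; exact: measurableI.
by rewrite lebE lebesgue_measure_itv/=; case: ifP => // _; rewrite -EFinB ltry.
Qed.

HB.instance Definition _ n := @Measure_isFinite.Build _ _ _ (window n) (window_fin n).

(** The set is the positive part of a Hahn decomposition of [G] minus [c] times Lebesgue measure on
    a bounded window. Were it Lebesgue null, it would be [G]-null, and [G] would be too small on the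
    window. *)
Lemma leb_minorant (G : {finite_measure set R -> \bar R}) (C : R) : 0 < C -> G setT = 1%E ->
  (forall B, measurable B -> (G B <= C%:E * leb B)%E) ->
  exists S c, [/\ measurable S, 0 < c, (0 < leb S < +oo)%E &
    forall A, measurable A -> (c%:E * leb (A `&` S) <= G A)%E].
Proof.
move=> C0 GT GC.
pose I (n : nat) : set R := `[(- n%:R)%R, n%:R]%classic.
have mI n : measurable (I n) by exact: measurable_itv.
have lebI n : leb (I n) = (2 * n%:R)%:E.
  rewrite lebE lebesgue_measure_itv/= lte_fin; case: ifPn => [_|].
    by rewrite -EFinB; congr EFin; lra.
  by rewrite -leNgt => h; congr EFin; have : 0 <= n%:R :> R by []; lra.
have [n Hn] : exists n, (2^-1%:E <= G (I n))%E.
  apply: (measure_bigcup_ge (mu := G) (F := I)) => //.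
    move=> m n mn; apply/subsetPset => x; rewrite /I/= !in_itv/=.
    have : m%:R <= n%:R :> R by rewrite ler_nat.
    by move=> mn' /andP[]; lra.
  rewrite [ltRHS](_ : _ = 1%E) ?lte_fin; first lra.
  rewrite -GT; congr (G _); apply/seteqP; split => // x _; exists (Num.trunc `|x|).+1 => //=.
  by rewrite /I/= in_itv/= -ler_norml ltW// truncnS_gt.
(* The window has length [2 n], so [c] times its length is below [1 / 4], less than its [G]-mass of
   at least [1 / 2]. *)
pose c : R := (8 * n.+1%:R)^-1.
have c0 : 0 < c by rewrite invr_gt0 mulr_gt0.
have n0 : 0 <= n%:R :> R by [].
pose nu : {charge set R -> \bar R} :=
  cadd (charge_of_finite_measure G) (cscale (- c) (charge_of_finite_measure (window n))).
have nuE A : nu A = (G A + (- c)%:E * leb (A `&` I n))%E by [].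
have [Pos [Neg [[mP HP] [mN HN] PN _]]] := Hahn_decomposition nu.
have lfin A : measurable A -> leb (A `&` I n) \is a fin_num by exact: window_fin.
have HPG A : measurable A -> A `<=` Pos -> (c%:E * leb (A `&` I n) <= G A)%E.
  move=> mA AP; have := HP _ mA AP; rewrite nuE.
  by rewrite EFinN mulNe sube_ge0// fin_numM// lfin.
have HNG A : measurable A -> A `<=` Neg -> (G A <= c%:E * leb (A `&` I n))%E.
  move=> mA AP; have := HN _ mA AP; rewrite nuE.
  by rewrite EFinN mulNe sube_le0.
exists (Pos `&` I n), c; split => //.
- exact: measurableI.
- apply/andP; split; last first.
    apply: (@le_lt_trans _ _ (leb (I n))); last by rewrite lebI ltry.
    by apply: le_measure; rewrite ?inE//; exact: measurableI.
  rewrite lt_neqAle measure_ge0 andbT; apply/eqP => S0.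
  have : (G (I n) <= 4^-1%:E)%E.
    apply: (@le_trans _ _ (G (Pos `&` I n) + G (Neg `&` I n))%E).
      rewrite (_ : G (I n) = G ((Pos `&` I n) `|` (Neg `&` I n))).
        by apply: measureU2; exact: measurableI.
      by rewrite -setIUl PN setTI.
    have -> : G (Pos `&` I n) = 0%E.
      apply/eqP; rewrite -measure_le0.
      apply: le_trans (GC _ _) _; first exact: measurableI.
      by rewrite -S0 mule0.
    rewrite add0e; apply: le_trans (HNG _ _ _) _ => //; first exact: measurableI.
    apply: (@le_trans _ _ (c%:E * leb (I n))%E).
      apply: lee_wpmul2l; first by rewrite lee_fin ltW.
      by apply: le_measure; rewrite ?inE//; apply: measurableI => //; exact: measurableI.
    rewrite lebI -EFinM lee_fin /c mulrC ler_pdivrMr ?mulr_gt0// -natr1; lra.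
  by move/(le_trans Hn); rewrite lee_fin; lra.
move=> A mA.
apply: le_trans (_ : (G (A `&` Pos) <= _)%E); last first.
  by apply: le_measure; rewrite ?inE//; exact: measurableI.
rewrite setIA; apply: HPG => //; exact: measurableI.
Qed.

Lemma integral_mrestr (S : set R) (mS : measurable S) (g : R -> \bar R) : measurable_fun setT g ->
  (forall x, 0 <= g x)%E ->
  (\int[mrestr leb mS]_x g x = \int[leb]_x ((\1_S x)%:E * g x))%E.
Proof.
move=> mg g0; rewrite ge0_integral_mrestr// integral_mkcond; apply: eq_integral => x _.
by rewrite patchE indicE; case: (x \in S); rewrite ?mul1e ?mul0e.
Qed.

(** The lower bound on [g] is inserted into the integral of [g] over [S]. After Tonelli, [g u] is
    weighted by the convolution of the indicator of [S] with itself, which is at least [m] on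
    [I]. *)
Lemma integral_convolution_le (c m : R) (S I : set R) (g : R -> \bar R) : 0 <= c -> 0 <= m ->
  measurable S -> measurable I -> measurable_fun setT g -> (forall x, 0 <= g x)%E ->
  (forall u, I u -> (m%:E <= leb [set z : R | S z /\ S (u - z)%R])%E) ->
  (forall z, (c%:E * \int[leb]_u ((\1_S u)%:E * g (u + z)%R) <= g z)%E) ->
  ((c * c * m)%:E * \int[leb]_u ((\1_I u)%:E * g u) <=
   c%:E * \int[leb]_z ((\1_S z)%:E * g z))%E.
Proof.
move=> c0 m0 mS mI mg g0 HI Hg.
pose k (z u : R) : \bar R := ((\1_S z)%:E * ((\1_S (u - z)%R)%:E * g u))%E.
have i0 (A : set R) z : (0 <= (\1_A z)%:E :> \bar R)%E by rewrite lee_fin.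
have mi (A : set R) : measurable A -> measurable_fun setT (fun z => (\1_A z)%:E : \bar R).
  by move=> mA; apply/measurable_EFinP; exact: measurable_indic.
have k0 z u : (0 <= k z u)%E by rewrite !mule_ge0.
have msub : measurable_fun setT (fun p : R * R => p.2 - p.1) by exact: measurable_funB.
have mk : measurable_fun setT (fun p : R * R => k p.1 p.2).
  apply: emeasurable_funM; first exact: (measurableT_comp (mi S mS)).
  apply: emeasurable_funM; first exact: (measurableT_comp (mi S mS) msub).
  exact: (measurableT_comp mg).
have W u : measurable [set z | S z /\ S (u - z)%R].
  apply: measurableI => //; apply: (measurable_pre (f := fun z : R => u - z) _ mS).
  exact: measurable_funB.
have step1 : (m%:E * \int[leb]_u ((\1_I u)%:E * g u) <= \int[leb]_u \int[leb]_z k z u)%E.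
  rewrite -ge0_integralZl//; last 2 first.
  - by apply: emeasurable_funM; [exact: mi|].
  - by move=> u _; rewrite mule_ge0.
  apply: ge0_le_integral => //.
  - by move=> u _; rewrite !mule_ge0.
  - by apply: emeasurable_funM => //; apply: emeasurable_funM; [exact: mi|].
  - exact: (measurable_fun_fubini_tonelli_G _ mk).
  move=> u _.
  rewrite (_ : \int[leb]_z k z u = leb [set z : R | S z /\ S (u - z)%R] * g u)%E; last first.
    rewrite -(integral_indic_comp leb (@measurable_id _ _ setT) (W u)) -ge0_integralZr//; last exact: mi.
    apply: eq_integral => z _; rewrite /k muleA -EFinM; congr (_%:E * _)%E.
    rewrite !indicE -natrM mulnb; congr (nat_of_bool _)%:R.
    by apply/idP/idP => [/andP[/set_mem ? /set_mem ?]|/set_mem[? ?]];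
      [exact/mem_set|apply/andP; split; exact/mem_set].
  rewrite muleA; apply: lee_wpmul2r => //.
  rewrite indicE; case: (boolP (u \in I)) => [|_]; last by rewrite mule0.
  by rewrite inE mule1 => /HI.
have step2 : (\int[leb]_u \int[leb]_z k z u = \int[leb]_z \int[leb]_u k z u)%E.
  exact/esym/(fubini_tonelli (fun p : R * R => k p.1 p.2) mk (fun p => k0 p.1 p.2)).
have step3 z : (c%:E * \int[leb]_u k z u <= (\1_S z)%:E * g z)%E.
  have mz : measurable_fun setT (fun u : R => (\1_S (u - z)%R)%:E * g u)%E.
    apply: emeasurable_funM; last exact: mg.
    by apply: (measurableT_comp (mi S mS)); exact: measurable_funB.
  have z0 u : (0 <= (\1_S (u - z)%R)%:E * g u)%E by rewrite mule_ge0.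
  have -> : (\int[leb]_u k z u = (\1_S z)%:E * \int[leb]_u ((\1_S (u - z)%R)%:E * g u))%E.
    exact: (ge0_integralZl leb measurableT mz (fun u _ => z0 u) (i0 S z)).
  rewrite muleCA; apply: lee_wpmul2l; first exact: i0.
  rewrite -(leb_integral_shift z mz z0).
  by under eq_integral do rewrite addrK; exact: Hg.
rewrite !EFinM -!muleA; apply: lee_wpmul2l; first by rewrite lee_fin.
apply: le_trans (lee_wpmul2l _ step1) _; first by rewrite lee_fin.
have mk2 : measurable_fun setT (fun z => \int[leb]_u k z u)%E.
  exact: (measurable_fun_fubini_tonelli_F _ mk).
clear mk step1 msub W.
have ik0 z : (0 <= \int[leb]_u k z u)%E by apply: integral_ge0 => u _; exact: k0.
have ce : (0 <= c%:E :> \bar R)%E by rewrite lee_fin.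
rewrite step2 -(ge0_integralZl leb measurableT mk2 (fun z _ => ik0 z) ce).
apply: ge0_le_integral.
- exact: measurableT.
- by move=> z _; exact: mule_ge0.
- by apply: emeasurable_funM; [exact: measurable_cst|exact: mk2].
- by apply: emeasurable_funM; [exact: mi|exact: mg].
- by move=> z _; exact: step3.
Qed.

End lebesgue_tools.

(** * Spreading the lower bound by convolution *)

Section spreading.
Context (R : realType) (d : measure_display) (T : measurableType d).
Variables (P : probability T R) (X : R -> T -> R).
Hypothesis levyX : levy_process P X.
Hypothesis measX : measurable_fun setT (fun p : R * T => X p.1 p.2).
Local Notation leb := (@leb R).
Local Notation tm := (@time_measure R).
Local Notation potential := (potential P measX).
Variable C : R.
Hypothesis C0 : 0 < C.
Hypothesis HC : forall B, measurable B -> (potential B <= C%:E * leb B)%E.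

Definition space_time : set (R * T) -> \bar R := (tm \x P)%E.

HB.instance Definition _ := Measure.on space_time.

Let space_time_sigma_finite : sigma_finite setT space_time.
Proof.
have [Q TQ mQ] := sigma_finiteT tm.
exists (fun n => Q n `*` setT).
  apply/seteqP; split => // -[x w] _.
  by have : setT x by []; rewrite TQ => -[n _ Qx]; exists n.
move=> n; have [mQn Qoo] := mQ n; split; first exact: measurableX.
apply: (@le_lt_trans _ _ (tm (Q n) * P setT)%E).
  by rewrite -product_measure1E.
by rewrite probability_setT mule1.
Qed.

HB.instance Definition _ :=
  Measure_isSigmaFinite.Build _ _ _ space_time space_time_sigma_finite.

(** In measure terms: the convolution of the potential measure with [c] times Lebesgue measure on
    [S] is at most the potential measure. Unlike a pointwise lower bound, this property can be
    iterated. *)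
Definition spreads (c : R) (S : set R) := forall B, measurable B ->
  (c%:E * \int[leb]_z ((\1_S z)%:E * potential [set y : R | B (y + z)%R]) <= potential B)%E.

Let measurable_shift (B : set R) : measurable B ->
  measurable [set q : R * R | B (q.1 + q.2)].
Proof. by move=> mB; apply: (measurable_pre _ mB); exact: measurable_funD. Qed.

Let measurable_translate (B : set R) z : measurable B -> measurable [set y | B (y + z)].
Proof. by move=> mB; apply: (measurable_pre (f := fun y : R => y + z) _ mB); exact: measurable_funD. Qed.

Let F (B : set R) u := potential [set y | B (y + u)].

Let mF B : measurable B -> measurable_fun setT (F B).
Proof. by move=> mB; exact: (measurable_potential_section P measX (measurable_shift mB)). Qed.

Lemma spreads_convolution (c m : R) (S I : set R) : 0 <= c -> 0 <= m -> measurable S -> measurable I ->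
  (forall u, I u -> (m%:E <= leb [set z : R | S z /\ S (u - z)%R])%E) ->
  spreads c S -> spreads (c * c * m) I.
Proof.
move=> c0 m0 mS mI HI HS B mB; apply: le_trans (HS B mB).
apply: (integral_convolution_le c0 m0 mS mI (mF mB) _ HI) => // z.
have FE u : F B (u + z) = F [set y | B (y + z)] u.
  by rewrite /F; apply: congr1; apply/seteqP; split => y /=; rewrite addrA.
under eq_integral do rewrite FE; exact: HS (measurable_translate z mB).
Qed.

(** By independence of increments the left side is the expected time spent in [B] after time [t]. *)
Lemma potential_shift_le t B : 0 <= t -> measurable B ->
  (\int[P]_v F B (X t v) <= potential B)%E.
Proof.
move=> t0 mB.
have := potential_markov levyX measX t0 (measurable_shift mB).
rewrite /F /= => <-.
have mS : measurable [set p : R * T | B (X (t + p.1) p.2)].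
  apply: (measurable_pre _ mB); apply: (measurableT_comp measX (g := fun q : R * T => (t + q.1, q.2))).
  by apply: measurable_fun_pair => //; exact: measurable_funD.
have mH := measurable_hit measX mB.
apply: (@le_trans _ _ (\int[tm]_s P [set w | B (X (t + s) w)])%E).
  rewrite le_eqVlt; apply/orP; left; apply/eqP; apply: eq_integral => s _.
  by congr (P _); apply/seteqP; split => w /=; rewrite [X s w + _]addrC subrK addrC.
rewrite (tonelli_set tm P mS) potentialE// (tonelli_set tm P mH).
apply: ge0_le_integral => //.
- exact: (measurable_measure_snd tm mS).
- exact: (measurable_measure_snd tm mH).
move=> w _; apply: (@le_trans _ _ (tm ([set s | B (X s w)] `&` `[t, +oo[))).
  by rewrite -(time_shift t0 (measurable_snd_section mH w)).
by apply: le_measure; rewrite ?inE; [apply: measurableI => //|..|by move=> s []];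
  exact: (measurable_snd_section mH w).
Qed.

Lemma mean_law_spreads B : measurable B ->
  (\int[mean_law P measX]_z F B z <= potential B)%E.
Proof.
move=> mB.
have F0 u : (0 <= F B u)%E by [].
have mFX : measurable_fun setT (fun p : R * T => F B (X p.1 p.2)).
  exact: (measurableT_comp (mF mB) measX).
rewrite (ge0_integral_image _ measX (mF mB))// (fubini_tonelli1 _ mFX)//.
apply: (@le_trans _ _ (\int[@unit_time R]_t potential B)%E); last first.
  rewrite integral_cst// [X in (_ * X)%E](_ : _ = 1%E); last exact: unit_timeT.
  by rewrite mule1.
apply: ae_ge0_le_integral => //.
- by move=> t _; exact: integral_ge0.
- exact: (measurable_fun_fubini_tonelli_F _ mFX).
exists (`]-oo, 0[%classic : set R); split => //.
  apply: etrans (unit_timeE _) _; rewrite (_ : _ `&` _ = set0) ?measure0//.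
  by apply/seteqP; split => // t [/=]; rewrite !in_itv/= => t0 /andP[]; rewrite leNgt t0.
move=> t /= h; rewrite in_itv/= ltNge; apply/negP => t0; apply: h => _.
exact: potential_shift_le.
Qed.

(** Averaging [potential_shift_le] over [t] in [[0, 1[] makes the averaged law spread the potential
    measure, and this law dominates [c] times Lebesgue measure on some [S] by [leb_minorant]. *)
Lemma exists_spreading_set : exists (S : set R) (c : R),
  [/\ measurable S, 0 < c, (0 < leb S < +oo)%E & spreads c S].
Proof.
have GC B : measurable B -> (mean_law P measX B <= C%:E * leb B)%E.
  move=> mB; apply: le_trans (HC mB); rewrite mean_lawE2// potentialE//.
  have mH := measurable_hit measX mB.
  rewrite (tonelli_set tm P mH); apply: ge0_le_integral => //.
  - exact: (measurable_measure_snd (@unit_time R) mH).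
  - exact: (measurable_measure_snd tm mH).
  move=> w _; rewrite unit_timeE; apply: le_measure; rewrite ?inE; last by move=> s [].
  - by apply: measurableI => //; exact: (measurable_snd_section mH w).
  - exact: (measurable_snd_section mH w).
have [S [c [mS c0 lS HS]]] := leb_minorant C0 (mean_lawT P measX) GC.
exists S, c; split => // B mB.
rewrite -(integral_mrestr mS (mF mB))//.
apply: le_trans (mean_law_spreads mB).
rewrite -lee_pdivlMl//; apply: integral_le_measure (mF mB) _ => //.
  by rewrite invr_ge0 ltW.
by move=> A mA; rewrite lee_pdivlMl//; exact: HS.
Qed.

Lemma spreads_sub (c : R) (S S' : set R) : 0 <= c -> measurable S -> measurable S' -> S' `<=` S ->
  spreads c S -> spreads c S'.
Proof.
move=> c0 mS mS' SS HS B mB; apply: le_trans (HS B mB).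
have mi (A : set R) : measurable A -> measurable_fun setT (fun z => (\1_A z)%:E : \bar R).
  by move=> mA; apply/measurable_EFinP; exact: measurable_indic.
apply: lee_wpmul2l; first by rewrite lee_fin.
apply: ge0_le_integral => //.
- by apply: emeasurable_funM; [exact: mi|exact: (mF mB)].
- by apply: emeasurable_funM; [exact: mi|exact: (mF mB)].
move=> z _; apply: lee_wpmul2r => //; rewrite lee_fin !indicE ler_nat.
by case: (boolP (z \in S')) => // /set_mem /SS /mem_set ->.
Qed.

(** A Steinhaus argument. If [S'] fills [3 / 4] of []x, y]] and [u] is within [l / 4] of [x + y],
    with [l = y - x], then [S'] and its reflection [u - S'] lie in an interval of length at most
    [5 l / 4]; their measures add up to at least [3 l / 2], so they overlap in at least [l / 4]. *)
Lemma exists_spreading_interval : exists c p l : R, [/\ 0 < c, 0 < l & spreads c `[p, p + l]].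
Proof.
have [S [c [mS c0 /andP[S0 Soo] HS]]] := exists_spreading_set.
have [x [y [xy dense]]] := leb_dense_interval mS S0 Soo.
pose S' := S `&` `]x, y].
have mS' : measurable S' by exact: measurableI.
have [l lE] : exists l, l = y - x by exists (y - x).
have l0 : 0 < l by rewrite lE subr_gt0.
exists (c * c * (l / 4)), (x + y - l / 4), (l / 2); split.
- by rewrite !mulr_gt0.
- by rewrite divr_gt0.
apply: (spreads_convolution (S := S')) => //; [exact: ltW|by rewrite divr_ge0// ltW| |]; last first.
  by apply: (spreads_sub (ltW c0) mS mS' _ HS) => z [].
move=> u; rewrite /= in_itv/= => /andP[u1 u2].
have mA' : measurable [set z | S' (u - z)].
  by apply: (measurable_pre (f := fun z : R => u - z) _ mS'); exact: measurable_funB.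
have mI2 : measurable (S' `&` [set z | S' (u - z)]) by exact: measurableI.
have mD2 : measurable (S' `\` [set z | S' (u - z)]) by exact: measurableD.
have fin (A : set R) : measurable A -> A `<=` `[x - l, y + l] -> leb A \is a fin_num.
  move=> mA AI; rewrite ge0_fin_numE//; apply: (@le_lt_trans _ _ (leb `[x - l, y + l])).
    by apply: le_measure; rewrite ?inE.
  by rewrite lebE lebesgue_measure_itv/=; case: ifP => // _; rewrite -EFinB ltry.
have S'I : S' `<=` `[x - l, y + l].
  by move=> z [_] /=; rewrite !in_itv/= => /andP[]; lra.
have A'I : [set z | S' (u - z)] `<=` `[x - l, y + l].
  by move=> z [_] /=; rewrite !in_itv/= => /andP[]; lra.
have EI : leb (S' `&` [set z | S' (u - z)]) \is a fin_num by apply: fin => // z [/S'I].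
have ED : leb (S' `\` [set z | S' (u - z)]) \is a fin_num by apply: fin => // z [/S'I].
have EA : leb S' \is a fin_num by exact: fin.
have sum1 : (leb S' = leb (S' `\` [set z | S' (u - z)%R]) + leb (S' `&` [set z | S' (u - z)%R]))%E.
  exact: measureDI.
have sum2 : (leb (S' `\` [set z | S' (u - z)%R]) + leb [set z | S' (u - z)%R] <= (5 / 4 * l)%:E)%E.
  rewrite -measureU//; last by apply/seteqP; split => // z [[_ h] ?]; exact: h.
  apply: (@le_trans _ _ (leb `[Num.min x (u - y), Num.max y (u - x)])).
    apply: le_measure; rewrite ?inE//; first exact: measurableU.
    have S'z z : S' z -> x < z <= y by case=> _; rewrite /= in_itv/=.
    move=> z [[/S'z/andP[z1 z2] _]|/S'z/andP[z1 z2]]; rewrite /= in_itv/= ge_min le_max.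
      by rewrite (ltW z1) z2.
    by apply/andP; split; apply/orP; right; lra.
  rewrite lebE lebesgue_measure_itv/= lte_fin; case: ifPn => _; last by rewrite lee_fin; lra.
  rewrite -EFinB lee_fin; have [h|h] := leP x (u - y); have [h'|h'] := leP y (u - x); lra.
move: sum2 dense; rewrite (leb_reflect u mS') -/S' sum1.
change (leb [set z | S' z /\ S' (u - z)]) with (leb (S' `&` [set z | S' (u - z)])).
rewrite -(fineK EI) -(fineK ED) -!EFinD !lee_fin; lra.
Qed.

(** The self-convolution of the interval lives on [[2 p, 2 p + 2 l]]; a quarter of [l] is removed at
    each end, so that the overlap stays at least [l / 4]. *)
Lemma spreads_grow (c p l : R) : 0 < c -> 0 < l -> spreads c `[p, p + l] ->
  exists c' p' : R, 0 < c' /\ spreads c' `[p', p' + 3 / 2 * l].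
Proof.
move=> c0 l0 Hs; exists (c * c * (l / 4)), (2 * p + l / 4); split.
  by rewrite !mulr_gt0.
apply: (spreads_convolution (S := `[p, p + l])) => //; [exact: ltW|by rewrite divr_ge0// ltW|].
move=> u; rewrite /= in_itv/= => /andP[u1 u2].
have mW : measurable [set z | `[p, p + l]%classic z /\ `[p, p + l]%classic (u - z)].
  apply: measurableI => //; apply: (measurable_pre (f := fun z : R => u - z) _ (measurable_itv `[p, p + l])).
  exact: measurable_funB.
have [h|h] := leP u (2 * p + l).
  apply: (@le_trans _ _ (leb `[p, u - p])).
    rewrite lebE lebesgue_measure_itv/= lte_fin; case: ifPn => [_|]; last by rewrite -leNgt lee_fin; lra.
    by rewrite -EFinB lee_fin; lra.
  apply: le_measure; rewrite ?inE// => z /=; rewrite !in_itv/= => /andP[]; lra.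
apply: (@le_trans _ _ (leb `[u - p - l, p + l])).
  rewrite lebE lebesgue_measure_itv/= lte_fin; case: ifPn => [_|]; last by rewrite -leNgt lee_fin; lra.
  by rewrite -EFinB lee_fin; lra.
apply: le_measure; rewrite ?inE// => z /=; rewrite !in_itv/= => /andP[]; lra.
Qed.

Lemma spreads_long (L : R) : exists c p l : R, [/\ 0 < c, L <= l & spreads c `[p, p + l]].
Proof.
have [c [p [l [c0 l0 Hs]]]] := exists_spreading_interval.
have iter n : exists c' p' l' : R, [/\ 0 < c', l * (1 + n%:R / 2) <= l' & spreads c' `[p', p' + l']].
  elim: n => [|n [c' [p' [l' [c'0 ll' Hs']]]]]; first by exists c, p, l; split => //; lra.
  have n0 : 0 <= l * (n%:R / 2) by rewrite mulr_ge0// ltW.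
  have [|c2 [p2 [c20 H2]]] := spreads_grow c'0 _ Hs'; first lra.
  by exists c2, p2, (3 / 2 * l'); split => //; rewrite -natr1; lra.
have [c' [p' [l' [c'0 ll' Hs']]]] := iter (Num.trunc (2 * `|L| / l)).+1.
exists c', p', l'; split => //; apply: le_trans ll'.
have := truncnS_gt (2 * `|L| / l); rewrite ltr_pdivrMr//; have := ler_norm L; lra.
Qed.

(** Spreading over [I = [p, p + l]] and Tonelli turn the lower bound into the integral over [x] in
    [B] of the potential of [x - I]. For [l >= K] and [x >= x0 + p + l] this set contains a block of
    length [K] to the right of [x0], of potential at least one half. *)
Lemma potential_ge_leb (K x0 : R) : 0 <= K ->
  (forall x : R, x0 <= x -> (2^-1%:E <= potential `]x, (x + K)%R]%classic)%E) ->
  exists c x1 : R, 0 < c /\ forall B, measurable B -> B `<=` `[x1, +oo[ ->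
    (c%:E * leb B <= potential B)%E.
Proof.
move=> K0 HK; have [c [p [l [c0 Kl Hs]]]] := spreads_long K.
exists (c * 2^-1), (x0 + p + l); split; first by rewrite mulr_gt0// invr_gt0.
move=> B mB Bx1; apply: le_trans (Hs B mB).
rewrite EFinM -muleA; apply: lee_wpmul2l; first by rewrite lee_fin ltW.
set I : set R := `[p, p + l]%classic.
have mI : measurable I by exact: measurable_itv.
have halfB : (2^-1%:E * leb B = \int[leb]_x (2^-1%:E * (\1_B x)%:E))%E.
  have mB1 : measurable_fun setT (fun x => (\1_B x)%:E : \bar R).
    by apply/measurable_EFinP; exact: measurable_indic.
  have B0 x : (0 <= (\1_B x)%:E :> \bar R)%E by rewrite lee_fin.
  have h0 : (0 <= 2^-1%:E :> \bar R)%E by rewrite lee_fin.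
  rewrite (ge0_integralZl leb measurableT mB1 (fun x _ => B0 x) h0).
  by rewrite (integral_indic_comp leb (@measurable_id _ _ setT) mB).
pose V1 := [set q : R * (R * T) | I q.1 /\ B (X q.2.1 q.2.2 + q.1)].
pose V2 := [set q : R * (R * T) | I (q.1 - X q.2.1 q.2.2) /\ B q.1].
have mX2 : measurable_fun setT (fun q : R * (R * T) => X q.2.1 q.2.2).
  exact: (measurableT_comp measX (@measurable_snd _ _ _ _)).
have mV1 : measurable V1.
  apply: measurableI; first exact: (measurable_pre measurable_fst mI).
  by apply: (measurable_pre _ mB); exact: measurable_funD.
have mV2 : measurable V2.
  apply: measurableI; last exact: (measurable_pre measurable_fst mB).
  by apply: (measurable_pre _ mI); exact: measurable_funB.
have E1 : (\int[leb]_z ((\1_I z)%:E * potential [set y : R | B (y + z)%R]) =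
    \int[leb]_z space_time [set q | V1 (z, q)])%E.
  apply: eq_integral => z _; rewrite indicE; case: (boolP (z \in I)) => [/set_mem Iz|/negP nIz].
    by rewrite mul1e; congr (space_time _); apply/seteqP; split => q //= [].
  rewrite mul0e (_ : [set q | _] = set0) ?measure0//.
  by apply/seteqP; split => // q [Iz _]; apply: nIz; exact/mem_set.
have E2 q : leb [set z | V1 (z, q)] = leb [set z | V2 (z, q)].
  rewrite -(leb_shift (X q.1 q.2) (measurable_snd_section mV2 q)); congr (leb _).
  by apply/seteqP; split => z; rewrite /V1 /V2/= addrK addrC.
have E3 : (\int[leb]_z space_time [set q | V1 (z, q)] = \int[leb]_z space_time [set q | V2 (z, q)])%E.
  apply: etrans (tonelli_set leb space_time mV1) _.
  apply: etrans _ (esym (tonelli_set leb space_time mV2)).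
  by apply: eq_integral => q _; exact: E2.
rewrite E1 E3 halfB; clear E1 E2 E3 mV1 mX2 halfB.
apply: ge0_le_integral => //.
- by apply/measurable_EFinP; apply: measurable_funM => //; exact: measurable_indic.
- exact: (measurable_measure_fst space_time mV2).
move=> x _; rewrite indicE; case: (boolP (x \in B)) => [/set_mem Bx|_]; last by rewrite mule0.
rewrite mule1; have := Bx1 _ Bx; rewrite /= in_itv/= andbT => xx.
have x0x : x0 <= x - p - l by lra.
apply: (@le_trans _ _ (space_time [set q | (`](x - p - l)%R, (x - p - l + K)%R]%classic : set R) (X q.1 q.2)])).
  exact: HK x0x.
apply: le_measure; rewrite ?inE.
- exact: (measurable_hit measX (measurable_itv `](x - p - l), (x - p - l + K)])).
- exact: (measurable_fst_section mV2 x).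
by move=> q /=; rewrite in_itv/= /V2/I/= in_itv/= => /andP[q1 q2]; split => //; lra.
Qed.

End spreading.
(** The square [S x S] is covered by its two halves on either side of the diagonal, and Tonelli
    exchanges them. *)
Lemma square_measure_le (R : realType) (mu : {sigma_finite_measure set R -> \bar R})
  (S : set R) : measurable S ->
  (mu S * mu S <= 2%:E * \int[mu]_s mu [set r : R | [/\ S s, S r & (s <= r)%R]])%E.
Proof.
move=> mS.
pose V := [set p : R * R | [/\ S p.1, S p.2 & p.1 <= p.2]].
pose V' := [set p : R * R | [/\ S p.1, S p.2 & p.2 <= p.1]].
have mS1 : measurable [set p : R * R | S p.1] by exact: (measurable_pre measurable_fst mS).
have mS2 : measurable [set p : R * R | S p.2] by exact: (measurable_pre measurable_snd mS).
have mV : measurable V.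
  rewrite (_ : V = [set p | S p.1] `&` [set p | S p.2] `&` [set p | p.1 <= p.2]).
    by apply: measurableI; [exact: measurableI|exact: measurable_le_set].
  by apply/seteqP; split => p [] => [? ? ?|[? ?] ?]; do !split.
have mV' : measurable V'.
  rewrite (_ : V' = [set p | S p.1] `&` [set p | S p.2] `&` [set p | p.2 <= p.1]).
    by apply: measurableI; [exact: measurableI|exact: measurable_le_set].
  by apply/seteqP; split => p [] => [? ? ?|[? ?] ?]; do !split.
have mi : measurable_fun setT (fun s => (\1_S s)%:E : \bar R).
  by apply/measurable_EFinP; exact: measurable_indic.
have i0 s : (0 <= (\1_S s)%:E :> \bar R)%E by rewrite lee_fin.
have -> : (mu S * mu S = \int[mu]_s ((\1_S s)%:E * mu S))%E.
  rewrite (ge0_integralZr mu measurableT mi (fun s _ => i0 s) (measure_ge0 mu S)).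
  by rewrite (integral_indic_comp mu (@measurable_id _ _ setT) mS).
have mf := measurable_measure_fst mu mV; have mf' := measurable_measure_fst mu mV'.
apply: (@le_trans _ _ (\int[mu]_s (mu [set r | V (s, r)] + mu [set r | V' (s, r)]))%E).
  apply: ge0_le_integral.
  - exact: measurableT.
  - by move=> s _; exact: mule_ge0.
  - by apply: emeasurable_funM => //; exact: measurable_cst.
  - exact: emeasurable_funD.
  move=> s _; rewrite indicE; case: (boolP (s \in S)) => [/set_mem Ss|_]; last first.
    by rewrite mul0e adde_ge0.
  rewrite mul1e; apply: le_trans (measureU2 _ _ _).
  - apply: le_measure; rewrite ?inE//.
      by apply: measurableU; exact: measurable_fst_section.
    by move=> r Sr; case: (leP s r) => [|/ltW] sr; [left|right].
  - exact: (measurable_fst_section mV s).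
  - exact: (measurable_fst_section mV' s).
rewrite (ge0_integralD mu measurableT (fun s _ => measure_ge0 mu _) mf (fun s _ => measure_ge0 mu _) mf').
rewrite (_ : \int[mu]_x mu [set r | V' (x, r)] = \int[mu]_x mu [set r | V (x, r)])%E.
  by rewrite -mule2n mule_natl.
apply: etrans (tonelli_set mu mu mV') _; apply: eq_integral => r _; congr (mu _).
by apply/seteqP; split => s [].
Qed.

Section restricted_probability.
Context d (T : measurableType d) (R : realType) (P : probability T R).
Variables (E : set T) (mE : measurable E).

Definition restricted : set T -> \bar R := mrestr P mE.

HB.instance Definition _ := Measure.on restricted.

Let restricted_fin : fin_num_fun restricted.
Proof. by move=> A mA; exact: (fin_num_measure P _ (measurableI _ _ mA mE)). Qed.

HB.instance Definition _ := @Measure_isFinite.Build _ _ _ restricted restricted_fin.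

End restricted_probability.

(** * Second moments of occupation times *)

Section lower_bound.
Context (R : realType) (d : measure_display) (T : measurableType d).
Variables (P : probability T R) (X : R -> T -> R).
Hypothesis levyX : levy_process P X.
Hypothesis measX : measurable_fun setT (fun p : R * T => X p.1 p.2).
Local Notation leb := (@leb R).
Local Notation tm := (@time_measure R).
Local Notation potential := (potential P measX).
Variable C : R.
Hypothesis C0 : 0 < C.
Hypothesis HC : forall B, measurable B -> (potential B <= C%:E * leb B)%E.

Let A (B : set R) w := tm [set s | B (X s w)].

Let measurable_A B : measurable B -> measurable_fun setT (A B).
Proof. by move=> mB; exact: (measurable_measure_snd tm (measurable_hit measX mB)). Qed.

Let visits B w s := tm [set r : R | [/\ B (X s w), B (X r w) & (s <= r)%R]].

(** Given [X s] in [B], the expected time in [B] after [s] is the potential of a translate of [B],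
    which has the same Lebesgue measure [b]. *)
Let visits_mean B s (b : R) : measurable B -> leb B = b%:E -> 0 <= s ->
  (\int[P]_w visits B w s <= (C * b)%:E * P [set w | B (X s w)])%E.
Proof.
move=> mB lB s0.
have b0 : 0 <= b by rewrite -lee_fin -lB.
pose W := [set q : (R * rseq R) * R | B q.1.1 /\ B (q.1.1 + path_at q.1.2 q.2)].
have mW : measurable W.
  apply: measurableI.
    exact: (measurable_pre (measurableT_comp measurable_fst measurable_fst) mB).
  apply: (measurable_pre _ mB); apply: measurable_funD.
    exact: (measurableT_comp measurable_fst measurable_fst).
  apply: (measurableT_comp (@measurable_path_at R) (g := fun q : (R * rseq R) * R => (q.1.2, q.2))).
  apply: measurable_fun_pair => //.
  exact: (measurableT_comp measurable_snd measurable_fst).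
have mH := measurable_measure_fst tm mW.
have HE w : (visits B w s = tm [set t | W ((X s w, future X s w), t)])%E.
  have mS : measurable [set s | B (X s w)] by exact: (measurable_snd_section (measurable_hit measX mB) w).
  have [Bs|nBs] := pselect (B (X s w)); last first.
    by rewrite /visits; apply: congr1; apply/seteqP; split => t [] /nBs.
  transitivity (tm ([set r | B (X r w)] `&` `[s, +oo[)).
    congr (tm _); apply/seteqP; split => r /=; rewrite in_itv/= andbT.
      by move=> [].
    by move=> [].
  rewrite -(time_shift s0 mS) !time_measureE; congr (leb _).
  apply/seteqP; split => t /=; rewrite /W/= in_itv/= andbT.
    by move=> [Bt t0]; rewrite (path_at_future levyX)// [_ + (_ - _)]addrC subrK.
  by move=> [[_]] /[swap] t0; rewrite (path_at_future levyX)// [_ + (_ - _)]addrC subrK.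
have mF0 := measurable_future levyX (lexx 0).
have mXs := measurable_levy levyX s0.
pose K (p : T * T) := tm [set t | W ((X s p.1, future X 0 p.2), t)].
have mK : measurable_fun setT K.
  apply: (measurableT_comp mH (g := fun p : T * T => (X s p.1, future X 0 p.2))).
  apply: measurable_fun_pair; first exact: (measurableT_comp mXs measurable_fst).
  exact: (measurableT_comp mF0 measurable_snd).
have mIK : measurable_fun setT (fun w => \int[P]_v K (w, v))%E.
  exact: (measurable_fun_fubini_tonelli_F K mK (fun=> measure_ge0 _ _)).
have mi : measurable_fun setT (fun w => (\1_B (X s w))%:E : \bar R).
  by apply/measurable_EFinP; apply: measurableT_comp => //; exact: measurable_indic.
have i0 w : (0 <= (\1_B (X s w))%:E :> \bar R)%E by rewrite lee_fin.
have c0 : (0 <= (C * b)%:E :> \bar R)%E by rewrite lee_fin mulr_ge0// ltW.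
have KE w : (\int[P]_v K (w, v) <= (C * b)%:E * (\1_B (X s w))%:E)%E.
  rewrite indicE; case: (boolP (X s w \in B)) => [/set_mem Bs|/negP nBs]; last first.
    rewrite mule0 le_eqVlt; apply/orP; left; apply/eqP; apply: integral0_eq => v _.
    rewrite /K (_ : [set t | _] = set0) ?measure0//.
    by apply/seteqP; split => // t [/mem_set /nBs].
  have mB' : measurable [set y | B (X s w + y)].
    by apply: (measurable_pre (f := fun y : R => X s w + y) _ mB); exact: measurable_funD.
  have lB' : leb [set y | B (X s w + y)] = b%:E.
    rewrite -lB -(leb_shift (X s w) mB); apply: congr1.
    by apply/seteqP; split => y /=; rewrite addrC.
  rewrite mule1 EFinM -lB'; apply: le_trans (HC mB').
  rewrite (potentialE _ _ mB') (tonelli_set tm P (measurable_hit measX mB')).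
  rewrite le_eqVlt; apply/orP; left; apply/eqP; apply: eq_integral => v _.
  rewrite /K; apply: (@etrans _ _ (leb ([set t | W ((X s w, future X 0 v), t)] `&` `[0%R, +oo[))) => //.
  apply: (@etrans _ _ (leb ([set t | B (X s w + X t v)%R] `&` `[0%R, +oo[))) => //.
  apply: congr1; apply/seteqP; split => t /=; rewrite /W/= in_itv/= andbT.
    by move=> [[_]] /[swap] t0; rewrite (path_at_future0 levyX).
  by move=> [Bt t0]; rewrite (path_at_future0 levyX).
under eq_integral do rewrite HE.
rewrite (markov_property levyX s0 mH (fun=> measure_ge0 _ _)).
rewrite -(integral_indic_comp P mXs mB).
rewrite -(ge0_integralZl P measurableT mi (fun w _ => i0 w) c0).
apply: ge0_le_integral.
- exact: measurableT.
- by move=> w _; exact: integral_ge0.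
- exact: mIK.
- by apply: emeasurable_funM => //; exact: measurable_cst.
- by move=> w _; exact: KE.
Qed.

(** Twice the mean of ordered pairs of visits: each first visit costs [C b] by [visits_mean], and
    the mean time of first visits is the potential of [B], at most [C b] again. *)
Lemma occupation_second_moment B (b : R) : measurable B -> leb B = b%:E ->
  (\int[P]_w (A B w * A B w) <= (2 * (C * b) ^+ 2)%:E)%E.
Proof.
move=> mB lB.
have b0 : 0 <= b by rewrite -lee_fin -lB.
have mS w : measurable [set s | B (X s w)] by exact: (measurable_snd_section (measurable_hit measX mB) w).
pose V := [set q : (R * T) * R | [/\ B (X q.1.1 q.1.2), B (X q.2 q.1.2) & q.1.1 <= q.2]].
have mV : measurable V.
  rewrite (_ : V = [set q | B (X q.1.1 q.1.2)] `&` [set q | B (X q.2 q.1.2)] `&` [set q | q.1.1 <= q.2]).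
    apply: measurableI; last first.
      apply: measurable_le_set => //.
      exact: (measurableT_comp measurable_fst measurable_fst).
    apply: measurableI; first exact: (measurable_pre measurable_fst (measurable_hit measX mB)).
    apply: (measurable_pre _ mB).
    apply: (measurableT_comp measX (g := fun q : (R * T) * R => (q.2, q.1.2))).
    apply: measurable_fun_pair => //.
    exact: (measurableT_comp measurable_snd measurable_fst).
  by apply/seteqP; split => p [] => [? ? ?|[? ?] ?]; do !split.
have mv := measurable_measure_fst tm mV.
have mF := measurable_fun_fubini_tonelli_F (m2 := P) _ mv (fun=> measure_ge0 _ _).
have mG := measurable_fun_fubini_tonelli_G (m1 := tm) _ mv (fun=> measure_ge0 _ _).
have mP := measurable_measure_fst P (measurable_hit measX mB).
have mA := measurable_A mB.
have G0 w : (0 <= \int[tm]_s visits B w s)%E by apply: integral_ge0.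
have c0 : (0 <= (C * b)%:E :> \bar R)%E by rewrite lee_fin mulr_ge0// ltW.
apply: (@le_trans _ _ (\int[P]_w (2%:E * \int[tm]_s visits B w s))%E).
  apply: ge0_le_integral.
  - exact: measurableT.
  - by move=> w _; exact: mule_ge0.
  - exact: emeasurable_funM.
  - by apply: emeasurable_funM; [exact: measurable_cst|exact: mG].
  - by move=> w _; exact: square_measure_le (mS w).
rewrite (ge0_integralZl P measurableT mG (fun w _ => G0 w)); last by rewrite lee_fin.
rewrite EFinM; apply: lee_wpmul2l; first by rewrite lee_fin.
rewrite -[leLHS](fubini_tonelli _ mv (fun=> measure_ge0 _ _)).
apply: (@le_trans _ _ (\int[tm]_s ((C * b)%:E * P [set w | B (X s w)]))%E).
  apply: le_time_integral.
  - exact: mF.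
  - by apply: emeasurable_funM; [exact: measurable_cst|exact: mP].
  - by move=> s; apply: integral_ge0.
  - by move=> s; exact: mule_ge0.
  - by move=> s s0; exact: visits_mean.
rewrite (ge0_integralZl tm measurableT mP (fun s _ => measure_ge0 _ _) c0).
rewrite expr2 (EFinM (C * b) (C * b)); apply: lee_wpmul2l => //.
by rewrite -(potentialE P measX mB) EFinM -lB; exact: HC.
Qed.

Variables (c x1 : R).
Hypothesis c0 : 0 < c.
Hypothesis Hc : forall B, measurable B -> B `<=` `[x1, +oo[ -> (c%:E * leb B <= potential B)%E.

(** Chosen with [rare] so that the time lost outside an event of probability at least [1 - rare] is
    at most [kappa b rare + 2 (C b)^2 / (kappa b) = c b / 4 + c b / 4], half of the lower bound
    [c b]. *)
Let kappa := 8 * C ^+ 2 / c.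

Let kappa0 : 0 < kappa.
Proof. by rewrite divr_gt0// mulr_gt0// exprn_gt0. Qed.

Definition rare := c / (4 * kappa).

Lemma rare_gt0 : 0 < rare.
Proof. by rewrite divr_gt0// mulr_gt0. Qed.

Section likely_event.
Variable E : set T.
Hypothesis mE : measurable E.
Hypothesis PE : (P (~` E) <= rare%:E)%E.

Let nu : {measure set R -> \bar R} := image_measure (tm \x restricted P mE)%E measX.

Let nuE B : measurable B -> (nu B = \int[P]_(w in E) A B w)%E.
Proof.
move=> mB; rewrite -(ge0_integral_mrestr P mE (measurable_A mB) (fun=> measure_ge0 _ _)).
transitivity (\int[tm]_s restricted P mE [set w | B (X s w)])%E.
  rewrite /nu image_measureE /product_measure1; apply: eq_integral => s _.
  by apply: (congr1 (restricted P mE)); apply/seteqP; split => w; rewrite /xsection/= inE.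
exact: (tonelli_set tm (restricted P mE) (measurable_hit measX mB)).
Qed.

(* [A <= kappa b + A^2 / (kappa b)] controls the occupation time outside [E] by the
   second moment. *)
Let nu_ge B (b : R) : measurable B -> B `<=` `[x1, +oo[ -> leb B = b%:E ->
  ((c / 2 * b)%:E <= nu B)%E.
Proof.
move=> mB Bx lB; have b0 : 0 <= b by rewrite -lee_fin -lB.
have mA := measurable_A mB.
have A0 w : (0 <= A B w)%E by [].
have mEC : measurable (~` E) by exact: measurableC.
move: b0; rewrite le_eqVlt => /predU1P[<-|b0]; first by rewrite mulr0.
have kb0 : 0 < kappa * b by exact: mulr_gt0.
have outside : (\int[P]_(w in ~` E) A B w <= (c / 2 * b)%:E)%E.
  have mAA : measurable_fun setT (fun w => A B w * A B w)%E by exact: emeasurable_funM.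
  have AA0 w : (0 <= A B w * A B w)%E by exact: mule_ge0.
  have k0 : (0 <= ((kappa * b)^-1)%:E :> \bar R)%E by rewrite lee_fin invr_ge0 ltW.
  have mkA : measurable_fun setT (fun w => ((kappa * b)^-1)%:E * (A B w * A B w))%E.
    by apply: emeasurable_funM => //; exact: measurable_cst.
  have kA0 w : (0 <= ((kappa * b)^-1)%:E * (A B w * A B w))%E by exact: mule_ge0.
  apply: (@le_trans _ _ (\int[P]_(w in ~` E) ((kappa * b)%:E + ((kappa * b)^-1)%:E * (A B w * A B w)))%E).
    apply: ge0_le_integral.
    - exact: mEC.
    - by move=> w _.
    - exact: measurable_funTS.
    - by apply: measurable_funTS; apply: emeasurable_funD => //; exact: measurable_cst.
    move=> w _; have := A0 w; case: (A B w) => [r r0||] //; last first.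
      by move=> _; rewrite mulyy gt0_muley ?lte_fin ?invr_gt0// addey ?leey.
    rewrite -!EFinM -EFinD lee_fin; have [rk|kr] := leP r (kappa * b).
      by rewrite (le_trans rk)// lerDl mulr_ge0 ?invr_ge0 ?(ltW kb0)// -expr2 sqr_ge0.
    apply: ler_wpDl; first exact: ltW.
    rewrite mulrCA -[leLHS]mulr1 ler_wpM2l//.
    by rewrite mulrC ler_pdivlMr// mul1r ltW.
  have kbE : (0 <= (kappa * b)%:E :> \bar R)%E by rewrite lee_fin ltW.
  rewrite (ge0_integralD P mEC (fun w _ => kbE) (measurable_cst _) (fun w _ => kA0 w) (measurable_funTS mkA)).
  rewrite integral_cst//.
  apply: (@le_trans _ _ ((kappa * b)%:E * rare%:E + ((kappa * b)^-1)%:E * (2 * (C * b) ^+ 2)%:E)%E).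
    apply: leeD; first by apply: lee_wpmul2l => //; rewrite lee_fin ltW.
    apply: (@le_trans _ _ (\int[P]_w (((kappa * b)^-1)%:E * (A B w * A B w)))%E).
      by apply: ge0_subset_integral.
    rewrite (ge0_integralZl P measurableT mAA (fun w _ => AA0 w) k0).
    by apply: lee_wpmul2l => //; exact: occupation_second_moment.
  rewrite -!EFinM -EFinD lee_fin /rare le_eqVlt; apply/orP; left; apply/eqP.
  rewrite /kappa; field; rewrite !gt_eqF//.
have nufin : (nu B < +oo)%E.
  apply: (@le_lt_trans _ _ (C * b)%:E); last exact: ltry.
  rewrite EFinM -lB; apply: le_trans (HC mB); rewrite nuE// (potentialE P measX mB).
  rewrite (tonelli_set tm P (measurable_hit measX mB)).
  exact: ge0_subset_integral.
have : ((c * b)%:E <= nu B + (c / 2 * b)%:E)%E.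
  rewrite EFinM -lB; apply: le_trans (Hc mB Bx) _.
  rewrite (potentialE P measX mB) (tonelli_set tm P (measurable_hit measX mB)).
  rewrite -(setUv E) ge0_integral_setU//; last 2 first.
  - by rewrite setUv.
  - by apply/disj_setPS; rewrite setICr.
  by rewrite nuE//; apply: leeD.
move: nufin; have : (0 <= nu B)%E by []; case: (nu B) => // r _ _.
by rewrite -EFinD !lee_fin; lra.
Qed.

(** The occupation measure restricted to [E] still dominates [c / 2] times Lebesgue measure to the
    right of [x1]. Bounded windows [J n] come first, because [nu_ge] is stated for sets of finite
    measure. *)
Lemma tail_integral_le (f : R -> \bar R) (M : R) : measurable_fun setT f -> (forall x, 0 <= f x)%E ->
  (\int[P]_(w in E) \int[tm]_s f (X s w) <= M%:E)%E ->
  (\int[leb]_(x in `[x1, +oo[) f x <= (2 / c * M)%:E)%E.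
Proof.
move=> mf f0 fM.
pose J (n : nat) : set R := `[x1, (x1 + n%:R)%R]%classic.
have mJ n : measurable (J n) by exact: measurable_itv.
have Jx n : J n `<=` `[x1, +oo[ by move=> x /=; rewrite !in_itv/= andbT => /andP[].
have c20 : 0 <= 2 / c by rewrite divr_ge0// ltW.
have HJ n : (\int[leb]_(x in J n) f x <= (2 / c * M)%:E)%E.
  rewrite -(ge0_integral_mrestr leb (mJ n) mf f0).
  apply: (@le_trans _ _ ((2 / c)%:E * \int[nu]_x f x)%E).
    apply: integral_le_measure => // B mB.
    have mBJ : measurable (B `&` J n) by exact: measurableI.
    have [b bE] : exists b, leb (B `&` J n) = b%:E.
      exists (fine (leb (B `&` J n))); rewrite fineK// ge0_fin_numE//.
      apply: (@le_lt_trans _ _ (leb (J n))); first by apply: le_measure; rewrite ?inE.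
      by rewrite lebE lebesgue_measure_itv/=; case: ifP => // _; rewrite -EFinB ltry.
    apply: (@le_trans _ _ ((2 / c)%:E * nu (B `&` J n))%E); last first.
      by apply: lee_wpmul2l; [rewrite lee_fin|apply: le_measure; rewrite ?inE].
    apply: (@le_trans _ _ ((2 / c)%:E * (c / 2 * b)%:E)%E); last first.
      apply: lee_wpmul2l; first by rewrite lee_fin.
      by apply: nu_ge => // x [_ /Jx].
    rewrite [leLHS](_ : _ = b%:E); last exact: bE.
    by rewrite -EFinM lee_fin; rewrite le_eqVlt; apply/orP; left; apply/eqP; field; rewrite gt_eqF.
  rewrite (EFinM (2 / c) M); apply: lee_wpmul2l; first by rewrite lee_fin.
  apply: le_trans fM.
  rewrite -(ge0_integral_mrestr P mE); last 2 first.
  - exact: (measurable_perpetual measX mf f0).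
  - by move=> w; exact: integral_ge0.
  rewrite (ge0_integral_image _ measX mf f0).
  have mfX : measurable_fun setT (fun p : R * T => f (X p.1 p.2)) by exact: (measurableT_comp mf).
  rewrite le_eqVlt; apply/orP; left; apply/eqP.
  exact: (fubini_tonelli2 _ mfX (fun p => f0 (X p.1 p.2))).
have ndJ : nondecreasing_seq J.
  move=> i j ij; apply/subsetPset => x; rewrite /J/= !in_itv/= => /andP[-> xi] /=.
  by rewrite (le_trans xi)// lerD2l ler_nat.
have JU : \bigcup_n J n = `[x1, +oo[%classic.
  apply/seteqP; split => [x [n _ /Jx]//|x]; rewrite /= in_itv/= andbT => x1x.
  exists (Num.trunc (x - x1)).+1 => //; rewrite /J/= in_itv/= x1x/=.
  by rewrite -lerBlDl ltW// truncnS_gt.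
have := @ge0_nondecreasing_set_cvg_integral _ _ _ J f leb ndJ mJ
  (fun _ => measurable_funTS mf) (fun _ _ _ => f0 _).
rewrite JU => cJ.
by apply: cvge_le cJ; apply: nearW => n; exact: HJ.
Qed.

End likely_event.

Lemma tail_integrable (f : R -> R) (M : R) : measurable_fun setT f -> (forall x, 0 <= f x) -> 0 <= M ->
  (1 - rare%:E <= P [set w | \int[tm]_s (f (X s w))%:E <= M%:E])%E ->
  (\int[leb]_(x in `[x1, +oo[) (f x)%:E < +oo)%E.
Proof.
move=> mf f0 M0 PM.
have mf' : measurable_fun setT (fun x => (f x)%:E : \bar R) by exact/measurable_EFinP.
have f0' x : (0 <= (f x)%:E :> \bar R)%E by rewrite lee_fin.
have mp := measurable_perpetual measX mf' f0'.
set E := [set w | _] in PM.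
have mE : measurable E by rewrite -(setTI E); exact: emeasurable_fun_infty_c.
have PE : (P (~` E) <= rare%:E)%E.
  rewrite probability_setC//; move: PM; rewrite -(fineK (fin_num_measure P _ mE)).
  by rewrite -!EFinB !lee_fin; lra.
have p0 w : (0 <= \int[tm]_s (f (X s w))%:E)%E by exact: integral_ge0.
apply: (@le_lt_trans _ _ (2 / c * M)%:E); last exact: ltry.
apply: (tail_integral_le mE PE mf' f0').
apply: (@le_trans _ _ (\int[P]_(w in E) M%:E)%E).
  apply: ge0_le_integral.
  - exact: mE.
  - by move=> w _; exact: p0.
  - exact: measurable_funTS.
  - exact: measurable_cst.
  - by move=> w.
rewrite integral_cst// -[leRHS]mule1; apply: lee_wpmul2l; first by rewrite lee_fin.
exact: probability_le1.
Qed.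

End lower_bound.

(** * Approximation by cylinder events and the dichotomy *)

Section approximation.
Context (R : realType) (m : {finite_measure set (rseq R) -> \bar R}).

Definition depends_on_first (n : nat) (A : set (rseq R)) := measurable A /\
  forall y y' : rseq R, (forall i, (i < n)%N -> y i = y' i :> R) -> A y -> A y'.

Definition approximable (E : set (rseq R)) := measurable E /\
  forall e : R, 0 < e -> exists n A, depends_on_first n A /\
    (m ((E `\` A) `|` (A `\` E)) <= e%:E)%E.

Let mSD (E A : set (rseq R)) : measurable E -> measurable A ->
  measurable ((E `\` A) `|` (A `\` E)).
Proof. by move=> mE mA; apply: measurableU; exact: measurableD. Qed.

Lemma approximable_cylinder A : cylinder A -> approximable A.
Proof.
move=> cA; have mA := measurable_cylinder cA.
split => // e e0; have [n [B [mB AE]]] := cA; exists n, A; split.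
  split => // y y' yy'; rewrite AE => Ay i ii; rewrite /= -yy'//; exact: Ay.
by rewrite setDv setU0 measure0 lee_fin ltW.
Qed.

Lemma approximable_setC E : approximable E -> approximable (~` E).
Proof.
move=> [mE HE]; split => [|e e0]; first exact: measurableC.
have [n [A [[mA HA] EA]]] := HE e e0; exists n, (~` A); split.
  split; first exact: measurableC.
  by move=> y y' yy' nA Ay'; apply: nA; apply: HA Ay' => i ii; rewrite yy'.
rewrite (_ : _ `|` _ = (E `\` A) `|` (A `\` E))//.
by apply/seteqP; split => y [] [h1 h2]; [right|left|right|left]; split => //; exact: contrapT.
Qed.

Lemma approximable_setU E E' : approximable E -> approximable E' -> approximable (E `|` E').
Proof.
move=> [mE HE] [mE' HE']; split => [|e e0]; first exact: measurableU.
have e2 : 0 < e / 2 by rewrite divr_gt0.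
have [n [A [[mA HA] EA]]] := HE _ e2; have [n' [A' [[mA' HA'] EA']]] := HE' _ e2.
exists (maxn n n'), (A `|` A'); split.
  split; first exact: measurableU.
  move=> y y' yy' [Ay|Ay]; [left; apply: HA Ay|right; apply: HA' Ay] => i ii;
    by apply: yy'; rewrite leq_max ii ?orbT.
apply: (@le_trans _ _ (m (((E `\` A) `|` (A `\` E)) `|` ((E' `\` A') `|` (A' `\` E'))))).
  apply: le_measure; rewrite ?inE.
  - by apply: mSD; exact: measurableU.
  - by apply: measurableU; exact: mSD.
  move=> y [[[Ey|Ey] nA]|[[Ay|Ay] nE]].
  - by left; left; split => // h; apply: nA; left.
  - by right; left; split => // h; apply: nA; right.
  - by left; right; split => // h; apply: nE; left.
  - by right; right; split => // h; apply: nE; right.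
apply: le_trans (measureU2 _ _ _) _; [exact: mSD|exact: mSD|].
by apply: le_trans (leeD EA EA') _; rewrite -EFinD lee_fin; lra.
Qed.

(** A finite partial union misses at most [e / 2] of the mass and is itself approximable within
    [e / 2]. *)
Lemma approximable_bigcup (F : nat -> set (rseq R)) : (forall n, approximable (F n)) ->
  approximable (\bigcup_n F n).
Proof.
move=> HF; have mU : measurable (\bigcup_n F n) by apply: bigcupT_measurable => n; have [] := HF n.
split => // e e0.
pose G k := \bigcup_(i in [set i | (i <= k)%N]) F i.
have aG k : approximable (G k).
  elim: k => [|k IH].
    by rewrite /G (_ : \bigcup_(_ in _) _ = F 0%N)//; apply/seteqP; split => [y [i /=]|y Fy];
      [rewrite leqn0 => /eqP ->|exists 0%N].
  rewrite (_ : G k.+1 = G k `|` F k.+1); first exact: approximable_setU.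
  apply/seteqP; split => [y [i /=]|y [[i /= ik Fy]|Fy]].
  - by rewrite leq_eqVlt ltnS => /orP[/eqP -> Fy|ik Fy]; [right|left; exists i].
  - by exists i => //=; exact: leqW.
  - by exists k.+1 => /=.
have mG k : measurable (G k) by have [] := aG k.
have GU : \bigcup_k G k = \bigcup_n F n.
  apply/seteqP; split => [y [k _ [i _ Fy]]|y [i _ Fy]]; first by exists i.
  by exists i => //; exists i => /=.
have [u uE] : exists u, m (\bigcup_n F n) = u%:E.
  by exists (fine (m (\bigcup_n F n))); rewrite fineK// fin_num_measure.
have [k Hk] : exists k, ((u - e / 2)%:E <= m (G k))%E.
  apply: (measure_bigcup_ge (mu := m) (F := G)) => // [i j ij|].
    by apply/subsetPset => y [l /= li Fy]; exists l => //=; exact: leq_trans ij.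
  by rewrite [ltRHS](etrans (congr1 m GU) uE) lte_fin; lra.
have e2 : 0 < e / 2 by rewrite divr_gt0.
have [_ HG] := aG k; have [n [A [[mA HA] GA]]] := HG _ e2.
exists n, A; split => //.
have GF : G k `<=` \bigcup_n F n by move=> y [i _ Fy]; exists i.
have mUG : measurable (\bigcup_n F n `\` G k) by exact: measurableD.
have UG : (m (\bigcup_n F n `\` G k) <= (e / 2)%:E)%E.
  have [v vE] : exists v, m (G k) = v%:E.
    by exists (fine (m (G k))); rewrite fineK// fin_num_measure.
  have Uoo : (m (\bigcup_n F n) < +oo)%E by rewrite uE ltry.
  have -> : (m (\bigcup_n F n `\` G k) = m (\bigcup_n F n) - m (\bigcup_n F n `&` G k))%E.
    exact: measureD.
  by rewrite (setIidr GF) uE vE -EFinB lee_fin; move: Hk; rewrite vE lee_fin; lra.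
apply: (@le_trans _ _ (m ((\bigcup_n F n `\` G k) `|` ((G k `\` A) `|` (A `\` G k))))).
  apply: le_measure; rewrite ?inE.
  - exact: mSD.
  - by apply: measurableU => //; exact: mSD.
  move=> y [[Uy nA]|[Ay nU]].
    by have [Gy|nGy] := pselect (G k y); [right; left|left].
  by right; right; split => // /GF.
apply: le_trans (measureU2 _ _ _) _; [by []|exact: mSD|].
by apply: le_trans (leeD UG GA) _; rewrite -EFinD lee_fin; lra.
Qed.

Lemma measurable_approximable E : measurable E -> approximable E.
Proof.
move: E; apply: smallest_sub; last exact: approximable_cylinder.
split.
- by apply: approximable_cylinder; exists 1%N, (fun=> set0); split=> //; apply/seteqP; split => // y /(_ 0%N isT).
- by move=> A /approximable_setC; rewrite setTD.
- exact: approximable_bigcup.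
Qed.

End approximation.

(** * Changing the starting point *)

Section shifted.
Context (R : realType) (d : measure_display) (T : measurableType d).
Variables (P : probability T R) (X : R -> T -> R).
Hypothesis levyX : levy_process P X.
Hypothesis measX : measurable_fun setT (fun p : R * T => X p.1 p.2).
Local Notation tm := (@time_measure R).
Variable f : R -> R.
Hypothesis mf : measurable_fun setT f.
Hypothesis f0 : forall x, 0 <= f x.

(** Starting point and increments are kept apart: the Markov property keeps the first and resamples
    the second. *)
Let J : set (R * rseq R) := [set p | (\int[tm]_s (f (p.1 + path_at p.2 s)%R)%:E < +oo)%E].

Let mJ : measurable J.
Proof.
have mg : measurable_fun setT (fun q : (R * rseq R) * R => (f (q.1.1 + path_at q.1.2 q.2))%:E : \bar R).
  apply/measurable_EFinP; apply: (measurableT_comp mf); apply: measurable_funD.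
    exact: (measurableT_comp measurable_fst measurable_fst).
  apply: (measurableT_comp (@measurable_path_at R) (g := fun q : (R * rseq R) * R => (q.1.2, q.2))).
  apply: measurable_fun_pair => //.
  exact: (measurableT_comp measurable_snd measurable_fst).
have g0 (q : (R * rseq R) * R) : (0 <= (f (q.1.1 + path_at q.1.2 q.2))%:E :> \bar R)%E.
  by rewrite lee_fin.
have := measurable_fun_fubini_tonelli_F (m2 := tm) _ mg g0.
by move=> mF; rewrite -(setTI J); exact: emeasurable_fun_infty_o.
Qed.

Let mXw := measurable_path measX.

Let mfX x w : measurable_fun setT (fun s => (f (x + X s w))%:E : \bar R).
Proof.
apply/measurable_EFinP; apply: (measurableT_comp mf).
by apply: measurable_funD => //; exact: mXw.
Qed.

Let mpath := @measurable_path_at_r R.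

Let J_future0 x w : J (x, future X 0 w) <-> (\int[tm]_s (f (x + X s w)%R)%:E < +oo)%E.
Proof.
rewrite /J/= (@eq_time_integral _ _ (fun s => (f (x + X s w))%:E)) => [||//|||].
- by [].
- by apply/measurable_EFinP; apply: (measurableT_comp mf); apply: measurable_funD.
- by move=> s; rewrite lee_fin.
- by move=> s; rewrite lee_fin.
- by move=> s s0; rewrite (path_at_future0 levyX).
Qed.

Let J_shift r w : 0 <= r -> J (0, future X 0 w) -> J (X r w, future X r w).
Proof.
move=> r0 /J_future0 h; apply: le_lt_trans h.
have mr : measurable_fun setT (fun s : R => r + s) by exact: measurable_funD.
apply: (@le_trans _ _ (\int[tm]_s (f (0 + X (r + s) w)%R)%:E)%E).
  apply: le_time_integral.
  - by apply/measurable_EFinP; apply: (measurableT_comp mf); apply: measurable_funD.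
  - exact: (measurableT_comp (mfX 0 w) mr).
  - by move=> s; rewrite lee_fin.
  - by move=> s; rewrite lee_fin.
  - by move=> s s0; rewrite (path_at_future levyX)//= [X r w + _]addrC subrK add0r.
have fX0 s : (0 <= (f (0 + X s w)%R)%:E :> \bar R)%E by rewrite lee_fin.
rewrite -(ge0_integral_image tm mr (mfX 0 w) fX0) -[leRHS]mul1e.
apply: integral_le_measure => // B mB; rewrite mul1e.
apply: (@le_trans _ _ (tm (B `&` `[r, +oo[))); first by rewrite -(time_shift r0 mB).
by apply: le_measure; rewrite ?inE//; exact: measurableI.
Qed.

Let early n : exists N : nat, forall i, (i < n)%N -> dyadic R i <= N%:R.
Proof.
elim: n => [|n [N HN]]; first by exists 0%N.
exists (maxn N (Num.trunc (dyadic R n)).+1) => i; rewrite ltnS leq_eqVlt => /orP[/eqP ->|/HN h].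
  by apply: ltW; apply: lt_le_trans (truncnS_gt _) _; rewrite ler_nat leq_maxr.
by apply: le_trans h _; rewrite ler_nat leq_maxl.
Qed.

Let law : set (rseq R) -> \bar R := image_measure P (measurable_future levyX (lexx 0)).

HB.instance Definition _ := Measure.on law.

Let law_fin : fin_num_fun law.
Proof.
move=> A mA; apply: fin_num_measure.
exact: (measurable_pre (measurable_future levyX (lexx 0)) mA).
Qed.

HB.instance Definition _ := @Measure_isFinite.Build _ _ _ law law_fin.

(** The event [A] is decided by some time [N]. A finite integral is finite after [N] as well, and
    given the past that has probability at most [q], whatever the position [X N]. *)
Lemma shift_almost_surely_finite (q : R) : 0 <= q ->
  (forall x, (P [set w | (\int[tm]_s (f (x + X s w)%R)%:E < +oo)%E] <= q%:E)%E) ->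
  forall n A, depends_on_first n A ->
  (law ([set y : rseq R | J (0%R, y)] `&` A) <= q%:E * law A)%E.
Proof.
move=> q0 Hq n A [mA HA]; have [N HN] := early n.
pose r : R := N%:R; have r0 : 0 <= r by [].
pose i0 := dyadic_index 0 N.
have i0E : dyadic R i0 = r by rewrite dyadic_indexK expr0 divr1.
pose W := [set p : rseq R * rseq R | A p.1 /\ J (p.1 i0, p.2)].
have mW : measurable W.
  apply: measurableI; first exact: (measurable_pre measurable_fst mA).
  apply: (measurable_pre _ mJ); apply: measurable_fun_pair => //.
  exact: (measurableT_comp (measurable_coord i0) measurable_fst).
have past_early w i : (i < n)%N -> past X r w i = future X 0 w i.
  by move=> ii; rewrite /past /future add0r (levy0 levyX) subr0 min_l// HN.
have past_i0 w : past X r w i0 = X r w by rewrite /past i0E minxx.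
have mPast := measurable_past levyX r0.
have mFut := measurable_future levyX r0.
have mFut0 := measurable_future levyX (lexx 0).
apply: (@le_trans _ _ (P [set w | W (past X r w, future X r w)])).
  rewrite [leLHS](_ : _ = P [set w | J (0%R, future X 0 w) /\ A (future X 0 w)])//.
  apply: le_measure; rewrite ?inE.
  - apply: measurableI; last exact: (measurable_pre mFut0 mA).
    by apply: (measurable_pre (f := fun w => (0 : R, future X 0 w)) _ mJ); exact: measurable_fun_pair.
  - by apply: (measurable_pre _ mW); exact: measurable_fun_pair.
  move=> w [/= J0 Aw]; split => /=.
    by apply: HA Aw => i ii; rewrite past_early.
  by rewrite past_i0; exact: J_shift.
have mI : measurable_fun setT (fun p => (\1_W p)%:E : \bar R).
  by apply/measurable_EFinP; exact: measurable_indic.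
have I0 p : (0 <= (\1_W p)%:E :> \bar R)%E by rewrite lee_fin.
rewrite -(integral_indic_comp P (measurable_fun_pair mPast mFut) mW) (markov_past levyX r0 mI I0).
have mA1 : measurable [set w | A (past X r w)] by exact: (measurable_pre mPast mA).
have -> : (law A = P [set w | A (past X r w)])%E.
  rewrite /law image_measureE; congr (P _); apply/seteqP; split => w.
    by apply: HA => i ii; rewrite past_early.
  by apply: HA => i ii; rewrite past_early.
have mIA : measurable_fun setT (fun w => (\1_A (past X r w))%:E : \bar R).
  by apply/measurable_EFinP; apply: (measurableT_comp _ mPast); exact: measurable_indic.
have IA0 w : (0 <= (\1_A (past X r w))%:E :> \bar R)%E by rewrite lee_fin.
have qE : (0 <= q%:E :> \bar R)%E by rewrite lee_fin.
rewrite -(integral_indic_comp P mPast mA) -(ge0_integralZl P measurableT mIA (fun w _ => IA0 w) qE).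
apply: ge0_le_integral.
- exact: measurableT.
- by move=> w _; exact: integral_ge0.
- have mK : measurable_fun setT (fun p : T * T => (\1_W (past X r p.1, future X 0 p.2))%:E : \bar R).
    apply: (measurableT_comp mI (g := fun p : T * T => (past X r p.1, future X 0 p.2))).
    apply: measurable_fun_pair; first exact: (measurableT_comp mPast measurable_fst).
    exact: (measurableT_comp mFut0 measurable_snd).
  exact: (measurable_fun_fubini_tonelli_F _ mK (fun p => I0 _)).
- by apply: emeasurable_funM; [exact: measurable_cst|exact: mIA].
move=> w _.
rewrite (integral_indic_comp P (g := fun v => (past X r w, future X 0 v)) _ mW); last first.
  by apply: measurable_fun_pair.
rewrite indicE; case: (boolP (past X r w \in A)) => [_|/negP nA]; last first.
  rewrite mule0 (_ : [set v | _] = set0) ?measure0//.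
  by apply/seteqP; split => // v [/mem_set /nA].
rewrite mule1; apply: le_trans (Hq (X r w)).
apply: le_measure; rewrite ?inE.
- by apply: (measurable_pre (f := fun v => (past X r w, future X 0 v)) _ mW); exact: measurable_fun_pair.
- rewrite (_ : [set v | _] = [set v | J (X r w, future X 0 v)]).
    by apply: (measurable_pre (f := fun v => (X r w, future X 0 v)) _ mJ); exact: measurable_fun_pair.
  by apply/seteqP; split => v /J_future0.
by move=> v [_ /=]; rewrite past_i0 => /J_future0.
Qed.

(** If every starting point had probability at most [1 - delta], the event of a finite integral
    would have conditional probability at most [1 - delta] given any event of finitely many
    coordinates, even one that nearly coincides with it. *)
Lemma exists_shift (delta : R) : 0 < delta ->
  (0 < P [set w | (\int[tm]_s (f (X s w))%:E < +oo)%E])%E ->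
  exists x, ((1 - delta)%:E <= P [set w | (\int[tm]_s (f (x + X s w)%R)%:E < +oo)%E])%E.
Proof.
move=> d0 p0; apply: contrapT => /forallNP H.
have Hq x : (P [set w | (\int[tm]_s (f (x + X s w)%R)%:E < +oo)%E] <= (1 - delta)%:E)%E.
  by apply/ltW; rewrite ltNge; apply/negP; exact: H.
have q0 : 0 <= 1 - delta by rewrite -lee_fin; apply: le_trans (Hq 0).
pose E := [set y | J (0, y)].
have mE : measurable E.
  by apply: (measurable_pre (f := fun y : rseq R => (0 : R, y)) _ mJ); exact: measurable_fun_pair.
have [p pE] : exists p, law E = p%:E by exists (fine (law E)); rewrite fineK// law_fin.
have {}p0 : 0 < p.
  rewrite -lte_fin -pE; move: p0; congr (_ < P _)%E.
  apply/seteqP; split => w /=.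
    by move=> h; apply/J_future0; under eq_integral do rewrite add0r.
  by move=> /J_future0; under eq_integral do rewrite add0r.
(* With this error the bounds read [p - delta p / 4 <= (1 - delta) (p + delta p / 4)], which is
   false for positive [p] and [delta]. *)
have e0 : 0 < delta * p / 4 by rewrite divr_gt0// mulr_gt0.
have [_ /(_ _ e0) [n [A [HA EA]]]] := measurable_approximable law mE.
have mA : measurable A by have [] := HA.
have := shift_almost_surely_finite q0 Hq HA; rewrite -/E.
have [u uE] : exists u, law A = u%:E by exists (fine (law A)); rewrite fineK// law_fin.
have mEA : measurable (E `&` A) by exact: measurableI.
have [v vE] : exists v, law (E `&` A) = v%:E by exists (fine (law (E `&` A))); rewrite fineK// law_fin.
have mD : measurable ((E `\` A) `|` (A `\` E)) by apply: measurableU; exact: measurableD.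
have pv : p <= v + delta * p / 4.
  rewrite -lee_fin EFinD -pE -vE; apply: le_trans (leeD (lexx _) EA).
  apply: le_trans (measureU2 _ mEA mD); apply: le_measure; rewrite ?inE//.
    exact: measurableU.
  by move=> y Ey; have [Ay|nAy] := pselect (A y); [left|right; left].
have up : u <= p + delta * p / 4.
  rewrite -lee_fin EFinD -pE -uE; apply: le_trans (leeD (lexx _) EA).
  apply: le_trans (measureU2 _ mE mD); apply: le_measure; rewrite ?inE//.
    exact: measurableU.
  by move=> y Ay; have [Ey|nEy] := pselect (E y); [left|right; right].
rewrite uE vE -EFinM lee_fin => vu.
have := ler_wpM2l q0 up; nra.
Qed.

End shifted.

(** * The two implications *)

Section dichotomy.
Context (R : realType) (d : measure_display) (T : measurableType d).
Variables (P : probability T R) (X : R -> T -> R).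
Hypothesis levyX : levy_process P X.
Hypothesis measX : measurable_fun setT (fun p : R * T => X p.1 p.2).
Hypothesis intX : P.-integrable setT (EFin \o X 1).
Hypothesis meanX : (0 < \int[P]_w (X 1 w)%:E)%E.
Hypothesis LT : has_local_times P X.
Local Notation leb := (@leb R).
Local Notation tm := (@time_measure R).
Local Notation potential := (potential P measX).

Let drift : exists a : R, 0 < a /\
  (\int[P]_w (Num.max (a - X 1 w) 0)%:E < \int[P]_w (Num.max (X 1 w - a) 0)%:E)%E.
Proof.
have fin : (\int[P]_w (X 1 w)%:E)%E \is a fin_num by exact: integrable_fin_num intX.
have [m mE] : exists m, (\int[P]_w (X 1 w)%:E)%E = m%:E.
  by exists (fine (\int[P]_w (X 1 w)%:E)%E); rewrite fineK.
have m0 : 0 < m by rewrite -lte_fin -mE.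
(* Any slope strictly between 0 and the mean would serve. *)
exists (m / 2); split; first by rewrite divr_gt0.
by apply: mean_gap intX _; rewrite mE lte_fin; lra.
Qed.

Lemma perpetual_integral_ae_finite (f : R -> R) : measurable_fun setT f -> (forall x, 0 <= f x) ->
  (forall c : R, \int[leb]_(x in `[c, +oo[) (f x)%:E < +oo)%E ->
  P [set w | (\int[tm]_s (f (X s w))%:E < +oo)%E] = 1%E.
Proof.
move=> mf f0 foo; have [a [a0 gap]] := drift.
have [C [C0 HC]] := potential_le_leb levyX measX a0 gap LT.
have mf' : measurable_fun setT (fun x => (f x)%:E : \bar R) by exact/measurable_EFinP.
have f0' x : (0 <= (f x)%:E :> \bar R)%E by rewrite lee_fin.
apply: probability_ae.
  have mp := measurable_perpetual measX mf' f0'.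
  by rewrite -(setTI [set w | _]); exact: emeasurable_fun_infty_o.
exact: (perpetual_finite_ae levyX a0 gap C0 HC mf f0 foo).
Qed.

Lemma perpetual_integral_tail (f : R -> R) : measurable_fun setT f -> (forall x, 0 <= f x) ->
  (0 < P [set w | (\int[tm]_s (f (X s w))%:E < +oo)%E])%E ->
  exists a : R, (\int[leb]_(x in `[a, +oo[) (f x)%:E < +oo)%E.
Proof.
move=> mf f0 p0; have [a [a0 gap]] := drift.
have [C [C0 HC]] := potential_le_leb levyX measX a0 gap LT.
have [K [x0 [K0 block]]] := potential_block levyX a0 gap C0 HC intX.
have [c [x1 [c0 Hc]]] := potential_ge_leb levyX C0 HC K0 block.
have rare0 : 0 < rare C c by exact: rare_gt0.
(* Half of [rare] is spent on the shift that makes the integral finite, the other half on the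
   passage from a finite integral to one bounded by a fixed [M]. *)
have r20 : 0 < rare C c / 2 by rewrite divr_gt0.
have [x Hx] := exists_shift levyX measX mf f0 r20 p0.
pose g y := f (x + y).
have mg : measurable_fun setT g by apply: measurableT_comp => //; exact: measurable_funD.
have mg' : measurable_fun setT (fun y => (g y)%:E : \bar R) by exact/measurable_EFinP.
have g0' y : (0 <= (g y)%:E :> \bar R)%E by rewrite lee_fin; exact: f0.
pose F (M : nat) := [set w | (\int[tm]_s (g (X s w))%:E <= M%:R%:E)%E].
have mp := measurable_perpetual measX mg' g0'.
have mF M : measurable (F M) by rewrite -(setTI (F M)); exact: emeasurable_fun_infty_c.
have [M HM] : exists M, (1 - (rare C c)%:E <= P (F M))%E.
  apply: (measure_bigcup_ge (mu := P) (F := F)) => // [i j ij|].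
    by apply/subsetPset => w h; apply: le_trans h _; rewrite lee_fin ler_nat.
  have FU : [set w | (\int[tm]_s (f (x + X s w)%R)%:E < +oo)%E] `<=` \bigcup_M F M.
    move=> w; rewrite /= => h.
    have i0 : (0 <= \int[tm]_s (g (X s w))%:E)%E by exact: integral_ge0.
    exists (Num.trunc (fine (\int[tm]_s (g (X s w))%:E))).+1 => //; rewrite /F/=.
    by rewrite -[leLHS]fineK ?ge0_fin_numE// lee_fin ltW// truncnS_gt.
  have : (P [set w | (\int[tm]_s (f (x + X s w)%R)%:E < +oo)%E] <= P (\bigcup_M F M))%E.
    apply: le_measure; rewrite ?inE//; last exact: bigcupT_measurable.
    by rewrite -(setTI [set w | _]); exact: (emeasurable_fun_infty_o _ mp).
  by apply: lt_le_trans; apply: lt_le_trans Hx; rewrite -EFinB lte_fin; lra.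
have := @tail_integrable _ _ _ _ _ levyX measX C C0 HC c x1 c0 Hc g M%:R mg (fun y => f0 _) (ler0n _ _) HM.
move=> tailg; exists (x + x1); apply: le_lt_trans tailg.
pose D : set R := `[x + x1, +oo[%classic.
have mD : measurable D by exact: measurable_itv.
have mf' : measurable_fun setT (EFin \o f) by exact/measurable_EFinP.
rewrite [leLHS]integral_mkcond -(leb_integral_shift x); last 2 first.
- by apply/(measurable_restrictT _ mD); exact: measurable_funTS.
- by move=> y; rewrite patchE; case: ifP => // _; rewrite lee_fin.
rewrite [leRHS]integral_mkcond le_eqVlt; apply/orP; left; apply/eqP.
apply: eq_integral => y _; rewrite !patchE /g addrC.
by congr (if _ then _ else _); apply/idP/idP; rewrite !inE/= !in_itv/= !andbT lerD2l.
Qed.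

End dichotomy.

(** * Negative times and the theorem *)

Section nonnegative_times.
Context (R : realType) (d : measure_display) (T : measurableType d).
Variables (P : probability T R) (X : R -> T -> R).
Hypothesis levyX : levy_process P X.

(** Values of [X] at negative times are arbitrary, so [X] need not be jointly measurable on the
    whole line. Freezing the path before time 0 repairs this and changes nothing at nonnegative
    times. *)
Definition stopped_before0 s w := X (Num.max s 0) w.

Local Notation Y := stopped_before0.

Let YE s w : 0 <= s -> Y s w = X s w.
Proof. by move=> s0; rewrite /stopped_before0 max_l. Qed.

Lemma stopped_before0_levy : levy_process P Y.
Proof.
have [X0 mX cX sX iX] := levyX; split.
- by move=> w; rewrite YE.
- move=> t t0; rewrite (_ : Y t = X t); first exact: mX.
  by apply/funext => w; exact: YE.
- move=> w t t0; have [cr cl] := cX w t t0; split.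
    rewrite YE//; apply: cvg_trans cr; apply: near_eq_cvg; near=> s.
    by rewrite YE// (le_trans t0)// ltW//; near: s; exact: nbhs_right_gt.
  move=> t1; have /cvg_ex[l cvl] := cl t1.
  apply/cvg_ex; exists l; apply: cvg_trans cvl; apply: near_eq_cvg; near=> s.
  by rewrite YE// ltW//; near: s; exact: nbhs_left_gt.
- move=> s t B s0 t0 mB; under eq_set do rewrite !YE ?addr_ge0//.
  by rewrite sX//; under [in RHS]eq_set do rewrite YE//.
- move=> n tt B tt0 ttm mB.
  have ttge i : (i <= n)%N -> 0 <= tt i.
    by elim: i => // i IH ii; apply: le_trans (IH (ltnW ii)) (ttm _ ii).
  transitivity (P (\bigcap_(i in [set i | (i < n)%N])
               [set w | X (tt i.+1) w - X (tt i) w \in B i])).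
    congr (P _); apply: eq_bigcapr => i /= ii.
    by apply/seteqP; split => w /=; rewrite !YE ?ttge// ltnW.
  rewrite iX//; apply: eq_bigr => i _; congr (P _).
  by apply/seteqP; split => w /=; rewrite !YE ?ttge// ltnW.
Unshelve. all: by end_near. Qed.

(** Right continuity expresses [Y] through [path_at] applied to the dyadic values, and [path_at] is
    jointly measurable. *)
Lemma measurable_stopped_before0 : measurable_fun setT (fun p : R * T => Y p.1 p.2).
Proof.
rewrite (_ : (fun p => _) = (fun p : R * T => path_at (future X 0 p.2) (Num.max p.1 0))).
  apply: (measurableT_comp (@measurable_path_at R) (g := fun p : R * T => (future X 0 p.2, Num.max p.1 0))).
  apply: measurable_fun_pair; last exact: measurable_maxr.
  exact: (measurableT_comp (measurable_future levyX (lexx 0)) measurable_snd).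
by apply/funext => p; rewrite (path_at_future0 levyX)// le_max lexx orbT.
Qed.

Lemma stopped_before0_local_times : has_local_times P X -> has_local_times P Y.
Proof.
move=> [L [mL HL]]; exists L; split => // g mg g0 gM.
apply: filterS (HL g mg g0 gM) => w H t t0; rewrite -H//.
by apply: eq_integral => s; rewrite inE/= in_itv/= => /andP[s0 _]; rewrite YE.
Qed.

Lemma perpetual_finite_stopped (f : R -> R) : measurable_fun setT f -> (forall x, 0 <= f x) ->
  perpetual_finite X f = [set w | (\int[@time_measure R]_s (f (Y s w))%:E < +oo)%E].
Proof.
move=> mf f0; apply/seteqP.
have E w : (\int[lebesgue_measure]_(s in `[0%R, +oo[) (f (X s w))%:E =
    \int[@time_measure R]_s (f (Y s w))%:E)%E.
  have mY : measurable_fun setT (fun s => (f (Y s w))%:E : \bar R).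
    apply/measurable_EFinP; apply: (measurableT_comp mf).
    apply: (measurableT_comp measurable_stopped_before0 (g := fun s => (s, w))).
    exact: measurable_fun_pair.
  rewrite integral_time//; last by move=> s; rewrite lee_fin.
  rewrite ge0_integral_leb//; last 2 first.
  - exact: measurable_funTS.
  - by move=> s _; rewrite lee_fin.
  by apply: eq_integral => s; rewrite inE/= in_itv/= andbT => s0; rewrite YE.
by split => w; rewrite /perpetual_finite /= E.
Qed.

End nonnegative_times.

Theorem theorem1 (R : realType) (d : measure_display) (T : measurableType d)
    (P : probability T R) (X : R -> T -> R) (f : R -> R) :
  levy_process P X ->
  P.-integrable setT (EFin \o X 1) ->
  (0 < \int[P]_w (X 1 w)%:E)%E ->
  has_local_times P X ->
  ~ compound_poisson P X ->
  measurable_fun setT f -> (forall x, 0 <= f x) ->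
  locally_integrable setT f ->
  [/\ P (perpetual_finite X f) = 0%E \/ P (perpetual_finite X f) = 1%E,
      P (perpetual_finite X f) = 1%E <->
        exists a : R, (\int[lebesgue_measure]_(x in `[a, +oo[) (f x)%:E < +oo)%E,
      P (perpetual_finite X f) = 0%E <->
        exists a : R, (\int[lebesgue_measure]_(x in `[a, +oo[) (f x)%:E = +oo)%E
    & P (perpetual_finite X f) = 0%E <->
        forall a : R, (\int[lebesgue_measure]_(x in `[a, +oo[) (f x)%:E = +oo)%E].
Proof.
move=> levyX intX meanX LT _ mf f0 locf.
rewrite (perpetual_finite_stopped levyX mf f0).
set Y := stopped_before0 X; set p := P _.
have levyY := stopped_before0_levy levyX.
have measY := measurable_stopped_before0 levyX.
have LTY := stopped_before0_local_times LT.
have Y1 : Y 1 = X 1 by apply/funext => w; rewrite /Y /stopped_before0 max_l.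
have intY : P.-integrable setT (EFin \o Y 1) by rewrite Y1.
have meanY : (0 < \int[P]_w (Y 1 w)%:E)%E by rewrite Y1.
have mf' D : measurable_fun D (EFin \o f).
  by apply: measurable_funTS; exact/measurable_EFinP.
have f0' x : (0 <= (f x)%:E :> \bar R)%E by rewrite lee_fin.
have tailE (a : R) : (\int[@leb R]_(x in `[a, +oo[) (f x)%:E =
    \int[lebesgue_measure]_(x in `[a, +oo[) (f x)%:E)%E.
  by rewrite ge0_integral_leb.
(* Local integrability bounds the integral over [[b, a]], so finiteness of the tail does not depend
   on where it starts. *)
have tail (a b : R) : (\int[@leb R]_(x in `[a, +oo[) (f x)%:E < +oo)%E ->
    (\int[@leb R]_(x in `[b, +oo[) (f x)%:E < +oo)%E.
  move=> fa; apply: (@le_lt_trans _ _ (\int[@leb R]_(x in `[b, a[ `|` `[a, +oo[) (f x)%:E)%E).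
    apply: ge0_subset_integral => //; first exact: measurableU.
    move=> x /=; rewrite !in_itv/= !andbT => bx.
    by case: (ltP x a) => xa; [left; rewrite bx|right].
  rewrite ge0_integral_setU//; last first.
    apply/disj_setPS => x [] /=; rewrite !in_itv/= andbT => /andP[_ xa].
    by rewrite leNgt xa.
  apply: lte_add_pinfty fa.
  have [_ _ /(_ `[b, a]%classic (@subsetT _ _) (@segment_compact _ _ _))] := locf.
  apply: le_lt_trans; apply: (@le_trans _ _ (\int[@leb R]_(x in `[b, a]) (f x)%:E)%E).
    apply: ge0_subset_integral => // x /=; rewrite !in_itv/= => /andP[-> xa] /=.
    exact: ltW.
  rewrite ge0_integral_leb// le_eqVlt; apply/orP; left; apply/eqP.
  by apply: eq_integral => x _; rewrite ger0_norm.
(* All four claims follow from two implications: a finite tail gives probability 1, and positive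
   probability gives a finite tail. *)
have fin_p1 a : (\int[@leb R]_(x in `[a, +oo[) (f x)%:E < +oo)%E -> p = 1%E.
  by move=> fa; apply: (perpetual_integral_ae_finite levyY measY intY meanY LTY mf f0) => c; exact: tail fa.
have pos_fin : (0 < p)%E -> exists a : R, (\int[@leb R]_(x in `[a, +oo[) (f x)%:E < +oo)%E.
  exact: (perpetual_integral_tail levyY measY intY meanY LTY mf f0).
have p0 : (0 <= p)%E by exact: measure_ge0.
have p_cases : p = 0%E \/ exists a : R, (\int[@leb R]_(x in `[a, +oo[) (f x)%:E < +oo)%E.
  by move: p0; rewrite le_eqVlt => /orP[/eqP <-|/pos_fin]; [left|right].
have one0 : 1%E <> 0%E :> \bar R by move=> -[] /eqP; rewrite oner_eq0.
have inf_p0 a : (\int[@leb R]_(x in `[a, +oo[) (f x)%:E = +oo)%E -> p = 0%E.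
  move=> fa; case: p_cases => // -[b /(tail _ a)]; by rewrite fa ltxx.
have p0_inf a : p = 0%E -> (\int[@leb R]_(x in `[a, +oo[) (f x)%:E = +oo)%E.
  move=> pz; apply/eqP; rewrite -leye_eq leNgt; apply/negP => /fin_p1 p1.
  by apply: one0; rewrite -p1.
split.
- by case: p_cases => [|[a /fin_p1]]; [left|right].
- split=> [p1|[a]]; last by rewrite -tailE => /fin_p1.
  by case: p_cases => [|[a fa]]; [rewrite p1 => /one0|exists a; rewrite -tailE].
- split=> [/(p0_inf 0) h|[a]]; first by exists 0; rewrite -tailE.
  by rewrite -tailE => /inf_p0.
- split=> [pz a|/(_ 0)]; first by rewrite -tailE; exact: p0_inf.
  by rewrite -tailE => /inf_p0.
Qed.
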